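(* Let $\varepsilon=1/N$, $x=yN$ and $n=zN$. For $0<z<1$ and $Y^{-}(z)<y<Y^{+}(z)$, as $N\to\infty$, $$K_n(x)\sim K^{+}(y,z)+K^{-}(y,z).$$
   Context: Fix real $0<p,q<1$ with $p+q=1$. For integers $n,N\ge 0$ and real $x$, the Krawtchouk polynomial is $$K_n(x)=K_n(x,N,p,q)=\sum_{k=0}^{n}\binom{x}{k}\binom{N-x}{n-k}q^{k}(-p)^{n-k},$$ where $\binom{a}{k}=a(a-1)\cdots(a-k+1)/k!$ for real $a$ and integer $k\geq 0$. For $0<z<1$ put $$U_0(z)=\sqrt{\frac{pq(1-z)}{z}},\qquad Y^{\pm}(z)=p+(q-p)z\pm 2zU_0(z),$$ $$U^{\pm}(y,z)=-\frac12\left(\frac{p-y}{z}+q-p\right)\pm\frac12\sqrt{\left(\frac{p-y}{z}+q-p\right)^2-4U_0(z)^2},$$ which for $Y^-(z)<y<Y^+(z)$ are complex conjugates, $U^{+}$ being the one with positive imaginary part; $$\psi^{\pm}(y,z)=(z-1)\ln U^{\pm}+(1-y)\ln(U^{\pm}-p)+y\ln(U^{\pm}+q),$$ $$L^{\pm}(y,z)=\sqrt{\frac{(U^{\pm}-p)(U^{\pm}+q)}{z\left[(U^{\pm})^2-U_0^2\right]}},\qquad K^{\pm}(y,z)=\frac{\varepsilon^{1/2}}{\sqrt{2\pi}}\exp\left[\varepsilon^{-1}\psi^{\pm}(y,z)\right]L^{\pm}(y,z),$$ with $U^{\pm}=U^{\pm}(y,z)$ and principal branches of the logarithms and square roots.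 *)

(* Defs.v *)
From HB Require Import structures.
From mathcomp Require Import all_boot all_order all_algebra.
From mathcomp Require Import all_classical all_reals all_analysis.
From mathcomp Require Import complex.

Set Implicit Arguments.
Unset Strict Implicit.
Unset Printing Implicit Defensive.

Import Order.TTheory GRing.Theory Num.Theory.
Import numFieldNormedType.Exports.

Local Open Scope classical_set_scope.
Local Open Scope ring_scope.
Local Open Scope complex_scope.

(* The mathcomp-real-closed projections, not those of numClosedFieldType. *)
Local Notation Re := complex.Re.
Local Notation Im := complex.Im.

Section Complex.
Variable R : realType.
Implicit Types (z : R[i]).

Definition cabs z : R := Re `|z|.

(* Principal argument of z != 0, with values in ]-pi, pi]. *)
Definition carg z : R :=
  if 0 <= Im z then acos (Re z / cabs z) else - acos (Re z / cabs z).

Definition clog z : R[i] := ln (cabs z) +i* carg z.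

Definition cexp z : R[i] :=
  (expR (Re z) * cos (Im z)) +i* (expR (Re z) * sin (Im z)).

End Complex.

Section Krawtchouk.
Variable R : realType.
Implicit Types (a x y z p q eps : R).

Definition rbinom a (k : nat) : R := (\prod_(i < k) (a - i%:R)) / (k`!)%:R.

Definition krawtchouk p q (N n : nat) x : R :=
  \sum_(k < n.+1)
    rbinom x k * rbinom (N%:R - x) (n - k) * q ^+ k * (- p) ^+ (n - k).

Definition U0 p q z : R := Num.sqrt (p * q * (1 - z) / z).

Definition Yplus p q z : R := p + (q - p) * z + 2 * z * U0 p q z.
Definition Yminus p q z : R := p + (q - p) * z - 2 * z * U0 p q z.

(* Below, s stands for the sign in the superscript and is only used with the
   values 1 and -1. The function sqrtc is the principal square root
   (nonnegative real part, and sqrtc (- r) = 'i * sqrt r for r >= 0). *)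

Definition U (s : R) p q y z : R[i] :=
  let b := (p - y) / z + q - p in
  - (b / 2)%:C + (s / 2)%:C * sqrtc (b ^+ 2 - 4 * U0 p q z ^+ 2)%:C.

Definition psi (s : R) p q y z : R[i] :=
  let u := U s p q y z in
  (z - 1)%:C * clog u + (1 - y)%:C * clog (u - p%:C) + y%:C * clog (u + q%:C).

Definition L (s : R) p q y z : R[i] :=
  let u := U s p q y z in
  sqrtc ((u - p%:C) * (u + q%:C) / (z%:C * (u ^+ 2 - (U0 p q z ^+ 2)%:C))).

Definition K (s : R) p q eps y z : R[i] :=
  (Num.sqrt eps / Num.sqrt (2 * pi))%:C
  * cexp ((eps^-1)%:C * psi s p q y z) * L s p q y z.

Definition Kplus : R -> R -> R -> R -> R -> R[i] := K 1.
Definition Kminus : R -> R -> R -> R -> R -> R[i] := K (-1).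

End Krawtchouk.

(* The compound asymptotic relation f ~ g + h between sequences, i.e.
   f = g (1 + o(1)) + h (1 + o(1)). It is not f / (g + h) --> 1: g and h are
   meant to be oscillating terms of the same size, whose sum may be arbitrarily
   small, or zero, compared to each of them. *)
Definition asymp_sum (R : realType) (f g h : nat -> R[i]) : Prop :=
  (fun k => cabs (f k - (g k + h k)))
    =o_\oo (fun k => cabs (g k) + cabs (h k)).

(* Main.v *)
Require Import Defs.
From HB Require Import structures.
From mathcomp Require Import all_boot all_order all_algebra.
From mathcomp Require Import all_classical all_reals all_analysis.
From mathcomp Require Import complex measurable_realfun ring lra.

Set Implicit Arguments.
Unset Strict Implicit.
Unset Printing Implicit Defensive.

Import Order.TTheory GRing.Theory Num.Theory.
Import numFieldNormedType.Exports.

Local Open Scope classical_set_scope.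
Local Open Scope ring_scope.
Local Open Scope complex_scope.

(** [krawtchouk p q N n x] is the coefficient of [w ^ n] in
    (1 + q w) ^ x (1 - p w) ^ (N - x), so it is [1 / pi] times the integral, over
    a small half-circle [w = t exp (- i x')] with [0 <= x' <= pi], of the real
    part of that function times [w ^ - n].  In the variable [u = 1 / w] the
    integrand is exp (N psi (u)), and the saddle points of psi are the conjugate
    points U^+ and U^-, both of modulus [U0].  The proof moves the half-circle to
    the radius [t = 1 / U0] and applies the method of Laplace there.

    Moving the contour.  By the Cauchy-Riemann equations the derivative of the
    integral with respect to the radius is a boundary term on the real axis
    ([is_derive_wint]).  It vanishes as long as the half-circle does not reach a
    branch point, [w = 1 / p] or [w = - 1 / q].  Beyond a branch point, where the
    integrand is multivalued because [x] is real, the boundary term is at most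
    the modulus of the integrand on the cut.  As psi has no real critical point,
    this modulus increases along the cut up to the saddle circle ([amp_cut_0],
    [amp_cut_pi]), and there it is exponentially smaller than at the saddle
    point, so the cuts do not contribute ([wint_deform], [saddle_cut]).  That the
    integral over a small half-circle is the coefficient is proved by induction:
    both sides satisfy the same recurrence in [n], obtained from differentiating
    the generating function, and for [n = 0] one lets the radius tend to 0
    ([wint_krawc]).

    The saddle circle.  On [|u| = U0] the derivative of psi with respect to the
    angle factors as [cos x' - cos x0] times an explicit function
    ([phst_saddle], [ampt_saddle]), where [x0] is the argument of U^+, and the
    real part of psi is a concave function of [cos x'].  Hence the modulus of the
    integrand is at most a Gaussian centred at [x0] on the whole half-circle,
    even if the circle meets a branch point ([amp_saddle_max]).  The circle is
    not the path of steepest descent, so the limiting Gaussian has a complex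
    coefficient [hess_re +i* hess_im]; its integral is found by rotating the
    coefficient to the real axis ([gauss_rotation]).  This coefficient is the
    inverse of the square of the amplitude [L] ([L_saddle]), and exp (N psi) at
    the saddle point is the exponential in [K] ([psi_saddle]).

    Conclusion.  [saddle_estimate] is an error bound for fixed [N], [n] and [x],
    relative to the modulus of exp (N psi) at the saddle point.  As K^+ and K^-
    are conjugate, their sum is the oscillating real term that the integral
    produces, and the error is measured against their common modulus, which does
    not oscillate.  The constants in the bound can be chosen uniformly for [z]
    and [y] near their limits, so the relative error tends to 0. *)

(** * Differential calculus and integrals over an open interval *)

Section Calculus.
Variable R : realType.
Implicit Types (f g h : R -> R) (a b x : R).

(** The following lemmas restate derivation rules for functions given by
    pointwise expressions, so that a derivative can be computed by composing
    them in one term. *)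
Lemma is_derive_congr f x a b :
  is_derive x 1 f a -> a = b -> is_derive x 1 f b.
Proof. by move=> ? <-. Qed.

Lemma is_derive_add f g x a b : is_derive x 1 f a -> is_derive x 1 g b ->
  is_derive x 1 (fun y => f y + g y) (a + b).
Proof. by move=> ? ?; exact: is_deriveD. Qed.

Lemma is_derive_opp f x a : is_derive x 1 f a ->
  is_derive x 1 (fun y => - f y) (- a).
Proof. by move=> ?; exact: is_deriveN. Qed.

Lemma is_derive_mul f g x a b : is_derive x 1 f a -> is_derive x 1 g b ->
  is_derive x 1 (fun y => f y * g y) (f x * b + g x * a).
Proof. by move=> ? ?; exact: is_deriveM. Qed.

Lemma is_derive_scale (k : R) f x a : is_derive x 1 f a ->
  is_derive x 1 (fun y => k * f y) (k * a).
Proof. by move=> ?; exact: is_deriveZ. Qed.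

Lemma is_derive_comp f g x a b : is_derive (g x) 1 f a -> is_derive x 1 g b ->
  is_derive x 1 (fun y => f (g y)) (a * b).
Proof. by move=> ? ?; exact: is_derive1_comp. Qed.

Lemma is_derive_var x : is_derive x (1 : R) (fun y : R => y) 1.
Proof. exact: is_derive_id. Qed.

Lemma is_derive_const (k : R) x : is_derive x (1 : R) (fun _ : R => k) 0.
Proof. exact: is_derive_cst. Qed.

Lemma is_derive_div f g x a b : g x != 0 ->
  is_derive x 1 f a -> is_derive x 1 g b ->
  is_derive x 1 (fun y => f y / g y) ((a * g x - f x * b) / g x ^+ 2).
Proof.
move=> g0 fa gb; have gV := is_deriveV g0 gb.
refine (is_derive_congr (is_derive_mul fa gV) _).
by rewrite /GRing.scale /=; field.
Qed.

Lemma is_derive_continuous f x a : is_derive x 1 f a -> {for x, continuous f}.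
Proof.
by move=> [fx _]; exact/differentiable_continuous/derivable1_diffP.
Qed.

Lemma is_derive_ln_comp f x a : 0 < f x -> is_derive x 1 f a ->
  is_derive x 1 (fun y => ln (f y)) (a / f x).
Proof.
move=> f0 fa; refine (is_derive_congr (is_derive_comp (is_derive1_ln f0) fa) _).
by rewrite mulrC.
Qed.

Lemma is_derive_expR_comp f x a : is_derive x 1 f a ->
  is_derive x 1 (fun y => expR (f y)) (expR (f x) * a).
Proof. by move=> fa; exact: (is_derive_comp (is_derive_expR _) fa). Qed.

Lemma is_derive_cos_comp f x a : is_derive x 1 f a ->
  is_derive x 1 (fun y => cos (f y)) (- sin (f x) * a).
Proof. by move=> fa; exact: (is_derive_comp (is_derive_cos _) fa). Qed.

Lemma is_derive_sin_comp f x a : is_derive x 1 f a ->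
  is_derive x 1 (fun y => sin (f y)) (cos (f x) * a).
Proof. by move=> fa; exact: (is_derive_comp (is_derive_sin _) fa). Qed.

Lemma is_derive_atan_comp f x a : is_derive x 1 f a ->
  is_derive x 1 (fun y => atan (f y)) (a / (1 + f x ^+ 2)).
Proof.
move=> fa; refine (is_derive_congr (is_derive_comp (is_derive1_atan _) fa) _).
by rewrite mulrC.
Qed.

Lemma is_derive_sqrt_comp f x a : 0 < f x -> is_derive x 1 f a ->
  is_derive x 1 (fun y => Num.sqrt (f y)) (a / (2 * Num.sqrt (f x))).
Proof.
move=> f0 fa; refine (is_derive_congr (is_derive_comp (is_derive1_sqrt f0) fa) _).
by rewrite mulrC.
Qed.

Notation mu := (@lebesgue_measure R).

Lemma integrable_itvoo f (a b M : R) :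
  (forall x, x \in `]a, b[ -> {for x, continuous f}) ->
  (forall x, x \in `]a, b[ -> `|f x| <= M) ->
  mu.-integrable `]a, b[ (EFin \o f).
Proof.
move=> cf fM; apply: measurable_bounded_integrable => //.
- by rewrite /= lebesgue_measure_itv; case: ifP => _ //=; rewrite -?EFinB ltry.
- apply: open_continuous_measurable_fun; first exact: interval_open.
  by move=> x /set_mem; exact: cf.
- exists M; split; first exact: num_real.
  by move=> K MK x /= /fM /le_trans; apply; exact: ltW.
Qed.

Lemma continuous_bounded_itvcc f (a b : R) :
  (forall x, x \in `[a, b] -> {for x, continuous f}) ->
  exists2 M, 0 < M & forall x, x \in `[a, b] -> `|f x| <= M.
Proof.
move=> cf.
have : bounded_set (f @` `[a, b]).
  apply/compact_bounded/continuous_compact; last exact: segment_compact.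
  apply: continuous_in_subspaceT => x /set_mem; exact: cf.
move=> [M [_ hM]]; exists (`|M| + 1); first by rewrite ltr_wpDl.
move=> x xab; apply: (hM (`|M| + 1)); last by exists x.
by rewrite (le_lt_trans (ler_norm M))// ltrDl.
Qed.

Lemma Rintegral_itvoo_FTC f F (a b : R) : a < b ->
  (forall x, x \in `[a, b] -> is_derive x 1 F (f x)) ->
  (forall x, x \in `[a, b] -> {for x, continuous f}) ->
  \int[mu]_(x in `]a, b[) f x = F b - F a.
Proof.
move=> ab dF cf.
have [M _ fM] := continuous_bounded_itvcc cf.
have sub x : x \in `]a, b[ -> x \in `[a, b] by exact: subset_itv_oo_cc.
have iab : mu.-integrable `]a, b[ (EFin \o f).
  by apply: (integrable_itvoo (M := M)) => x /sub; [exact: cf|exact: fM].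
have wf : {within `[a, b], continuous f}.
  by apply: continuous_in_subspaceT => x /set_mem; exact: cf.
have icc : mu.-integrable `[a, b] (EFin \o f).
  by apply: continuous_compact_integrable => //; exact: segment_compact.
rewrite Rintegral_itv_bndo_bndc// Rintegral_itv_obnd_cbnd; last first.
  by apply: integrableS icc => //; exact: subset_itv_oc_cc.
rewrite /Rintegral (@continuous_FTC2 _ f F)//.
- split.
  + by move=> x /sub /dF [].
  + apply: cvg_at_right_filter; apply: (is_derive_continuous (dF a _)).
    by rewrite bound_itvE ltW.
  + apply: cvg_at_left_filter; apply: (is_derive_continuous (dF b _)).
    by rewrite bound_itvE ltW.
- by move=> x /sub /dF [_ <-]; rewrite derive1E.
Qed.

Lemma RintegralB_le f g h (a b : R) :
  mu.-integrable `]a, b[ (EFin \o f) -> mu.-integrable `]a, b[ (EFin \o g) ->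
  mu.-integrable `]a, b[ (EFin \o h) ->
  (forall x, x \in `]a, b[ -> `|f x - g x| <= h x) ->
  `|\int[mu]_(x in `]a, b[) f x - \int[mu]_(x in `]a, b[) g x|
    <= \int[mu]_(x in `]a, b[) h x.
Proof.
move=> fi gi hi fgh; rewrite -RintegralB//.
have fgi : mu.-integrable `]a, b[ (EFin \o (fun x => f x - g x)).
  by have := @integrableB _ _ _ mu `]a, b[ _ _ _ fi gi; apply.
apply: le_trans (le_normr_Rintegral _ fgi) _ => //.
apply: le_Rintegral => //.
exact: integrable_norm.
Qed.

(** If the partial derivative of [G] in the parameter is itself the derivative
    of [H] in the variable, the derivative of the integral is a boundary term:
    this is how contours are moved below. *)
Lemma is_derive_Rintegral (G G1 : R -> R -> R) (H : R -> R) (a b t0 e C : R) :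
  a < b -> 0 < e ->
  (forall t x, `|t - t0| < e -> x \in `]a, b[ ->
     is_derive t 1 (G^~ x) (G1 t x)) ->
  (forall t x, `|t - t0| < e -> x \in `]a, b[ ->
     {for x, continuous (G t)}) ->
  (forall t x, `|t - t0| < e -> x \in `]a, b[ -> `|G t x| <= C) ->
  (forall t x, `|t - t0| < e -> x \in `]a, b[ -> `|G1 t x| <= C) ->
  (forall x, x \in `[a, b] -> is_derive x 1 H (G1 t0 x)) ->
  (forall x, x \in `[a, b] -> {for x, continuous (G1 t0)}) ->
  is_derive t0 1 (fun t => \int[mu]_(x in `]a, b[) G t x) (H b - H a).
Proof.
move=> ab e0 dG cG bG bG1 dH cG1.
have inI t : (`]t0 - e, t0 + e[%classic : set R) t -> `|t - t0| < e.
  by rewrite /= in_itv /= => /andP[? ?]; rewrite ltr_distl; apply/andP; split; lra.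
have It0 : (`]t0 - e, t0 + e[%classic : set R) t0.
  by rewrite /= in_itv /=; apply/andP; split; lra.
have bC : 0 <= C.
  have mid : (a + b) / 2 \in `]a, b[ by rewrite in_itv /=; apply/andP; split; lra.
  apply: le_trans (bG t0 _ _ mid) => //; exact: inI.
have intG t : (`]t0 - e, t0 + e[%classic : set R) t ->
    mu.-integrable `]a, b[ (EFin \o G t).
  move=> /inI te; apply: (integrable_itvoo (M := C)) => x xab;
    [exact: cG|exact: bG].
have intC : mu.-integrable `]a, b[ (EFin \o (fun _ : R => C)).
  apply: (integrable_itvoo (M := C)) => x xab; first exact: cvg_cst.
  by rewrite ger0_norm.
have dd t x : (`]t0 - e, t0 + e[%classic : set R) t -> `]a, b[%classic x ->
    derivable (G^~ x) t 1 by move=> /inI te xab; case: (dG t x te xab).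
have ee t x : (`]t0 - e, t0 + e[%classic : set R) t -> `]a, b[%classic x ->
    partial1of2 G t x = G1 t x.
  by move=> /inI te xab; rewrite partial1of2E; case: (dG t x te xab).
have bb t x : (`]t0 - e, t0 + e[%classic : set R) t -> `]a, b[%classic x ->
    `|partial1of2 G t x| <= C.
  by move=> It xab; rewrite ee//; apply: bG1 => //; exact: inI.
split.
  exact: (derivable_under_integral _ It0 intG dd _ intC bb).
rewrite -derive1E (differentiation_under_integral _ It0 intG dd _ intC bb)//.
rewrite -(Rintegral_itvoo_FTC ab dH cG1).
by apply: eq_Rintegral => x /set_mem xab; exact: ee.
Qed.

Lemma continuous_Rintegral (G : R -> R -> R) (a b t0 e C : R) :
  0 < e ->
  (forall t x, `|t - t0| < e -> x \in `]a, b[ -> {for t, continuous (G^~ x)}) ->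
  (forall t x, `|t - t0| < e -> x \in `]a, b[ -> {for x, continuous (G t)}) ->
  (forall t x, `|t - t0| < e -> x \in `]a, b[ -> `|G t x| <= C) ->
  {for t0, continuous (fun t => \int[mu]_(x in `]a, b[) G t x)}.
Proof.
move=> e0 cGt cG bG.
have inI t : (`]t0 - e, t0 + e[%classic : set R) t -> `|t - t0| < e.
  by rewrite /= in_itv /= => /andP[? ?]; rewrite ltr_distl; apply/andP; split; lra.
have intG t : (`]t0 - e, t0 + e[%classic : set R) t ->
    mu.-integrable `]a, b[ (EFin \o G t).
  move=> /inI te; apply: (integrable_itvoo (M := C)) => x xab;
    [exact: cG|exact: bG].
have intC : mu.-integrable `]a, b[ (EFin \o (fun _ : R => `|C|)).
  apply: (integrable_itvoo (M := `|C|)) => x xab; first exact: cvg_cst.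
  by rewrite normr_id.
apply: (@continuity_under_integral _ _ _ mu G `]a, b[ _ (t0 - e) (t0 + e)
  intG _ _ intC) => //.
- by apply/aeW => x xab t /set_mem /inI te; exact: cGt.
- move=> t /inI te; apply/aeW => x xab.
  by rewrite (le_trans (bG _ _ te xab))// ler_norm.
- by apply/mem_set; rewrite /= in_itv /=; apply/andP; split; lra.
Qed.

Lemma mvt_bound f (a b M : R) : a <= b ->
  (forall x, x \in `[a, b] -> {for x, continuous f}) ->
  (forall x, x \in `]a, b[ -> exists2 d, is_derive x 1 f d & `|d| <= M) ->
  `|f b - f a| <= M * (b - a).
Proof.
rewrite le_eqVlt => /predU1P[->|ab] cf df; first by rewrite !subrr normr0 mulr0.
have df' x : x \in `]a, b[ -> is_derive x 1 f ('D_1 f x).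
  by move=> /df[d [fx fd] _]; split.
have wf : {within `[a, b], continuous f}.
  by apply: continuous_in_subspaceT => x /set_mem; exact: cf.
have [c cab ->] := MVT ab df' wf.
have [d [_ ->] dM] := df c cab.
by rewrite normrM (gtr0_norm (_ : 0 < b - a)) ?subr_gt0// ler_wpM2r// subr_ge0 ltW.
Qed.

(** The exceptional points will be the radii at which a circle meets a branch
    point. *)
Lemma mvt_bound_except f (s : seq R) (a b M : R) : a <= b ->
  (forall x, x \in `[a, b] -> {for x, continuous f}) ->
  (forall x, x \in `]a, b[ -> x \notin s ->
     exists2 d, is_derive x 1 f d & `|d| <= M) ->
  `|f b - f a| <= M * (b - a).
Proof.
elim: s a b => [|c s IH] a b ab cf df.
  by apply: mvt_bound => // x xab; exact: df.
have [cab|ncab] := boolP (c \in `[a, b]); last first.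
  apply: IH => // x xab xs; apply: df => //; rewrite inE negb_or xs andbT.
  by apply: contraNneq ncab => <-; exact: subset_itv_oo_cc.
have /andP[ac cb] : a <= c <= b by rewrite in_itv in cab.
have -> : f b - f a = (f b - f c) + (f c - f a) by ring.
have -> : M * (b - a) = M * (b - c) + M * (c - a) by ring.
apply: le_trans (ler_normD _ _) _; apply: lerD; apply: IH => // x.
- by rewrite in_itv /= => /andP[? ?]; apply: cf; rewrite in_itv /=; lra.
- rewrite in_itv /= => /andP[cx xb] xs; apply: df; first by rewrite in_itv /=; lra.
  by rewrite inE negb_or xs andbT gt_eqF.
- by rewrite in_itv /= => /andP[? ?]; apply: cf; rewrite in_itv /=; lra.
- rewrite in_itv /= => /andP[cx xb] xs; apply: df; first by rewrite in_itv /=; lra.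
  by rewrite inE negb_or xs andbT lt_eqF.
Qed.

End Calculus.

(** * The argument on the closed upper half-plane *)

Section UpperArg.
Variable R : realType.
Implicit Types (a b x k : R) (f g : R -> R).

(** The argument of [a +i* b], in half-angle form.  Unlike formulas with [acos]
    or with the arctangent of [a / b], it is smooth in a neighbourhood of every
    point of the closed upper half-plane other than 0, the real axis included. *)
Definition uarg a b : R :=
  pi / 2 - 2 * atan (a / (Num.sqrt (a ^+ 2 + b ^+ 2) + b)).

Lemma norm2_gt0 a b : 0 < a ^+ 2 + b ^+ 2 -> 0 < Num.sqrt (a ^+ 2 + b ^+ 2).
Proof. by rewrite sqrtr_gt0. Qed.

Lemma sqr_norm2 a b :
  Num.sqrt (a ^+ 2 + b ^+ 2) ^+ 2 = a ^+ 2 + b ^+ 2.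
Proof. by rewrite sqr_sqrtr// addr_ge0 ?sqr_ge0. Qed.

Lemma is_derive_uarg f g x a b :
  0 < f x ^+ 2 + g x ^+ 2 -> 0 <= g x ->
  is_derive x 1 f a -> is_derive x 1 g b ->
  is_derive x 1 (fun y => uarg (f y) (g y))
    ((f x * b - g x * a) / (f x ^+ 2 + g x ^+ 2)).
Proof.
move=> fg0 g0 fa gb; rewrite /uarg.
have m0 := norm2_gt0 fg0; have m2 := sqr_norm2 (f x) (g x).
set m := Num.sqrt _ in m0 m2.
have dm : is_derive x 1 (fun y => Num.sqrt (f y ^+ 2 + g y ^+ 2))
    ((f x * a + g x * b) / m).
  refine (is_derive_congr (is_derive_sqrt_comp (f := fun y => f y ^+ 2 + g y ^+ 2)
     fg0 (is_derive_add (is_derive_mul fa fa) (is_derive_mul gb gb))) _).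
  by rewrite -/m; field; rewrite gt_eqF.
have mg0 : 0 < m + g x by rewrite ltr_pwDl.
have mgN : m + g x != 0 by rewrite gt_eqF.
refine (is_derive_congr (is_derive_add (is_derive_const _ _)
   (is_derive_opp (is_derive_scale 2 (is_derive_atan_comp
     (is_derive_div (f := f) (g := fun y => Num.sqrt (f y ^+ 2 + g y ^+ 2) + g y)
        mgN fa (is_derive_add dm gb)))))) _).
rewrite -/m -m2.
have fx2 : f x ^+ 2 = m ^+ 2 - g x ^+ 2 by rewrite m2; ring.
have -> : 1 + (f x / (m + g x)) ^+ 2 = 2 * m / (m + g x).
  by rewrite exprMn fx2; field.
have -> : a * (m + g x) - f x * ((f x * a + g x * b) / m + b) =
          (m + g x) * (g x * a - f x * b) / m.
  have -> : f x * ((f x * a + g x * b) / m + b) =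
     (f x ^+ 2 * a + f x * g x * b + f x * b * m) / m by field; rewrite gt_eqF.
  by rewrite fx2; field; rewrite gt_eqF.
by field; rewrite mgN gt_eqF.
Qed.

Lemma sin_atanE x : sin (atan x) = x * cos (atan x).
Proof.
have c0 : cos (atan x) != 0.
  by rewrite cos_atan invr_eq0 sqrtr_eq0 -ltNge ltr_pwDl// sqr_ge0.
by rewrite -{2}[x]atanK /tan divfK.
Qed.

Lemma cos_atan_sqr x : cos (atan x) ^+ 2 = (1 + x ^+ 2)^-1.
Proof. by rewrite cos_atan exprVn sqr_sqrtr// addr_ge0// sqr_ge0. Qed.

Lemma cos_uarg a b : 0 < a ^+ 2 + b ^+ 2 -> 0 <= b ->
  cos (uarg a b) = a / Num.sqrt (a ^+ 2 + b ^+ 2).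
Proof.
move=> ab0 b0; rewrite /uarg.
have m0 := norm2_gt0 ab0; have m2 := sqr_norm2 a b.
set m := Num.sqrt _ in m0 m2 *.
have mb0 : m + b != 0 by rewrite gt_eqF// ltr_pwDl.
rewrite cosB cos_pihalf sin_pihalf mul0r add0r mul1r mulr_natl sin_mulr2n.
rewrite sin_atanE mulrCA -expr2 cos_atan_sqr.
have a2 : a ^+ 2 = m ^+ 2 - b ^+ 2 by rewrite m2; ring.
have -> : 1 + (a / (m + b)) ^+ 2 = 2 * m / (m + b) by rewrite exprMn a2; field.
by rewrite -mulr_natr; field; rewrite mb0 gt_eqF.
Qed.

Lemma sin_uarg a b : 0 < a ^+ 2 + b ^+ 2 -> 0 <= b ->
  sin (uarg a b) = b / Num.sqrt (a ^+ 2 + b ^+ 2).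
Proof.
move=> ab0 b0; rewrite /uarg.
have m0 := norm2_gt0 ab0; have m2 := sqr_norm2 a b.
set m := Num.sqrt _ in m0 m2 *.
have mb0 : m + b != 0 by rewrite gt_eqF// ltr_pwDl.
rewrite sinB cos_pihalf sin_pihalf mul0r subr0 mul1r mulr_natl cos_mulr2n.
rewrite cos_atan_sqr.
have a2 : a ^+ 2 = m ^+ 2 - b ^+ 2 by rewrite m2; ring.
have -> : 1 + (a / (m + b)) ^+ 2 = 2 * m / (m + b) by rewrite exprMn a2; field.
by rewrite -mulr_natr; field; rewrite mb0 gt_eqF.
Qed.

Lemma uarg_itv a b : 0 < a ^+ 2 + b ^+ 2 -> 0 <= b -> uarg a b \in `[0, pi].
Proof.
move=> ab0 b0; rewrite /uarg.
have m0 := norm2_gt0 ab0; have m2 := sqr_norm2 a b.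
set m := Num.sqrt _ in m0 m2 *.
have mb0 : 0 < m + b by rewrite ltr_pwDl.
have am : `|a| <= m.
  by rewrite /m -sqrtr_sqr ler_wsqrtr// lerDl sqr_ge0.
have [a1 a2] : -1 <= a / (m + b) /\ a / (m + b) <= 1.
  rewrite ler_pdivlMr// ler_pdivrMr// mulN1r mul1r.
  by move: am; rewrite ler_norml => /andP[? ?]; split; lra.
have := le_atan a1; have := le_atan a2.
by rewrite atanN atan1 in_itv /= => h1 h2; apply/andP; split; lra.
Qed.

Lemma uargE a b : 0 < a ^+ 2 + b ^+ 2 -> 0 <= b ->
  uarg a b = acos (a / Num.sqrt (a ^+ 2 + b ^+ 2)).
Proof. by move=> ab0 b0; rewrite -cos_uarg// cosK// uarg_itv. Qed.

Lemma uarg_scale k a b : 0 < k -> uarg (k * a) (k * b) = uarg a b.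
Proof.
move=> k0; rewrite /uarg; congr (_ - _ * atan _).
rewrite !exprMn -mulrDr sqrtrM ?sqr_ge0// sqrtr_sqr gtr0_norm// -mulrDr.
by rewrite invfM mulrACA divff ?mul1r// gt_eqF.
Qed.

Lemma uarg_polar x : x \in `[0, pi] -> uarg (cos x) (sin x) = x.
Proof.
move=> x0; have s0 : 0 <= sin x by apply: sin_ge0_pi; rewrite in_itv in x0.
by rewrite uargE// cos2Dsin2// sqrtr1 divr1 cosK.
Qed.

Lemma uarg_pos a : 0 < a -> uarg a 0 = 0.
Proof.
move=> a0; rewrite uargE// ?expr0n/= addr0 ?exprn_gt0//.
by rewrite sqrtr_sqr gtr0_norm// divff ?gt_eqF// acos1.
Qed.

Lemma uarg_neg a : a < 0 -> uarg a 0 = pi.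
Proof.
move=> a0; have ? : 0 < a ^+ 2 by rewrite exprn_even_gt0//= lt_eqF.
rewrite uargE// ?expr0n/= addr0 //.
by rewrite sqrtr_sqr ltr0_norm// invrN mulrN divff ?lt_eqF// acosN1.
Qed.

End UpperArg.

(** * The generating function on a circle *)

Section Factor.
Variable R : realType.
Implicit Types (kap t x : R).

(** [sqmod kap t x] is the square modulus of [1 + kap w], where [w] has modulus
    [t] and argument [- x]; [lmod] and [larg] are the real and imaginary parts
    of its logarithm.  The factor exp (- i x) is taken out, which keeps the
    formulas meaningful at [t = 0]. *)
Definition sqmod kap t x : R := (cos x + kap * t) ^+ 2 + sin x ^+ 2.
Definition lmod kap t x : R := ln (sqmod kap t x) / 2.
Definition larg kap t x : R := uarg (cos x + kap * t) (sin x) - x.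

Lemma sqmodE kap t x : sqmod kap t x = 1 + 2 * kap * t * cos x + kap ^+ 2 * t ^+ 2.
Proof. by rewrite /sqmod sin2cos2; ring. Qed.

Lemma sqmod_ge kap t x : (1 - `|kap * t|) ^+ 2 <= sqmod kap t x.
Proof.
have -> : (1 - `|kap * t|) ^+ 2 = 1 - 2 * `|kap * t| + kap ^+ 2 * t ^+ 2.
  have e : `|kap * t| ^+ 2 = kap ^+ 2 * t ^+ 2.
    by rewrite real_normK ?num_real// exprMn.
  by rewrite -e; ring.
rewrite sqmodE; suff : `|kap * t * cos x| <= `|kap * t|.
  by rewrite ler_norml => /andP[? ?]; lra.
by rewrite normrM ler_piMr// cos_max.
Qed.

Lemma sqmod_le kap t x : sqmod kap t x <= (1 + `|kap * t|) ^+ 2.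
Proof.
have -> : (1 + `|kap * t|) ^+ 2 = 1 + 2 * `|kap * t| + kap ^+ 2 * t ^+ 2.
  have e : `|kap * t| ^+ 2 = kap ^+ 2 * t ^+ 2.
    by rewrite real_normK ?num_real// exprMn.
  by rewrite -e; ring.
rewrite sqmodE; suff : `|kap * t * cos x| <= `|kap * t|.
  by rewrite ler_norml => /andP[? ?]; lra.
by rewrite normrM ler_piMr// cos_max.
Qed.

Lemma sqmod_gt0 kap t x : x \in `]0, pi[ -> 0 < sqmod kap t x.
Proof.
rewrite in_itv /= => xpi; rewrite /sqmod ltr_wpDl ?sqr_ge0//.
by rewrite exprn_gt0// sin_gt0_pi.
Qed.

Lemma is_derive_sqmodt kap t x :
  is_derive t 1 (fun s => sqmod kap s x) (2 * kap * (cos x + kap * t)).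
Proof.
rewrite /sqmod.
have d : is_derive t (1 : R) (fun s => cos x + kap * s) (0 + kap * 1).
  exact: is_derive_add (is_derive_const _ _) (is_derive_scale _ (is_derive_var _)).
refine (is_derive_congr (is_derive_add (is_derive_mul d d) (is_derive_const _ _)) _).
by ring.
Qed.

Lemma is_derive_sqmodx kap t x :
  is_derive x 1 (sqmod kap t) (- 2 * kap * t * sin x).
Proof.
rewrite /sqmod.
have d : is_derive x 1 (fun s => cos s + kap * t) (- sin x + 0).
  exact: is_derive_add (is_derive_cos _) (is_derive_const _ _).
refine (is_derive_congr (is_derive_add (is_derive_mul d d)
  (is_derive_mul (is_derive_sin _) (is_derive_sin _))) _).
by ring.
Qed.

Variables (kap t x : R).
Hypothesis D0 : 0 < sqmod kap t x.

Lemma is_derive_lmodt :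
  is_derive t 1 (fun s => lmod kap s x) (kap * (cos x + kap * t) / sqmod kap t x).
Proof.
refine (is_derive_congr (is_derive_mul (is_derive_ln_comp (f := fun s => sqmod kap s x) D0
  (is_derive_sqmodt kap t x)) (is_derive_const _ _)) _).
by field; rewrite gt_eqF.
Qed.

Lemma is_derive_lmodx :
  is_derive x 1 (lmod kap t) (- (kap * t * sin x / sqmod kap t x)).
Proof.
refine (is_derive_congr (is_derive_mul (is_derive_ln_comp (f := sqmod kap t) D0
  (is_derive_sqmodx kap t x)) (is_derive_const _ _)) _).
by field; rewrite gt_eqF.
Qed.

Hypothesis s0 : 0 <= sin x.

Lemma is_derive_largt :
  is_derive t 1 (fun s => larg kap s x) (- (kap * sin x / sqmod kap t x)).
Proof.
rewrite /larg.
have d : is_derive t (1 : R) (fun s => cos x + kap * s) (0 + kap * 1).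
  exact: is_derive_add (is_derive_const _ _) (is_derive_scale _ (is_derive_var _)).
refine (is_derive_congr (is_derive_add (is_derive_uarg (f := fun s => cos x + kap * s) (g := fun=> sin x)
  D0 s0 d (is_derive_const _ _)) (is_derive_const _ _)) _).
by rewrite -/(sqmod kap t x); field; rewrite gt_eqF.
Qed.

(** Compared with the derivatives in [t], the derivatives in [x] of [lmod] and
    [larg] exhibit the Cauchy-Riemann equations in polar coordinates. *)
Lemma is_derive_largx :
  is_derive x 1 (larg kap t) (- (kap * t * (cos x + kap * t) / sqmod kap t x)).
Proof.
rewrite /larg.
have d : is_derive x 1 (fun s => cos s + kap * t) (- sin x + 0).
  exact: is_derive_add (is_derive_cos _) (is_derive_const _ _).
refine (is_derive_congr (is_derive_add (is_derive_uarg (f := fun s => cos s + kap * t) (g := sin)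
  D0 s0 d (is_derive_sin _)) (is_derive_opp (is_derive_var _))) _).
rewrite -/(sqmod kap t x).
have -> : (cos x + kap * t) * cos x - sin x * (- sin x + 0) =
  sqmod kap t x - kap * t * (cos x + kap * t) by rewrite /sqmod; ring.
by field; rewrite gt_eqF.
Qed.

End Factor.

Section Wave.
Variable R : realType.
Notation mu := (@lebesgue_measure R).
Variables p q nu b a : R.
Implicit Types (t x : R).

(** [amp +i* phs] is the logarithm of [w ^ - nu (1 - p w) ^ b (1 + q w) ^ a] at
    the point [w] of modulus [t] and argument [- x], and [wre +i* wim] is its
    exponential; [ampt], [phst] and [wret] are partial derivatives in [t]. *)
Definition amp t x : R := - (nu * ln t) + b * lmod (- p) t x + a * lmod q t x.
Definition phs t x : R := nu * x + b * larg (- p) t x + a * larg q t x.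
Definition wre t x : R := expR (amp t x) * cos (phs t x).
Definition wim t x : R := expR (amp t x) * sin (phs t x).

Definition ampt t x : R :=
  - (nu / t) - b * (p * (cos x - p * t) / sqmod (- p) t x)
  + a * (q * (cos x + q * t) / sqmod q t x).
Definition phst t x : R :=
  b * (p * sin x / sqmod (- p) t x) - a * (q * sin x / sqmod q t x).
Definition wret t x : R :=
  expR (amp t x) * (ampt t x * cos (phs t x) - phst t x * sin (phs t x)).

Section Derivatives.
Variables t x : R.
Hypothesis D1 : 0 < sqmod (- p) t x.
Hypothesis D2 : 0 < sqmod q t x.

Lemma is_derive_ampt : 0 < t -> is_derive t 1 (amp ^~ x) (ampt t x).
Proof.
move=> t0.
refine (is_derive_congr (is_derive_add (is_derive_add (is_derive_opp
  (is_derive_scale nu (is_derive1_ln t0)))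
  (is_derive_scale b (is_derive_lmodt D1))) (is_derive_scale a (is_derive_lmodt D2))) _).
by rewrite /ampt; field; rewrite !gt_eqF.
Qed.

Lemma is_derive_ampx : is_derive x 1 (amp t) (t * phst t x).
Proof.
refine (is_derive_congr (is_derive_add (is_derive_add (is_derive_const _ _)
  (is_derive_scale b (is_derive_lmodx D1))) (is_derive_scale a (is_derive_lmodx D2))) _).
by rewrite /phst; field; rewrite !gt_eqF.
Qed.

Hypothesis s0 : 0 <= sin x.

Lemma is_derive_phst : is_derive t 1 (phs ^~ x) (phst t x).
Proof.
refine (is_derive_congr (is_derive_add (is_derive_add (is_derive_const _ _)
  (is_derive_scale b (is_derive_largt D1 s0))) (is_derive_scale a (is_derive_largt D2 s0))) _).
by rewrite /phst; field; rewrite !gt_eqF.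
Qed.

Lemma is_derive_phsx : 0 < t -> is_derive x 1 (phs t) (- (t * ampt t x)).
Proof.
move=> t0.
refine (is_derive_congr (is_derive_add (is_derive_add
  (is_derive_scale nu (is_derive_var _))
  (is_derive_scale b (is_derive_largx D1 s0))) (is_derive_scale a (is_derive_largx D2 s0))) _).
by rewrite /ampt; field; rewrite !gt_eqF.
Qed.

Lemma is_derive_wret : 0 < t -> is_derive t 1 (wre ^~ x) (wret t x).
Proof.
move=> t0.
refine (is_derive_congr (is_derive_mul (is_derive_expR_comp (is_derive_ampt t0))
  (is_derive_cos_comp is_derive_phst)) _).
by rewrite /wret; ring.
Qed.

(** The Cauchy-Riemann equation that makes the derivative of the integral in
    the radius a boundary term. *)
Lemma is_derive_wimx : 0 < t -> is_derive x 1 (wim t) (- t * wret t x).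
Proof.
move=> t0.
refine (is_derive_congr (is_derive_mul (is_derive_expR_comp is_derive_ampx)
  (is_derive_sin_comp (is_derive_phsx t0))) _).
by rewrite /wret; ring.
Qed.

Lemma continuous_wrex : 0 < t -> {for x, continuous (wre t)}.
Proof.
move=> t0; exact: (is_derive_continuous (f := wre t)
  (is_derive_mul (is_derive_expR_comp is_derive_ampx)
  (is_derive_cos_comp (is_derive_phsx t0)))).
Qed.

Lemma continuous_sqmodx kap : {for x, continuous (sqmod kap t)}.
Proof. exact: (is_derive_continuous (is_derive_sqmodx kap t x)). Qed.

Lemma continuous_wretx : 0 < t -> {for x, continuous (wret t)}.
Proof.
move=> t0.
have c1 : {for x, continuous (fun y => (sqmod (- p) t y)^-1)}.
  by apply: cvgV; [rewrite gt_eqF|exact: continuous_sqmodx].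
have c2 : {for x, continuous (fun y => (sqmod q t y)^-1)}.
  by apply: cvgV; [rewrite gt_eqF|exact: continuous_sqmodx].
have cc : {for x, continuous (@cos R)} by exact: continuous_cos.
have cs : {for x, continuous (@sin R)} by exact: continuous_sin.
have ca : {for x, continuous (ampt t)}.
  apply: cvgD; [apply: cvgB; first exact: cvg_cst|];
    apply: cvgM; try exact: cvg_cst; (apply: cvgM; last by []);
    apply: cvgM; try exact: cvg_cst.
  - by apply: cvgB => //; exact: cvg_cst.
  - by apply: cvgD => //; exact: cvg_cst.
have cp : {for x, continuous (phst t)}.
  by apply: cvgB; apply: cvgM; try exact: cvg_cst; (apply: cvgM; last by []);
    apply: cvgM; try exact: cvg_cst.
have cph := is_derive_continuous (is_derive_phsx t0).
apply: cvgM.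
  exact: (is_derive_continuous (is_derive_expR_comp is_derive_ampx)).
apply: cvgB; apply: cvgM => //.
- exact: (is_derive_continuous (is_derive_cos_comp (is_derive_phsx t0))).
- exact: (is_derive_continuous (is_derive_sin_comp (is_derive_phsx t0))).
Qed.

End Derivatives.

Lemma wre_le t x : `|wre t x| <= expR (amp t x).
Proof.
by rewrite /wre normrM ger0_norm ?expR_ge0// ler_piMr ?expR_ge0// cos_max.
Qed.

Lemma wim_le t x : `|wim t x| <= expR (amp t x).
Proof.
by rewrite /wim normrM ger0_norm ?expR_ge0// ler_piMr ?expR_ge0// sin_max.
Qed.

Lemma wret_le t x :
  `|wret t x| <= expR (amp t x) * (`|ampt t x| + `|phst t x|).
Proof.
rewrite /wret normrM (ger0_norm (expR_ge0 _)) ler_wpM2l ?expR_ge0//.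
apply: le_trans (ler_normB _ _) _; rewrite !normrM; apply: lerD.
- by rewrite ler_piMr// cos_max.
- by rewrite ler_piMr// sin_max.
Qed.

Lemma normr_ln_le (y d M : R) : 0 < d -> d <= y -> y <= M -> `|ln y| <= M + d^-1.
Proof.
move=> d0 dy yM; have y0 : 0 < y by rewrite (lt_le_trans d0).
have M0 : 0 < M by rewrite (lt_le_trans y0).
have di : 0 < d^-1 by rewrite invr_gt0.
rewrite ler_norml; apply/andP; split; last first.
  by have := ln_sublinear y0; lra.
have yi : 0 < y^-1 by rewrite invr_gt0.
have := ln_sublinear yi; rewrite lnV// => h.
have : y^-1 <= d^-1 by rewrite lef_pV2.
lra.
Qed.

Hypotheses (p0 : 0 < p) (p1 : p < 1) (q0 : 0 < q) (q1 : q < 1).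

Lemma sqmod_le_sqr kap t x T : `|kap| <= 1 -> `|t| <= T ->
  sqmod kap t x <= (1 + T) ^+ 2.
Proof.
move=> k1 tT; apply: le_trans (sqmod_le _ _ _) _.
have T0 : 0 <= T by rewrite (le_trans (normr_ge0 t)).
rewrite ler_sqr ?nnegrE ?addr_ge0// lerD2l normrM -[T]mul1r.
exact: ler_pM.
Qed.

Lemma amp_le t x d T : 0 < d -> `|t| <= T ->
  d <= sqmod (- p) t x -> d <= sqmod q t x ->
  amp t x <= `|nu * ln t| + (`|b| + `|a|) * ((1 + T) ^+ 2 + d^-1).
Proof.
move=> d0 tT dD1 dD2; set M := _ + d^-1.
have np : `|- p| <= 1 by rewrite normrN gtr0_norm// ltW.
have nq : `|q| <= 1 by rewrite gtr0_norm// ltW.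
have l1 := normr_ln_le d0 dD1 (sqmod_le_sqr x np tT).
have l2 := normr_ln_le d0 dD2 (sqmod_le_sqr x nq tT).
have m1 : `|b * lmod (- p) t x| <= `|b| * M.
  rewrite normrM ler_wpM2l// /lmod normrM.
  rewrite (ger0_norm (_ : 0 <= 2^-1)) ?invr_ge0//.
  by have := normr_ge0 (ln (sqmod (- p) t x)); rewrite /M; lra.
have m2 : `|a * lmod q t x| <= `|a| * M.
  rewrite normrM ler_wpM2l// /lmod normrM.
  rewrite (ger0_norm (_ : 0 <= 2^-1)) ?invr_ge0//.
  by have := normr_ge0 (ln (sqmod q t x)); rewrite /M; lra.
rewrite /amp mulrDl addrA; apply: lerD; last by apply: le_trans m2; exact: ler_norm.
apply: lerD; last by apply: le_trans m1; exact: ler_norm.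
by rewrite -normrN ler_norm.
Qed.

(** A bound for domination, uniform as long as the circle stays away from the
    branch points; the signs of [a] and [b] are arbitrary. *)
Lemma wave_bound t1 T d : 0 < t1 -> 0 < d ->
  exists C, forall t x, t1 <= t -> t <= T ->
    d <= sqmod (- p) t x -> d <= sqmod q t x ->
    `|wre t x| <= C /\ `|wret t x| <= C.
Proof.
move=> t10 d0.
set E := expR (`|nu| * (T + t1^-1) + (`|b| + `|a|) * ((1 + T) ^+ 2 + d^-1)).
set W := `|nu| / t1 + (`|b| + `|a|) * ((1 + T) / d) * 2.
exists (E * (1 + W)) => t x t1t tT dD1 dD2.
have t0 : 0 < t by rewrite (lt_le_trans t10).
have T0 : 0 < T by rewrite (lt_le_trans t0).
have ampE : expR (amp t x) <= E.
  have tT' : `|t| <= T by rewrite gtr0_norm.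
  rewrite /E ler_expR; apply: le_trans (amp_le d0 tT' dD1 dD2) _.
  apply: lerD => //; rewrite normrM ler_wpM2l//; exact: normr_ln_le.
have E0 : 0 <= E by exact: expR_ge0.
have W0 : 0 <= W.
  have r0 : 0 <= (1 + T) / d by rewrite divr_ge0 ?ltW ?addr_gt0.
  by rewrite /W; apply: addr_ge0; [rewrite divr_ge0// ltW|do 2?apply: mulr_ge0 => //; exact: addr_ge0].
split.
  apply: le_trans (wre_le _ _) _; apply: le_trans ampE _.
  by rewrite ler_peMr// lerDl.
apply: le_trans (wret_le _ _) _; apply: ler_pM; [exact: expR_ge0|exact: addr_ge0|exact: ampE|].
have frac (u s y : R) : 0 < u -> u < 1 -> d <= y -> `|s| <= 1 + T ->
    `|u * s / y| <= (1 + T) / d.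
  move=> u0 u1 dy sT; have y0 : 0 < y by rewrite (lt_le_trans d0).
  rewrite normrM normrM normfV (gtr0_norm y0) (gtr0_norm u0).
  apply: ler_pM; rewrite ?mulr_ge0 ?invr_ge0 ?(ltW y0) ?(ltW u0)//.
    by rewrite -[1 + T]mul1r ler_pM// ltW.
  by rewrite lef_pV2.
have bnd1 : `|cos x - p * t| <= 1 + T.
  apply: le_trans (ler_normB _ _) _; apply: lerD; first exact: cos_max.
  rewrite normrM (gtr0_norm p0) (gtr0_norm t0) -[T]mul1r ler_pM// ltW//.
have bnd2 : `|cos x + q * t| <= 1 + T.
  apply: le_trans (ler_normD _ _) _; apply: lerD; first exact: cos_max.
  rewrite normrM (gtr0_norm q0) (gtr0_norm t0) -[T]mul1r ler_pM// ltW//.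
have bnd3 : `|sin x| <= 1 + T by rewrite (le_trans (sin_max x))// lerDl ltW.
have h1 := frac _ _ _ p0 p1 dD1 bnd1.
have h2 := frac _ _ _ q0 q1 dD2 bnd2.
have h3 := frac _ _ _ p0 p1 dD1 bnd3.
have h4 := frac _ _ _ q0 q1 dD2 bnd3.
have ha : `|ampt t x| <= `|nu| / t1 + (`|b| + `|a|) * ((1 + T) / d).
  rewrite mulrDl addrA; apply: le_trans (ler_normD _ _) _; apply: lerD.
    apply: le_trans (ler_normB _ _) _; apply: lerD.
      rewrite normrN normrM normfV (gtr0_norm t0) ler_wpM2l// lef_pV2//.
    by rewrite normrM ler_wpM2l.
  by rewrite normrM ler_wpM2l.
have hp : `|phst t x| <= (`|b| + `|a|) * ((1 + T) / d).
  rewrite mulrDl; apply: le_trans (ler_normB _ _) _; apply: lerD;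
    by rewrite normrM ler_wpM2l.
by rewrite /W; lra.
Qed.

Definition wint t : R := \int[mu]_(x in `]0, pi[) wre t x.

Lemma is_derive_wint t0 : 0 < t0 -> p * t0 != 1 -> q * t0 != 1 ->
  is_derive t0 1 wint (- ((wim t0 pi - wim t0 0) / t0)).
Proof.
move=> t00 pt qt.
set c := Num.min t0 (Num.min `|1 - p * t0| `|1 - q * t0|).
have c0 : 0 < c by rewrite !lt_min t00 !normr_gt0 !subr_eq0 ![1 == _]eq_sym pt qt.
have [ct cp cq] : [/\ c <= t0, c <= `|1 - p * t0| & c <= `|1 - q * t0|].
  by rewrite !ge_min !lexx !orbT.
have e0 : 0 < c / 2 by lra.
have near_t t : `|t - t0| < c / 2 -> t0 / 2 <= t /\ t <= 2 * t0.
  by rewrite ltr_distl => /andP[? ?]; split; lra.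
have dist (u t : R) : 0 < u -> u < 1 -> `|t - t0| < c / 2 -> c <= `|1 - u * t0| ->
    (c / 2) ^+ 2 <= (1 - u * t) ^+ 2.
  move=> u0 u1 tt0 cu; rewrite -[leRHS]real_normK ?num_real//.
  rewrite ler_sqr ?nnegrE ?normr_ge0//; last exact: ltW.
  have : `|1 - u * t0| <= `|1 - u * t| + `|u * (t - t0)|.
    by rewrite (_ : 1 - u * t0 = (1 - u * t) + u * (t - t0)); [exact: ler_normD|ring].
  have : `|u * (t - t0)| <= `|t - t0| by rewrite normrM ler_piMl// gtr0_norm// ltW.
  lra.
have dD t x : `|t - t0| < c / 2 ->
    (c / 2) ^+ 2 <= sqmod (- p) t x /\ (c / 2) ^+ 2 <= sqmod q t x.
  move=> tt0; have [h1 h2] := near_t _ tt0.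
  have t_gt0 : 0 < t by lra.
  split; apply: le_trans (sqmod_ge _ _ _).
    by rewrite mulNr normrN gtr0_norm ?mulr_gt0//; exact: dist.
  by rewrite gtr0_norm ?mulr_gt0//; exact: dist.
have d0 : 0 < (c / 2) ^+ 2 by rewrite exprn_gt0.
have Dpos t x : `|t - t0| < c / 2 -> 0 < sqmod (- p) t x /\ 0 < sqmod q t x.
  by move=> /(dD _ x)[h1 h2]; split; exact: lt_le_trans d0 _.
have self : `|t0 - t0| < c / 2 by rewrite subrr normr0.
have t20 : 0 < t0 / 2 by lra.
have [C hC] := @wave_bound (t0 / 2) (2 * t0) ((c / 2) ^+ 2) t20 d0.
have spos x : x \in `[0, pi] -> 0 <= sin x.
  by rewrite in_itv /= => ?; exact: sin_ge0_pi.
have spos' x : x \in `]0, pi[ -> 0 <= sin x.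
  by move=> /subset_itv_oo_cc; exact: spos.
have tpos t : `|t - t0| < c / 2 -> 0 < t by move=> /near_t[? ?]; lra.
refine (is_derive_congr (@is_derive_Rintegral R wre wret
  (fun x => (- t0^-1) * wim t0 x) 0 pi t0 (c / 2) C (pi_gt0 R) e0 _ _ _ _ _ _) _).
- move=> t x te xpi; have [h1 h2] := Dpos t x te.
  exact: (is_derive_wret h1 h2 (spos' _ xpi) (tpos _ te)).
- move=> t x te xpi; have [h1 h2] := Dpos t x te.
  exact: (continuous_wrex h1 h2 (spos' _ xpi) (tpos _ te)).
- move=> t x te xpi; have [h1 h2] := dD t x te; have [h3 h4] := near_t t te.
  by have [] := hC t x h3 h4 h1 h2.
- move=> t x te xpi; have [h1 h2] := dD t x te; have [h3 h4] := near_t t te.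
  by have [] := hC t x h3 h4 h1 h2.
- move=> x xpi; have [h1 h2] := Dpos t0 x self.
  refine (is_derive_congr (is_derive_scale _ (is_derive_wimx h1 h2 (spos _ xpi) t00)) _).
  by field; rewrite gt_eqF.
- move=> x xpi; have [h1 h2] := Dpos t0 x self.
  exact: (continuous_wretx h1 h2 (spos _ xpi) t00).
- by field; rewrite gt_eqF.
Qed.

(** For nonnegative exponents the integrand stays bounded up to the branch
    points. *)
Lemma amp_le_ge0 t x t1 T : 0 <= b -> 0 <= a -> 0 < t1 -> t1 <= t -> t <= T ->
  amp t x <= `|nu| * (T + t1^-1) + (b + a) * (1 + T) ^+ 2.
Proof.
move=> b0 a0 t10 t1t tT.
have t0 : 0 < t by rewrite (lt_le_trans t10).
have half kap : `|kap| <= 1 -> lmod kap t x <= (1 + T) ^+ 2.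
  move=> k1; have D := @sqmod_le_sqr kap t x T k1.
  rewrite (gtr0_norm t0) in D; have {}D := D tT.
  have D0 : 0 <= sqmod kap t x by rewrite addr_ge0 ?sqr_ge0.
  rewrite /lmod; suff : ln (sqmod kap t x) <= sqmod kap t x by lra.
  move: D0; rewrite le_eqVlt => /predU1P[<-|]; first by rewrite ln0.
  by move=> /ln_sublinear /ltW.
have np : `|- p| <= 1 by rewrite normrN gtr0_norm// ltW.
have nq : `|q| <= 1 by rewrite gtr0_norm// ltW.
rewrite /amp mulrDl addrA; apply: lerD; last by rewrite ler_wpM2l// half.
apply: lerD; last by rewrite ler_wpM2l// half.
rewrite (le_trans (ler_norm _))// normrN normrM ler_wpM2l//.
exact: normr_ln_le.
Qed.

(** This includes the two radii where the half-circle ends at a branch point. *)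
Lemma continuous_wint t0 : 0 <= b -> 0 <= a -> 0 < t0 ->
  {for t0, continuous wint}.
Proof.
move=> b0 a0 t00; have e0 : 0 < t0 / 2 by lra.
have near_t t : `|t - t0| < t0 / 2 -> [/\ t0 / 2 <= t, t <= 2 * t0 & 0 < t].
  by rewrite ltr_distl => /andP[? ?]; split; lra.
have spos x : x \in `]0, pi[ -> 0 <= sin x.
  by rewrite in_itv /= => /andP[h1 h2]; apply: sin_ge0_pi; rewrite !ltW.
pose C := expR (`|nu| * (2 * t0 + (t0 / 2)^-1) + (b + a) * (1 + 2 * t0) ^+ 2).
have t20 : 0 < t0 / 2 by lra.
apply: (continuous_Rintegral (C := C) e0) => t x te xpi;
  have [h1 h2 h3] := near_t _ te;
  have D1 := sqmod_gt0 (- p) t xpi; have D2 := sqmod_gt0 q t xpi.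
- exact: (is_derive_continuous (is_derive_wret D1 D2 (spos _ xpi) h3)).
- exact: (continuous_wrex D1 D2 (spos _ xpi) h3).
- apply: le_trans (wre_le _ _) _.
  by rewrite ler_expR; exact: amp_le_ge0 t20 h1 h2.
Qed.

Lemma larg0 kap t : 0 < 1 + kap * t -> larg kap t 0 = 0.
Proof. by move=> h; rewrite /larg cos0 sin0 uarg_pos// subr0. Qed.

Lemma largpi kap t : kap * t < 1 -> larg kap t pi = 0.
Proof. by move=> h; rewrite /larg cospi sinpi uarg_neg ?subrr//; lra. Qed.

(** Before the branch point [w = 1 / p] the integrand is real on the real axis. *)
Lemma wim0 t : 0 < t -> p * t < 1 -> wim t 0 = 0.
Proof.
move=> t0 pt; rewrite /wim /phs !larg0.
- by rewrite !mulr0 !addr0 sin0 mulr0.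
- by rewrite ltr_wpDr// mulr_ge0 ?ltW.
- by lra.
Qed.

Lemma sin_natpi (n : nat) : sin (n%:R * pi : R) = 0.
Proof.
elim: n => [|n IH]; first by rewrite mul0r sin0.
by rewrite -natr1 mulrDl mul1r sinDpi IH oppr0.
Qed.

(** Before the branch point [w = - 1 / q] the integrand is real on the real
    axis, as [nu] is an integer. *)
Lemma wimpi t n : nu = n%:R -> 0 < t -> q * t < 1 -> wim t pi = 0.
Proof.
move=> nun t0 qt; rewrite /wim /phs !largpi//.
- by rewrite !mulr0 !addr0 nun sin_natpi mulr0.
- by rewrite mulNr; have := mulr_gt0 p0 t0; lra.
Qed.

End Wave.

(** * Krawtchouk polynomials as contour integrals *)

Section Coefficients.
Variable R : realType.
Notation mu := (@lebesgue_measure R).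
Implicit Types (p q nu b a t x : R).

Lemma sqmod_ge_half kap t x : `|kap| <= 1 -> `|t| < 2^-1 ->
  2^-1 ^+ 2 <= sqmod kap t x.
Proof.
move=> k1 t2; apply: le_trans (sqmod_ge _ _ _).
have : `|kap * t| <= 1 * `|t| by rewrite normrM ler_wpM2r.
by move=> h; rewrite ler_sqr ?nnegrE; lra.
Qed.

Lemma wre_amp0 p q b a x : x \in `]0, pi[ -> wre p q 0 b a 0 x = 1.
Proof.
move=> xpi; have xpi' := subset_itv_oo_cc xpi.
have l kap : lmod kap 0 x = 0.
  by rewrite /lmod /sqmod mulr0 addr0 cos2Dsin2 ln1 mul0r.
have g kap : larg kap 0 x = 0.
  by rewrite /larg mulr0 addr0 uarg_polar// subrr.
by rewrite /wre /amp /phs !l !g !mul0r !mulr0 oppr0 !addr0 expR0 cos0 mul1r.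
Qed.

Lemma continuous_wint_0 p q b a : 0 < p < 1 -> 0 < q < 1 ->
  {for 0, continuous (wint p q 0 b a)}.
Proof.
move=> /andP[p0 p1] /andP[q0 q1].
have np : `|- p| <= 1 by rewrite normrN gtr0_norm// ltW.
have nq : `|q| <= 1 by rewrite gtr0_norm// ltW.
have e0 : (0 : R) < 2^-1 by lra.
have d0 : (0 : R) < 2^-1 ^+ 2 by rewrite exprn_gt0.
pose C := expR (0 + (`|b| + `|a|) * ((1 + 2^-1) ^+ 2 + (2^-1 ^+ 2)^-1)).
apply: (continuous_Rintegral (C := C) e0) => t x; rewrite subr0 => te xpi;
  have D1 := sqmod_ge_half x np te; have D2 := sqmod_ge_half x nq te;
  have D1' := lt_le_trans d0 D1; have D2' := lt_le_trans d0 D2;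
  have s0 : 0 <= sin x by apply: sin_ge0_pi; move: xpi; rewrite in_itv /=;
    case/andP=> *; rewrite !ltW.
- have -> : (wre p q 0 b a)^~ x = (fun s => expR (b * lmod (- p) s x + a * lmod q s x)
      * cos (phs p q 0 b a s x)).
    by apply/funext => s; rewrite /wre /amp mul0r oppr0 add0r.
  exact: (is_derive_continuous (is_derive_mul (is_derive_expR_comp
    (is_derive_add (is_derive_scale b (is_derive_lmodt D1'))
      (is_derive_scale a (is_derive_lmodt D2'))))
    (is_derive_cos_comp (is_derive_phst 0 b a D1' D2' s0)))).
- exact: (is_derive_continuous (is_derive_mul (is_derive_expR_comp
    (is_derive_ampx 0 b a D1' D2'))
    (is_derive_cos_comp (is_derive_add (is_derive_add
      (is_derive_scale 0 (is_derive_var _))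
      (is_derive_scale b (is_derive_largx D1' s0)))
      (is_derive_scale a (is_derive_largx D2' s0)))))).
- apply: le_trans (wre_le _ _ _ _ _ _ _) _; rewrite ler_expR.
  have := amp_le 0 b a p0 p1 q0 q1 d0 (ltW te) D1 D2.
  by rewrite mul0r normr0.
Qed.

(** The integral does not depend on the radius, and at radius 0 the integrand
    is 1. *)
Lemma wint_0 p q b a t : 0 < p < 1 -> 0 < q < 1 -> 0 < t < 1 ->
  wint p q 0 b a t = pi.
Proof.
move=> pp qq /andP[t0 t1]; have [p0 p1] := andP pp; have [q0 q1] := andP qq.
have small (u s : R) : 0 < u < 1 -> 0 < s < 1 -> u * s < 1.
  by move=> /andP[? ?] /andP[? ?]; rewrite -[ltRHS]mulr1 ltr_pM// ltW.
have dJ (s : R) : 0 < s < 1 -> is_derive s 1 (wint p q 0 b a) 0.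
  move=> ss; have [s0 s1] := andP ss.
  have ps := small _ _ pp ss; have qs := small _ _ qq ss.
  have := is_derive_wint 0 b a p0 p1 q0 q1 s0.
  rewrite !lt_eqF// => /(_ isT isT).
  rewrite (wim0 0 b a q0 s0 ps) (wimpi b a p0 (n := 0) erefl s0 qs) subr0 mul0r oppr0.
  exact.
have c0 : wint p q 0 b a 0 = pi.
  rewrite /wint; transitivity (\int[mu]_(x in `]0, pi[) (1 : R)).
    by apply: eq_Rintegral => x /set_mem; exact: wre_amp0.
  rewrite (@Rintegral_itvoo_FTC R (fun=> 1) id) ?pi_gt0 ?subr0// => x _.
  exact: cvg_cst.
have := @mvt_bound R (wint p q 0 b a) 0 t 0 (ltW t0).
rewrite mul0r normr_le0 subr_eq0 c0 => h; apply/eqP/h => x.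
- rewrite in_itv /= => /andP[]; rewrite le_eqVlt => /predU1P[<- _|x0 xt].
    exact: continuous_wint_0.
  by apply: (is_derive_continuous (dJ x _)); rewrite x0 (le_lt_trans xt).
- rewrite in_itv /= => /andP[x0 xt]; exists 0; last by rewrite normr0.
  by apply: dJ; rewrite x0 (lt_trans xt).
Qed.

(** Pointwise form of the recurrence: with [f = (1 + q w) ^ a (1 - p w) ^ b], the
    left-hand side is the derivative of [wim] in [x], and the right-hand side
    comes from [w f' = a q w f / (1 + q w) - b p w f / (1 - p w)]. *)
Lemma wret_rec p q nu b a t x : 0 < t ->
  0 < sqmod (- p) t x -> 0 < sqmod q t x -> 0 <= sin x ->
  - t * wret p q nu b a t x =
    nu * wre p q nu b a t x - a * q * wre p q (nu - 1) b (a - 1) t x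
    + b * p * wre p q (nu - 1) (b - 1) a t x.
Proof.
move=> t0 D1 D2 s0.
have sq (kap : R) : 0 < sqmod kap t x ->
    [/\ expR (ln t - lmod kap t x) = t / Num.sqrt (sqmod kap t x),
        cos (x + larg kap t x) = (cos x + kap * t) / Num.sqrt (sqmod kap t x) &
        sin (x + larg kap t x) = sin x / Num.sqrt (sqmod kap t x)].
  move=> D; have -> : x + larg kap t x = uarg (cos x + kap * t) (sin x).
    by rewrite /larg; ring.
  split; [|exact: cos_uarg|exact: sin_uarg].
  rewrite expRB lnK ?posrE//; congr (_ / _).
  have h : expR (lmod kap t x) ^+ 2 = sqmod kap t x.
    by rewrite -expRM_natr /lmod divfK ?pnatr_eq0// lnK.
  by rewrite -[in RHS]h sqrtr_sqr ger0_norm// expR_ge0.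
have [e1 c1 s1] := sq _ D1; have [e2 c2 s2] := sq _ D2.
have w2 : wre p q (nu - 1) b (a - 1) t x = expR (amp p q nu b a t x) *
    (t / sqmod q t x) * (cos (phs p q nu b a t x) * (cos x + q * t)
      + sin (phs p q nu b a t x) * sin x).
  rewrite /wre.
  have -> : amp p q (nu - 1) b (a - 1) t x =
     amp p q nu b a t x + (ln t - lmod q t x) by rewrite /amp; ring.
  have -> : phs p q (nu - 1) b (a - 1) t x =
     phs p q nu b a t x - (x + larg q t x) by rewrite /phs; ring.
  rewrite expRD cosB e2 c2 s2 -[in RHS](sqr_sqrtr (ltW D2)); field.
  by rewrite gt_eqF ?sqrtr_gt0.
have w1 : wre p q (nu - 1) (b - 1) a t x = expR (amp p q nu b a t x) *
    (t / sqmod (- p) t x) * (cos (phs p q nu b a t x) * (cos x - p * t)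
      + sin (phs p q nu b a t x) * sin x).
  rewrite /wre.
  have -> : amp p q (nu - 1) (b - 1) a t x =
     amp p q nu b a t x + (ln t - lmod (- p) t x) by rewrite /amp; ring.
  have -> : phs p q (nu - 1) (b - 1) a t x =
     phs p q nu b a t x - (x + larg (- p) t x) by rewrite /phs; ring.
  rewrite expRD cosB e1 c1 s1 -[in RHS](sqr_sqrtr (ltW D1)); field.
  by rewrite gt_eqF ?sqrtr_gt0.
rewrite w1 w2 /wret /wre /ampt /phst; field.
by rewrite !gt_eqF.
Qed.

(** The integral of the derivative of [wim] vanishes because [wim] is zero at
    both ends of the half-circle. *)
Lemma wint_rec p q b a t (n : nat) : 0 < p < 1 -> 0 < q < 1 -> 0 < t < 1 ->
  n.+1%:R * wint p q n.+1%:R b a t =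
  a * q * wint p q n%:R b (a - 1) t - b * p * wint p q n%:R (b - 1) a t.
Proof.
move=> pp qq tt; have [p0 p1] := andP pp; have [q0 q1] := andP qq.
have [t0 t1] := andP tt.
have small (u : R) : 0 < u < 1 -> u * t < 1.
  by move=> /andP[? ?]; rewrite -[ltRHS]mulr1 ltr_pM// ltW.
have pt := small _ pp; have qt := small _ qq.
have D1 x : 0 < sqmod (- p) t x.
  apply: lt_le_trans _ (sqmod_ge _ _ _); rewrite mulNr normrN (gtr0_norm (mulr_gt0 p0 t0)).
  by rewrite exprn_gt0// subr_gt0.
have D2 x : 0 < sqmod q t x.
  apply: lt_le_trans _ (sqmod_ge _ _ _); rewrite (gtr0_norm (mulr_gt0 q0 t0)).
  by rewrite exprn_gt0// subr_gt0.
have spos x : x \in `[0, pi] -> 0 <= sin x.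
  by rewrite in_itv /=; exact: sin_ge0_pi.
have iw nu b' a' : mu.-integrable `]0, pi[ (EFin \o wre p q nu b' a' t).
  have cw x : x \in `[0, pi] -> {for x, continuous (wre p q nu b' a' t)}.
    by move=> xpi; apply: continuous_wrex => //; exact: spos.
  have [M _ hM] := continuous_bounded_itvcc cw.
  apply: (integrable_itvoo (M := M)) => x /subset_itv_oo_cc xpi; [exact: cw|exact: hM].
set nu : R := n.+1%:R.
have nu1 : n%:R = nu - 1 :> R by rewrite /nu -natr1 addrK.
rewrite nu1.
have := @Rintegral_itvoo_FTC R (fun x => - t * wret p q nu b a t x) (wim p q nu b a t)
  0 pi (pi_gt0 R).
rewrite (wim0 _ b a q0 t0 pt) (wimpi b a p0 (n := n.+1) erefl t0 qt) subrr => h.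
have {}h : \int[mu]_(x in `]0, pi[) (- t * wret p q nu b a t x) = 0.
  apply: h => x xpi; first exact: is_derive_wimx (spos _ xpi) t0.
  by apply: cvgM; [exact: cvg_cst|apply: continuous_wretx => //; exact: spos].
have : \int[mu]_(x in `]0, pi[) (- t * wret p q nu b a t x) =
  \int[mu]_(x in `]0, pi[) (nu * wre p q nu b a t x -
     a * q * wre p q (nu - 1) b (a - 1) t x
    + b * p * wre p q (nu - 1) (b - 1) a t x).
  apply: eq_Rintegral => x /set_mem /subset_itv_oo_cc xpi.
  by apply: wret_rec => //; exact: spos.
rewrite h.
have iZ k nu' b' a' :
    mu.-integrable `]0, pi[ (EFin \o (fun x => k * wre p q nu' b' a' t x)).
  by have := @integrableZl _ _ _ mu `]0, pi[ _ k _ (iw nu' b' a'); apply.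
rewrite RintegralD//; last first.
  by have := @integrableB _ _ _ mu `]0, pi[ _ _ _ (iZ nu nu b a)
    (iZ (a * q) (nu - 1) b (a - 1)); apply.
rewrite RintegralB// !RintegralZl// -!/(wint _ _ _ _ _ _) => e.
lra.
Qed.

(** The coefficient of [w ^ n] in (1 + q w) ^ a (1 - p w) ^ b.  Krawtchouk
    polynomials are the case [a + b = N], but the recurrence lowers [a] and [b]
    independently. *)
Definition krawc p q b a (n : nat) : R :=
  \sum_(k < n.+1) rbinom a k * rbinom b (n - k) * q ^+ k * (- p) ^+ (n - k).

Lemma rbinomS a k : k.+1%:R * rbinom a k.+1 = a * rbinom (a - 1) k.
Proof.
rewrite /rbinom big_ord_recl subr0 factS natrM.
under eq_bigr do rewrite /bump /= natrD opprD addrA.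
field; rewrite !pnatr_eq0 -!lt0n fact_gt0 /=.
by rewrite addrC natr1 pnatr_eq0.
Qed.

Lemma krawc_rec p q b a n :
  n.+1%:R * krawc p q b a n.+1 =
  a * q * krawc p q b (a - 1) n - b * p * krawc p q (b - 1) a n.
Proof.
rewrite /krawc.
have -> : n.+1%:R * (\sum_(k < n.+2)
    rbinom a k * rbinom b (n.+1 - k) * q ^+ k * (- p) ^+ (n.+1 - k)) =
  \sum_(k < n.+2)
    k%:R * (rbinom a k * rbinom b (n.+1 - k) * q ^+ k * (- p) ^+ (n.+1 - k)) +
  \sum_(k < n.+2) (n.+1 - k)%:R *
    (rbinom a k * rbinom b (n.+1 - k) * q ^+ k * (- p) ^+ (n.+1 - k)).
  rewrite -big_split mulr_sumr; apply: eq_bigr => k _ /=.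
  by rewrite -mulrDl -natrD subnKC// -ltnS.
congr (_ + _).
  rewrite big_ord_recl mul0r add0r mulr_sumr; apply: eq_bigr => k _.
  rewrite /= /bump /= add1n subSS exprS.
  have := rbinomS a k; set X := rbinom a _; set Y := rbinom (a - 1) _ => XY.
  transitivity ((k.+1%:R * X) * (rbinom b (n - k) * (q * q ^+ k) * (- p) ^+ (n - k))).
    by ring.
  by rewrite XY; ring.
rewrite big_ord_recr /= subnn mul0r addr0 -mulNr mulr_sumr; apply: eq_bigr => k _.
have kn : (k <= n)%N by rewrite -ltnS.
rewrite subSn// exprS.
have := rbinomS b (n - k); set X := rbinom b _; set Y := rbinom (b - 1) _ => XY.
transitivity (((n - k).+1%:R * X) * (rbinom a k * q ^+ k * (- p * (- p) ^+ (n - k)))).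
  by ring.
by rewrite XY; ring.
Qed.

(** A contour integral representation for arbitrary real exponents, by induction
    on [n]. *)
Lemma wint_krawc p q b a t n : 0 < p < 1 -> 0 < q < 1 -> 0 < t < 1 ->
  wint p q n%:R b a t = pi * krawc p q b a n.
Proof.
move=> pp qq tt; elim: n b a => [|n IH] b a.
  rewrite wint_0// /krawc big_ord1 /rbinom !big_ord0 fact0 !expr0.
  by rewrite divr1 !mulr1.
have n0 : n.+1%:R != 0 :> R by rewrite pnatr_eq0.
apply: (mulfI n0).
by rewrite wint_rec// !IH [RHS]mulrCA krawc_rec; ring.
Qed.

End Coefficients.

Section Deformation.
Variable R : realType.
Implicit Types (p q nu b a t x r M : R).

(** The boundary terms appear only at the radii beyond a branch point, where
    they are assumed to be at most [M]; continuity of the integral carries the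
    mean value inequality across the exceptional radii. *)
Lemma wint_deform p q b a r M (n : nat) : 0 < p < 1 -> 0 < q < 1 -> 0 < r ->
  0 <= b -> 0 <= a ->
  (forall t, 0 < t -> t < r -> 1 < p * t -> `|wim p q n%:R b a t 0| <= M) ->
  (forall t, 0 < t -> t < r -> 1 < q * t -> `|wim p q n%:R b a t pi| <= M) ->
  0 <= M ->
  `|wint p q n%:R b a r - pi * krawc p q b a n| <= 4 * (1 + r) * M.
Proof.
move=> pp qq r0 b0 a0 M1 M2 M0; have [p0 p1] := andP pp; have [q0 q1] := andP qq.
set t1 := Num.min r 1 / 2.
have [t10 t11 t1r] : [/\ 0 < t1, t1 < 1 & t1 < r].
  have h1 : Num.min r 1 <= r by rewrite ge_min lexx.
  have h2 : Num.min r 1 <= 1 by rewrite ge_min lexx orbT.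
  have h3 : 0 < Num.min r 1 by rewrite lt_min r0 ltr01.
  by rewrite /t1; split; lra.
rewrite -(@wint_krawc _ p q b a t1)//; last by rewrite t10.
have key : forall t, t1 < t -> t < r -> p * t != 1 -> q * t != 1 ->
   `|(wim p q n%:R b a t pi - wim p q n%:R b a t 0) / t| <= 2 * M / t1.
  move=> t t1t tr pt qt; have t0 : 0 < t by rewrite (lt_trans t10).
  rewrite normrM normfV (gtr0_norm t0) ler_pM ?normr_ge0 ?invr_ge0 ?(ltW t0)//; last first.
    by rewrite lef_pV2 ?posrE// ltW.
  apply: le_trans (ler_normB _ _) _; rewrite mulr2n mulrDl !mul1r; apply: lerD.
    have [h|h] := ltP (q * t) 1; first by rewrite (wimpi b a p0 (n := n) erefl t0 h) normr0.
    by apply: M2 => //; rewrite lt_neqAle eq_sym qt.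
  have [h|h] := ltP (p * t) 1; first by rewrite (wim0 _ b a q0 t0 h) normr0.
  by apply: M1 => //; rewrite lt_neqAle eq_sym pt.
apply: le_trans (_ : 2 * M / t1 * (r - t1) <= _).
  apply: (mvt_bound_except (s := [:: p^-1; q^-1]) (ltW t1r)) => t.
    rewrite in_itv /= => /andP[h _]; apply: continuous_wint => //.
    exact: lt_le_trans h.
  rewrite in_itv /= => /andP[h1 h2]; rewrite !inE negb_or => /andP[n1 n2].
  have pt : p * t != 1.
    by apply: contraNneq n1 => e; rewrite -(mulKf (lt0r_neq0 p0) t) e mulr1.
  have qt : q * t != 1.
    by apply: contraNneq n2 => e; rewrite -(mulKf (lt0r_neq0 q0) t) e mulr1.
  exists (- ((wim p q n%:R b a t pi - wim p q n%:R b a t 0) / t)).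
    by apply: is_derive_wint => //; exact: lt_trans h1.
  by rewrite normrN; exact: key.
have h : (r - t1) / t1 <= 2 * (1 + r).
  rewrite ler_pdivrMr// /t1.
  have [h|h] := leP r 1; first by nra.
  by nra.
have -> : 2 * M / t1 * (r - t1) = (2 * M) * ((r - t1) / t1) by ring.
have -> : 4 * (1 + r) * M = (2 * M) * (2 * (1 + r)) by ring.
by rewrite ler_wpM2l// mulr_ge0.
Qed.

End Deformation.

(** * The saddle circle *)

Section Saddle.
Variable R : realType.
(* The circle is given by [r = 1 / U0] and the saddle point on it by the cosine
   [c0] of its argument; [z] and [y] are rational functions of these, which
   turns the identities below into identities of rational functions. *)
Variables p q z y r c0 : R.
Hypotheses (p0 : 0 < p) (q0 : 0 < q) (pq1 : p + q = 1).
Hypotheses (r0 : 0 < r) (zE : z = p * q * r ^+ 2 / (1 + p * q * r ^+ 2)).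
Hypotheses (c0_gt : -1 < c0) (c0_lt : c0 < 1).
Hypothesis yE : y = p + z * (q - p + 2 * c0 / r).
Implicit Types (t x : R).

Notation A := (amp p q z (1 - y) y).

Let m0 : 0 < 1 + p * q * r ^+ 2.
Proof. by rewrite addr_gt0// !mulr_gt0. Qed.

Let qE : q = 1 - p. Proof. by rewrite -pq1; ring. Qed.

Let z0 : 0 < z.
Proof. by rewrite zE divr_gt0// !mulr_gt0. Qed.

(** The angular derivatives of [amp] and [phs] on the saddle circle, divided by
    [cos x - c0]: on [|u| = U0] the quadratic factor of psi' is a multiple of
    [cos x - c0] and of [u]. *)
Definition curv_re x : R := 2 * p * q * r ^+ 2 * sin x / (sqmod (- p) r x * sqmod q r x).
Definition curv_im x : R :=
  2 * z * ((1 - p * q * r ^+ 2) * cos x + (q - p) * r) / (sqmod (- p) r x * sqmod q r x).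

Let c0_fact : 0 <= (1 - c0) * (1 + c0).
Proof. by rewrite mulr_ge0 ?subr_ge0 ?(ltW c0_lt)// -lerBlDl sub0r ltW. Qed.

Let rN : r != 0. Proof. by rewrite gt_eqF. Qed.
Let mN : 1 + p * q * r ^+ 2 != 0. Proof. by rewrite gt_eqF. Qed.

Lemma phst_saddle x : 0 < sqmod (- p) r x -> 0 < sqmod q r x ->
  r * phst p q (1 - y) y r x = (cos x - c0) * curv_re x.
Proof.
move=> D1 D2; have D1N : sqmod (- p) r x != 0 by rewrite gt_eqF.
have D2N : sqmod q r x != 0 by rewrite gt_eqF.
rewrite /phst /curv_re.
have e : (1 - y) * p * sqmod q r x - y * q * sqmod (- p) r x =
   2 * p * q * r * (cos x - c0).
  rewrite !sqmodE yE zE; field: qE.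
  by rewrite rN mN.
transitivity (r * sin x * ((1 - y) * p * sqmod q r x - y * q * sqmod (- p) r x)
  / (sqmod (- p) r x * sqmod q r x)); first by field; rewrite D1N D2N.
by rewrite e; field; rewrite D1N D2N.
Qed.

Lemma ampt_saddle x : 0 < sqmod (- p) r x -> 0 < sqmod q r x ->
  - (r * ampt p q z (1 - y) y r x) = (cos x - c0) * curv_im x.
Proof.
move=> D1 D2; have D1N : sqmod (- p) r x != 0 by rewrite gt_eqF.
have D2N : sqmod q r x != 0 by rewrite gt_eqF.
rewrite /ampt /curv_im.
have e : z * sqmod (- p) r x * sqmod q r x
   + (1 - y) * (p * r * (cos x - p * r)) * sqmod q r x
   - y * (q * r * (cos x + q * r)) * sqmod (- p) r x
   = 2 * z * (cos x - c0) * ((1 - p * q * r ^+ 2) * cos x + (q - p) * r).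
  rewrite !sqmodE yE zE; field: qE.
  by rewrite rN mN.
transitivity ((z * sqmod (- p) r x * sqmod q r x
   + (1 - y) * (p * r * (cos x - p * r)) * sqmod q r x
   - y * (q * r * (cos x + q * r)) * sqmod (- p) r x)
  / (sqmod (- p) r x * sqmod q r x)); first by field; rewrite D1N D2N rN.
by rewrite e; field; rewrite D1N D2N.
Qed.

(** Since [-1 < c0 < 1], the quadratic factor of psi' has no real root, so the
    modulus is monotone along the cut. *)
Lemma amp_cut_pi t : 1 < q * t -> t <= r -> A t pi <= A r pi.
Proof.
move=> qt tr; have t0 : 0 < t by rewrite -(pmulr_rgt0 _ q0) (lt_trans ltr01).
have D1 s : 0 < s -> 0 < sqmod (- p) s pi.
  move=> s0; rewrite /sqmod cospi sinpi expr0n addr0.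
  have -> : (-1 + - p * s) ^+ 2 = (1 + p * s) ^+ 2 by ring.
  by rewrite exprn_gt0// addr_gt0// mulr_gt0.
have D2 s : t <= s -> 0 < sqmod q s pi.
  move=> s0; rewrite /sqmod cospi sinpi expr0n addr0 exprn_gt0//.
  have : q * t <= q * s by rewrite ler_pM2l.
  by lra.
have d s : t <= s -> is_derive s 1 (A ^~ pi) (ampt p q z (1 - y) y s pi).
  move=> ts; have s0 : 0 < s by rewrite (lt_le_trans t0).
  by apply: is_derive_ampt => //; [exact: D1|exact: D2].
have wf : {within `[t, r], continuous (A ^~ pi)}.
  apply: continuous_in_subspaceT => s /set_mem; rewrite /= in_itv /= => /andP[ts _].
  exact: (is_derive_continuous (d s ts)).
have d' s : s \in `]t, r[ -> is_derive s 1 (A ^~ pi) (ampt p q z (1 - y) y s pi).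
  by rewrite in_itv /= => /andP[ts _]; apply: d; exact: ltW.
have [c] := MVT_segment tr d' wf.
rewrite in_itv /= => /andP[tc cr] e; rewrite -subr_ge0 e.
  apply: mulr_ge0; last by rewrite subr_ge0.
  have c00 : 0 < c by rewrite (lt_le_trans t0).
  have qc : 0 < q * c - 1 by have : q * t <= q * c; [rewrite ler_pM2l|lra].
  have pc : 0 < 1 + p * c by rewrite addr_gt0// mulr_gt0.
  have -> : ampt p q z (1 - y) y c pi =
     z * ((c / r + c0) ^+ 2 + (1 - c0) * (1 + c0)) / (c * (1 + p * c) * (q * c - 1)).
    rewrite /ampt /sqmod cospi sinpi expr0n !addr0 yE zE; field: qE.
    by rewrite rN mN (gt_eqF qc) (gt_eqF pc) (gt_eqF c00) /= lt_eqF//; lra.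
  apply: divr_ge0; last by rewrite !mulr_ge0// ltW.
  apply: mulr_ge0; first exact: ltW.
  by apply: addr_ge0; [exact: sqr_ge0|exact: c0_fact].
Qed.

(** The same argument on the other cut. *)
Lemma amp_cut_0 t : 1 < p * t -> t <= r -> A t 0 <= A r 0.
Proof.
move=> pt tr; have t0 : 0 < t by rewrite -(pmulr_rgt0 _ p0) (lt_trans ltr01).
have D2 s : 0 < s -> 0 < sqmod q s 0.
  move=> s0; rewrite /sqmod cos0 sin0 expr0n addr0.
  by rewrite exprn_gt0// addr_gt0// mulr_gt0.
have D1 s : t <= s -> 0 < sqmod (- p) s 0.
  move=> s0; rewrite /sqmod cos0 sin0 expr0n addr0.
  have -> : (1 + - p * s) ^+ 2 = (p * s - 1) ^+ 2 by ring.
  rewrite exprn_gt0//.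
  have : p * t <= p * s by rewrite ler_pM2l.
  by lra.
have d s : t <= s -> is_derive s 1 (A ^~ 0) (ampt p q z (1 - y) y s 0).
  move=> ts; have s0 : 0 < s by rewrite (lt_le_trans t0).
  by apply: is_derive_ampt => //; [exact: D1|exact: D2].
have wf : {within `[t, r], continuous (A ^~ 0)}.
  apply: continuous_in_subspaceT => s /set_mem; rewrite /= in_itv /= => /andP[ts _].
  exact: (is_derive_continuous (d s ts)).
have d' s : s \in `]t, r[ -> is_derive s 1 (A ^~ 0) (ampt p q z (1 - y) y s 0).
  by rewrite in_itv /= => /andP[ts _]; apply: d; exact: ltW.
have [c] := MVT_segment tr d' wf.
rewrite in_itv /= => /andP[tc cr] e; rewrite -subr_ge0 e.
  apply: mulr_ge0; last by rewrite subr_ge0.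
  have c00 : 0 < c by rewrite (lt_le_trans t0).
  have pc : 0 < p * c - 1 by have : p * t <= p * c; [rewrite ler_pM2l|lra].
  have qc : 0 < 1 + q * c by rewrite addr_gt0// mulr_gt0.
  have -> : ampt p q z (1 - y) y c 0 =
     z * ((c / r - c0) ^+ 2 + (1 - c0) * (1 + c0)) / (c * (p * c - 1) * (1 + q * c)).
    rewrite /ampt /sqmod cos0 sin0 expr0n !addr0 yE zE; field: qE.
    by rewrite rN mN (gt_eqF qc) (gt_eqF pc) (gt_eqF c00) /= lt_eqF//; lra.
  apply: divr_ge0; last by rewrite !mulr_ge0// ltW.
  apply: mulr_ge0; first exact: ltW.
  by apply: addr_ge0; [exact: sqr_ge0|exact: c0_fact].
Qed.

End Saddle.

Section Concavity.
Variable R : realType.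
Implicit Types x v : R.

(** Strong concavity of the logarithm on the interval from 0 to [M]. *)
Lemma ln_quad (X X0 M : R) : 0 < X -> 0 < X0 -> X <= M -> X0 <= M ->
  ln X <= ln X0 + (X - X0) / X0 - (X - X0) ^+ 2 / (2 * M ^+ 2).
Proof.
move=> X_gt0 X0_gt0 XM X0M; have M0 : 0 < M by rewrite (lt_le_trans X_gt0).
pose f s := ln s - s / X0 + (s - X0) ^+ 2 / (2 * M ^+ 2).
pose df s := (s - X0) * ((M ^+ 2)^-1 - (s * X0)^-1).
have dfE (s : R) : 0 < s -> is_derive s 1 f (df s).
  move=> s0; refine (is_derive_congr (is_derive_add (is_derive_add
    (is_derive1_ln s0) (is_derive_opp (is_derive_mul (is_derive_var s)
      (is_derive_const X0^-1 s)))) (is_derive_mul (is_derive_mul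
      (is_derive_add (is_derive_var s) (is_derive_const (- X0) s))
      (is_derive_add (is_derive_var s) (is_derive_const (- X0) s)))
      (is_derive_const (2 * M ^+ 2)^-1 s))) _).
  by rewrite /df; field; rewrite !gt_eqF.
have neg (s : R) : 0 < s -> s <= M -> (M ^+ 2)^-1 - (s * X0)^-1 <= 0.
  move=> s0 sM; rewrite subr_le0 lef_pV2 ?posrE ?mulr_gt0 ?exprn_gt0//.
  by rewrite expr2 ler_pM// ltW.
suff : f X <= f X0 by rewrite /f subrr expr0n mul0r; lra.
have [XX0|XX0] := leP X X0.
- have wf : {within `[X, X0], continuous f}.
    apply: continuous_in_subspaceT => s /set_mem; rewrite /= in_itv /= => /andP[h _].
    by apply: (is_derive_continuous (dfE s _)); exact: lt_le_trans h.
  have d' s : s \in `]X, X0[ -> is_derive s 1 f (df s).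
    by rewrite in_itv /= => /andP[h _]; apply: dfE; exact: lt_trans h.
  have [s] := MVT_segment XX0 d' wf; rewrite in_itv /= => /andP[h1 h2] e.
  rewrite -subr_ge0 e mulr_ge0 ?subr_ge0// /df mulr_le0 ?subr_le0//.
  by rewrite -subr_le0; apply: neg; [exact: lt_le_trans h1|exact: le_trans h2 _].
- have wf : {within `[X0, X], continuous f}.
    apply: continuous_in_subspaceT => s /set_mem; rewrite /= in_itv /= => /andP[h _].
    by apply: (is_derive_continuous (dfE s _)); exact: lt_le_trans h.
  have d' s : s \in `]X0, X[ -> is_derive s 1 f (df s).
    by rewrite in_itv /= => /andP[h _]; apply: dfE; exact: lt_trans h.
  have [s] := MVT_segment (ltW XX0) d' wf; rewrite in_itv /= => /andP[h1 h2] e.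
  rewrite -subr_le0 e mulr_le0_ge0 ?subr_ge0 ?(ltW XX0)// /df mulr_ge0_le0 ?subr_ge0//.
  by apply: neg; [exact: lt_le_trans h1|exact: le_trans h2 _].
Qed.

Lemma sin_ge_half v : 0 <= v <= pi / 2 -> v / 2 <= sin v.
Proof.
move=> /andP[v0 v1]; have pi0 := pi_gt0 R.
have w0 : 0 <= v / 2 by lra.
have d s : s \in `]0, v / 2[ -> is_derive s 1 (@sin R) (cos s) by move=> _; exact: is_derive_sin.
have wf : {within `[0, v / 2], continuous (@sin R)}.
  by apply: continuous_subspaceT => s; exact: continuous_sin.
have [s] := MVT_segment w0 d wf; rewrite in_itv /= sin0 !subr0 => /andP[s0 s1] e.
have cs : cos (v / 2) <= cos s.
  by rewrite leNgt ltr_cos ?in_itv /= -?leNgt//; apply/andP; split; lra.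
have c0 : 0 <= cos (v / 2) by apply: cos_ge0_pihalf; apply/andP; split; lra.
have cv : 0 <= cos v by apply: cos_ge0_pihalf; apply/andP; split; lra.
have e2 : sin v = 2 * (cos (v / 2) * sin (v / 2)).
  transitivity (sin ((v / 2) *+ 2)); first by congr sin; rewrite [RHS]mulr2n; lra.
  by rewrite sin_mulr2n; ring.
have e3 : cos v = 2 * cos (v / 2) ^+ 2 - 1.
  transitivity (cos ((v / 2) *+ 2)); first by congr cos; rewrite [RHS]mulr2n; lra.
  by rewrite cos_mulr2n; ring.
rewrite e2 e.
have : cos (v / 2) ^+ 2 * v <= cos (v / 2) * cos s * v.
  by rewrite ler_wpM2r// expr2 ler_wpM2l.
have : v * (1 - 2 * cos (v / 2) ^+ 2) <= 0.
  by rewrite mulr_ge0_le0//; lra.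
lra.
Qed.

(** With [sin (x0 / 2 + x / 2)] expanded, use [1 <= cos + sin] on the first
    quadrant. *)
Lemma sin_mid x0 x : x0 \in `]0, pi[ -> x \in `[0, pi] ->
  sin x0 / 2 <= sin ((x + x0) / 2).
Proof.
rewrite !in_itv /= => /andP[h1 h2] /andP[h3 h4].
have -> : (x + x0) / 2 = x0 / 2 + x / 2 by lra.
have -> : sin x0 / 2 = sin (x0 / 2) * cos (x0 / 2).
  have -> : sin x0 = sin ((x0 / 2) *+ 2) by congr sin; rewrite [RHS]mulr2n; lra.
  by rewrite sin_mulr2n; field.
have s1 : 0 <= sin (x0 / 2) by apply: sin_ge0_pi; apply/andP; split; lra.
have s2 : 0 <= sin (x / 2) by apply: sin_ge0_pi; apply/andP; split; lra.
have c1 : 0 <= cos (x0 / 2) by apply: cos_ge0_pihalf; apply/andP; split; lra.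
have c2 : 0 <= cos (x / 2) by apply: cos_ge0_pihalf; apply/andP; split; lra.
have cs : 1 <= cos (x / 2) + sin (x / 2).
  rewrite -[leLHS](cos2Dsin2 (x / 2)) !expr2; apply: lerD.
    by rewrite ler_piMr// cos_le1.
  by rewrite ler_piMr// sin_le1.
have h : sin (x0 / 2) * cos (x0 / 2) * (cos (x / 2) + sin (x / 2)) <= sin (x0 / 2 + x / 2).
  rewrite sinD mulrDr; apply: lerD.
    by rewrite ler_wpM2r// ler_piMr// cos_le1.
  by rewrite mulrAC [leLHS]mulrC mulrA ler_wpM2r ?(mulrC _ (sin _))// ler_piMl// sin_le1.
by apply: le_trans h; rewrite ler_peMr// mulr_ge0.
Qed.

(** Turns a quadratic decay in [cos x] into a quadratic decay in [x]; the
    degeneracy of the cosine at 0 and [pi] costs only the factor in [sin x0]. *)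
Lemma cos_dist x0 x : x0 \in `]0, pi[ -> x \in `[0, pi] ->
  sin x0 ^+ 2 / 16 * (x - x0) ^+ 2 <= (cos x - cos x0) ^+ 2.
Proof.
move=> h1 h2; have hm := sin_mid h1 h2.
have s0 : 0 < sin x0 by apply: sin_gt0_pi; move: h1; rewrite in_itv.
move: h1 h2; rewrite !in_itv /= => /andP[h1 h2] /andP[h3 h4].
set v := (x - x0) / 2.
have -> : cos x - cos x0 = - 2 * sin ((x + x0) / 2) * sin v.
  have -> : cos x = cos ((x + x0) / 2 + v) by congr cos; rewrite /v; lra.
  have -> : cos x0 = cos ((x + x0) / 2 - v) by congr cos; rewrite /v; lra.
  by rewrite cosD cosB; ring.
have hv : v ^+ 2 / 4 <= sin v ^+ 2.
  have -> : v ^+ 2 / 4 = (`|v| / 2) ^+ 2 by rewrite [RHS]exprMn real_normK ?num_real//; field.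
  have -> : sin v ^+ 2 = sin `|v| ^+ 2.
    by have [_|_] := ger0P v; rewrite // sinN sqrrN.
  have hn : `|v| / 2 <= sin `|v|.
    apply: sin_ge_half; rewrite normr_ge0 /= ler_norml.
    by apply/andP; split; rewrite /v; lra.
  have n0 : 0 <= `|v| by [].
  by rewrite ler_sqr ?nnegrE//; lra.
have -> : sin x0 ^+ 2 / 16 * (x - x0) ^+ 2 = 4 * (sin x0 / 2) ^+ 2 * (v ^+ 2 / 4).
  by rewrite /v; field.
have -> : (- 2 * sin ((x + x0) / 2) * sin v) ^+ 2 =
   4 * sin ((x + x0) / 2) ^+ 2 * sin v ^+ 2 by ring.
apply: ler_pM => //.
- by apply: mulr_ge0 => //; exact: sqr_ge0.
- by apply: divr_ge0 => //; exact: sqr_ge0.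
by rewrite ler_pM2l// ler_sqr ?nnegrE//; lra.
Qed.

Lemma weighted_sum_ge0 (l y X X0 dX Y Y0 dY Q : R) :
  (1 - y) / 2 * X <= (1 - y) / 2 * (X0 + dX) ->
  y / 2 * Y <= y / 2 * (Y0 + dY - Q) -> (1 - y) / 2 * dX + y / 2 * dY = 0 ->
  0 <= l + (1 - y) * (X0 / 2) + y * (Y0 / 2) - y / 2 * Q
       - (l + (1 - y) * (X / 2) + y * (Y / 2)).
Proof. by move=> *; lra. Qed.

End Concavity.

Section SaddleMax.
Variable R : realType.
Variables p q z y r x0 : R.
Hypotheses (p0 : 0 < p) (q0 : 0 < q) (pq1 : p + q = 1).
Hypotheses (r0 : 0 < r) (zE : z = p * q * r ^+ 2 / (1 + p * q * r ^+ 2)).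
Hypotheses (x0pi : x0 \in `]0, pi[).
Hypothesis yE : y = p + z * (q - p + 2 * cos x0 / r).
Hypotheses (y0 : 0 < y) (y1 : y < 1).

Notation A := (amp p q z (1 - y) y).

(** The first factor comes from the second-order term of [ln_quad] for the
    branch factor with [q], the second one from [cos_dist]. *)
Definition decay : R := y * q ^+ 2 * r ^+ 2 / (1 + q * r) ^+ 4 * (sin x0 ^+ 2 / 16).

(** As a function of [cos x], [amp] is a combination of two logarithms of affine
    functions with positive coefficients, hence strongly concave, and it is
    stationary at the saddle point.  The bound holds on the whole closed
    half-circle except at a branch point. *)
Lemma amp_saddle_max x : x \in `[0, pi] ->
  0 < sqmod (- p) r x -> 0 < sqmod q r x ->
  A r x <= A r x0 - decay * (x - x0) ^+ 2.
Proof.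
move=> xpi D1 D2.
have hy1 : 0 <= (1 - y) / 2 by rewrite divr_ge0// subr_ge0 ltW.
have hy2 : 0 <= y / 2 by rewrite divr_ge0// ltW.
have s0 : 0 < sin x0 by apply: sin_gt0_pi; move: x0pi; rewrite in_itv.
have D10 := sqmod_gt0 (- p) r x0pi; have D20 := sqmod_gt0 q r x0pi.
have first_order : (1 - y) * p / sqmod (- p) r x0 = y * q / sqmod q r x0.
  have h := phst_saddle p0 q0 pq1 r0 zE yE D10 D20.
  have {}h : phst p q (1 - y) y r x0 = 0.
    move/eqP: h; rewrite subrr mul0r mulf_eq0 gt_eqF//= => /eqP; exact.
  have hh : sin x0 * ((1 - y) * p / sqmod (- p) r x0 - y * q / sqmod q r x0) = 0.
    by rewrite -[RHS]h /phst; field; rewrite !gt_eqF.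
  by move/eqP: hh; rewrite mulf_eq0 gt_eqF//= subr_eq0 => /eqP.
have qr0 : 0 < q * r by rewrite mulr_gt0.
have sqle w : sqmod q r w <= (1 + q * r) ^+ 2.
  by have := sqmod_le q r w; rewrite gtr0_norm.
have l1 : ln (sqmod (- p) r x) <=
    ln (sqmod (- p) r x0) + (sqmod (- p) r x - sqmod (- p) r x0) / sqmod (- p) r x0.
  rewrite -lerBlDl -ln_div ?posrE//.
  have -> : sqmod (- p) r x / sqmod (- p) r x0 = 1 +
    (sqmod (- p) r x - sqmod (- p) r x0) / sqmod (- p) r x0 by field; rewrite gt_eqF.
  apply: le_ln1Dx.
  have : 0 < sqmod (- p) r x / sqmod (- p) r x0 by rewrite divr_gt0.
  by rewrite mulrBl divff ?gt_eqF// ltrBrDr addNr.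
have l2 := ln_quad D2 D20 (sqle x) (sqle x0).
have d1 : sqmod (- p) r x - sqmod (- p) r x0 = - 2 * p * r * (cos x - cos x0).
  by rewrite !sqmodE; ring.
have d2 : sqmod q r x - sqmod q r x0 = 2 * q * r * (cos x - cos x0).
  by rewrite !sqmodE; ring.
have hc : decay * (x - x0) ^+ 2 <=
    y * q ^+ 2 * r ^+ 2 / (1 + q * r) ^+ 4 * (cos x - cos x0) ^+ 2.
  rewrite /decay -mulrA ler_wpM2l ?cos_dist//.
  by rewrite divr_ge0 ?exprn_ge0 ?mulr_ge0 ?sqr_ge0 ?addr_ge0 ?ltW.
apply: le_trans (_ : A r x0 - y * q ^+ 2 * r ^+ 2 / (1 + q * r) ^+ 4 *
  (cos x - cos x0) ^+ 2 <= _); last by rewrite lerD2l lerN2.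
rewrite /amp /lmod -subr_ge0.
have k1 : (1 - y) / 2 * ln (sqmod (- p) r x) <= (1 - y) / 2 *
   (ln (sqmod (- p) r x0) + (sqmod (- p) r x - sqmod (- p) r x0) / sqmod (- p) r x0).
  by rewrite ler_wpM2l.
have k2 := ler_wpM2l hy2 l2.
have e : (1 - y) / 2 * ((sqmod (- p) r x - sqmod (- p) r x0) / sqmod (- p) r x0) +
   y / 2 * ((sqmod q r x - sqmod q r x0) / sqmod q r x0) = 0.
  rewrite d1 d2.
  transitivity (- r * (cos x - cos x0) * ((1 - y) * p / sqmod (- p) r x0
     - y * q / sqmod q r x0)); first by field; rewrite !gt_eqF.
  by rewrite first_order subrr mulr0.
have e2 : y / 2 * ((sqmod q r x - sqmod q r x0) ^+ 2 / (2 * (1 + q * r) ^+ 2 ^+ 2))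
   = y * q ^+ 2 * r ^+ 2 / (1 + q * r) ^+ 4 * (cos x - cos x0) ^+ 2.
  by rewrite d2; field; rewrite gt_eqF// addr_gt0.
by rewrite -e2; exact: (weighted_sum_ge0 _ k1 k2 e).
Qed.

End SaddleMax.

(** * The method of Laplace with a complex Gaussian *)

Section Laplace.
Variable R : realType.
Notation mu := (@lebesgue_measure R).
Implicit Types (a b x t u v w : R).

Lemma cos_lip u v : `|cos u - cos v| <= `|u - v|.
Proof.
wlog uv : u v / v <= u => [H|].
  have [|h] := leP v u; first exact: H.
  by rewrite distrC [leRHS]distrC; apply: H; exact: ltW.
have := @mvt_bound R cos v u 1 uv.
rewrite mul1r (ger0_norm (_ : 0 <= u - v)) ?subr_ge0//; apply => x _.
  exact: continuous_cos.
by exists (- sin x); [exact: is_derive_cos|rewrite normrN sin_max].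
Qed.

Lemma expR_lip u v w : u <= w -> v <= w ->
  `|expR u - expR v| <= expR w * `|u - v|.
Proof.
wlog uv : u v / v <= u => [H|].
  have [|h] := leP v u; first exact: H.
  by move=> h1 h2; rewrite distrC [`|u - v|]distrC; apply: H => //; exact: ltW.
move=> uw vw; have := @mvt_bound R expR v u (expR w) uv.
rewrite (ger0_norm (_ : 0 <= u - v)) ?subr_ge0//; apply => x.
  by move=> _; exact: continuous_expR.
rewrite in_itv /= => /andP[_ xu]; exists (expR x); first exact: is_derive_expR.
by rewrite ger0_norm ?expR_ge0// ler_expR (le_trans (ltW xu)).
Qed.

Lemma expR_cos_lip a b u v w : a <= w -> b <= w ->
  `|expR a * cos u - expR b * cos v| <= expR w * (`|a - b| + `|u - v|).
Proof.
move=> aw bw.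
have -> : expR a * cos u - expR b * cos v =
  expR a * (cos u - cos v) + (expR a - expR b) * cos v by ring.
apply: le_trans (ler_normD _ _) _; rewrite [leLHS]addrC [leRHS]mulrDr; apply: lerD.
  rewrite normrM; apply: le_trans (expR_lip aw bw).
  by rewrite ler_piMr// cos_max.
rewrite normrM (ger0_norm (expR_ge0 _)); apply: ler_pM; [exact: expR_ge0|exact: normr_ge0| |exact: cos_lip].
by rewrite ler_expR.
Qed.

(** Gaussian error terms are dominated by a Lorentzian, whose integral is
    elementary. *)
Lemma mul_expRN_le k w : 0 < k -> 0 <= w ->
  w * expR (- (k * w)) <= (k^-1 + 2 * k^-1 ^+ 2) / (1 + w).
Proof.
move=> k0 w0; have kw : 0 <= k * w by rewrite mulr_ge0// ltW.
rewrite ler_pdivlMr ?ltr_pwDl// expRN mulrAC ler_pdivrMr ?expR_gt0//.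
have e1 : w <= k^-1 * expR (k * w).
  rewrite -[leLHS](mulKf (lt0r_neq0 k0)) ler_pM2l ?invr_gt0//.
  by apply: le_trans (expR_ge1Dx _); rewrite lerDr.
have e2 : w ^+ 2 <= 2 * k^-1 ^+ 2 * expR (k * w).
  have -> : w ^+ 2 = 2 * k^-1 ^+ 2 * ((k * w) ^+ 2 / 2) by field; rewrite gt_eqF.
  rewrite ler_pM2l ?mulr_gt0 ?exprn_gt0 ?invr_gt0//.
  by apply: le_trans (expR_ge1Dxn 1 kw); rewrite lerDr.
rewrite (_ : w * (1 + w) = w + w ^+ 2); last by ring.
by rewrite [leRHS]mulrDl; exact: lerD.
Qed.

Lemma Rintegral_lorentz (N x0 : R) : 0 < N ->
  mu.-integrable `]0, pi[ (EFin \o (fun x => (1 + N * (x - x0) ^+ 2)^-1)) /\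
  \int[mu]_(x in `]0, pi[) (1 + N * (x - x0) ^+ 2)^-1 <= pi / Num.sqrt N.
Proof.
move=> N0; set s := Num.sqrt N.
have s0 : 0 < s by rewrite sqrtr_gt0.
have s2 : s ^+ 2 = N by rewrite sqr_sqrtr// ltW.
pose F x := atan (s * (x - x0)) / s.
have pos x : 0 < 1 + N * (x - x0) ^+ 2 by rewrite ltr_pwDl// mulr_ge0 ?sqr_ge0// ltW.
have dF x : is_derive x 1 F (1 + N * (x - x0) ^+ 2)^-1.
  refine (is_derive_congr (is_derive_mul (is_derive_atan_comp
    (is_derive_scale s (is_derive_add (is_derive_var x) (is_derive_const (- x0) x))))
    (is_derive_const s^-1 x)) _).
  have h : 1 + (s * (x - x0)) ^+ 2 = 1 + N * (x - x0) ^+ 2 by rewrite exprMn s2.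
  by rewrite h; field; rewrite !gt_eqF.
have d2 x : is_derive x 1 (fun x => 1 + N * (x - x0) ^+ 2) (2 * N * (x - x0)).
  refine (is_derive_congr (is_derive_add (is_derive_const 1 x)
    (is_derive_scale N (is_derive_mul (is_derive_add (is_derive_var x) (is_derive_const (- x0) x))
       (is_derive_add (is_derive_var x) (is_derive_const (- x0) x))))) _).
  by ring.
have cF x : {for x, continuous (fun x => (1 + N * (x - x0) ^+ 2)^-1)}.
  apply: cvgV; first by rewrite gt_eqF.
  exact: (is_derive_continuous (d2 x)).
split.
  apply: (integrable_itvoo (M := 1)) => x _; first exact: cF.
  rewrite normfV (gtr0_norm (pos x)) invf_le1//.
  by rewrite lerDl mulr_ge0 ?sqr_ge0// ltW.
rewrite (@Rintegral_itvoo_FTC R _ F 0 pi (pi_gt0 R))//.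
rewrite /F -mulrBl ler_pM2r ?invr_gt0//.
have := atan_ltpi2 (s * (pi - x0)); have := atan_gtNpi2 (s * (0 - x0)); lra.
Qed.

(** Near [x0] the exponents differ from their quadratic parts by at most
    [eta (x - x0) ^ 2]; away from [x0] both integrands are bounded by a Gaussian,
    and there [1 <= ((x - x0) / d) ^ 2].  So in both regions the difference is at
    most a constant times [N (x - x0) ^ 2 exp (- N k (x - x0) ^ 2)], where the
    constant tends to 0 with [eta] and [1 / N]. *)
Lemma laplace_compare (E F : R -> R) (N x0 k l m d eta chi : R) :
  0 < N -> 0 < k -> 2 * k <= l -> 0 < d -> 0 <= eta ->
  (forall x, x \in `]0, pi[ ->
     {for x, continuous (fun x => expR (N * E x) * cos (chi + N * F x))}) ->
  (forall x, x \in `]0, pi[ -> E x <= - (k * (x - x0) ^+ 2)) ->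
  (forall x, x \in `]0, pi[ -> `|x - x0| <= d ->
     `|E x + l * (x - x0) ^+ 2 / 2| <= eta * (x - x0) ^+ 2 /\
     `|F x + m * (x - x0) ^+ 2 / 2| <= eta * (x - x0) ^+ 2) ->
  `|\int[mu]_(x in `]0, pi[) (expR (N * E x) * cos (chi + N * F x)) -
    \int[mu]_(x in `]0, pi[) (expR (- (N * l * (x - x0) ^+ 2 / 2)) *
       cos (chi - N * m * (x - x0) ^+ 2 / 2))|
  <= (2 * eta + 2 / (d ^+ 2 * N)) * (k^-1 + 2 * k^-1 ^+ 2) * (pi / Num.sqrt N).
Proof.
move=> N0 k0 kl d0 eta0 cEF Emax Eloc.
set D := 2 * eta + 2 / (d ^+ 2 * N).
set C := k^-1 + 2 * k^-1 ^+ 2.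
have D0 : 0 <= D.
  apply: addr_ge0; first exact: mulr_ge0.
  by apply: divr_ge0 => //; apply: mulr_ge0; [exact: sqr_ge0|exact: ltW].
have C0 : 0 <= C.
  apply: addr_ge0; first by rewrite invr_ge0 ltW.
  by apply: mulr_ge0 => //; exact: sqr_ge0.
have [il le] := Rintegral_lorentz x0 N0.
have l0 : 0 < l by lra.
have iDC : mu.-integrable `]0, pi[ (EFin \o (fun x => D * C * (1 + N * (x - x0) ^+ 2)^-1)).
  by have := @integrableZl _ _ _ mu `]0, pi[ _ (D * C) _ il; apply.
have intE : \int[mu]_(x in `]0, pi[) (D * C * (1 + N * (x - x0) ^+ 2)^-1) <=
   D * C * (pi / Num.sqrt N).
  by rewrite RintegralZl// ler_wpM2l// mulr_ge0.
apply: le_trans intE; apply: RintegralB_le => //.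
- apply: (integrable_itvoo (M := 1)) => // x xpi.
  rewrite normrM ger0_norm ?expR_ge0//; apply: mulr_ile1; [exact: expR_ge0|exact: normr_ge0| |exact: cos_max].
  rewrite -expR0 ler_expR; apply: mulr_ge0_le0; first exact: ltW.
    by apply: le_trans (Emax _ xpi) _; rewrite oppr_le0 mulr_ge0 ?sqr_ge0// ltW.
- apply: (integrable_itvoo (M := 1)) => x xpi.
    have dh (c : R) : is_derive x 1 (fun x => c * (x - x0) ^+ 2 / 2) (c * (x - x0)).
      refine (is_derive_congr (is_derive_mul (is_derive_scale c (is_derive_mul
        (is_derive_add (is_derive_var x) (is_derive_const (- x0) x))
        (is_derive_add (is_derive_var x) (is_derive_const (- x0) x))))
        (is_derive_const 2^-1 x)) _).
      by field.
    exact: (is_derive_continuous (is_derive_mul (is_derive_expR_comp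
      (is_derive_opp (dh (N * l)))) (is_derive_cos_comp (is_derive_add
      (is_derive_const chi x) (is_derive_opp (dh (N * m))))))).
  rewrite normrM ger0_norm ?expR_ge0//; apply: mulr_ile1; [exact: expR_ge0|exact: normr_ge0| |exact: cos_max].
  rewrite -expR0 ler_expR oppr_le0 divr_ge0// mulr_ge0 ?sqr_ge0//.
    by rewrite mulr_ge0// ltW.
move=> x xpi; set w := N * (x - x0) ^+ 2.
have h2 : 0 <= (x - x0) ^+ 2 by exact: sqr_ge0.
have w0 : 0 <= w by rewrite mulr_ge0// ltW.
have m1 : N * E x <= - (k * w).
  by rewrite /w mulrCA -mulrN ler_pM2l// Emax.
have m2 : - (N * l * (x - x0) ^+ 2 / 2) <= - (k * w).
  rewrite lerN2 (_ : N * l * (x - x0) ^+ 2 / 2 = l / 2 * w); last by rewrite /w; field.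
  by rewrite ler_wpM2r//; lra.
have main : D * (w * expR (- (k * w))) <= D * C * (1 + w)^-1.
  by rewrite -mulrA ler_wpM2l//; exact: mul_expRN_le.
apply: le_trans main.
have [hd|hd] := leP `|x - x0| d.
- apply: le_trans (expR_cos_lip _ _ m1 m2) _.
  rewrite mulrA mulrC ler_wpM2r ?expR_ge0//.
  have [e1 e2] := Eloc _ xpi hd.
  have -> : N * E x - - (N * l * (x - x0) ^+ 2 / 2) = N * (E x + l * (x - x0) ^+ 2 / 2).
    by field.
  have -> : chi + N * F x - (chi - N * m * (x - x0) ^+ 2 / 2) =
    N * (F x + m * (x - x0) ^+ 2 / 2) by field.
  rewrite !normrM (gtr0_norm N0) -mulrDr.
  apply: le_trans (_ : N * (2 * eta * (x - x0) ^+ 2) <= _).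
    rewrite ler_pM2l//; lra.
  have -> : N * (2 * eta * (x - x0) ^+ 2) = 2 * eta * w by rewrite /w; ring.
  by rewrite ler_wpM2r// lerDl divr_ge0 ?mulr_ge0 ?sqr_ge0// ltW.
- apply: le_trans (ler_normB _ _) _; rewrite !normrM !(ger0_norm (expR_ge0 _)).
  apply: le_trans (_ : 2 * expR (- (k * w)) <= _).
    rewrite mulr2n mulrDl mul1r; apply: lerD.
      by rewrite -[leRHS]mulr1 ler_pM ?expR_ge0 ?ler_expR ?cos_max.
    by rewrite -[leRHS]mulr1 ler_pM ?expR_ge0 ?ler_expR ?cos_max.
  rewrite mulrA ler_wpM2r ?expR_ge0//.
  apply: le_trans (_ : 2 / (d ^+ 2 * N) * w <= _); last first.
    by rewrite ler_wpM2r// lerDr mulr_ge0.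
  rewrite mulrAC ler_pdivlMr ?mulr_gt0 ?exprn_gt0// ler_pM2l// /w mulrC ler_pM2l//.
  rewrite -[leRHS]real_normK ?num_real// ler_sqr ?nnegrE ?ltW//.
  exact: lt_trans hd.
Qed.

End Laplace.

Section Gaussian.
Variable R : realType.
Notation mu := (@lebesgue_measure R).
Implicit Types (a b x t u v w : R).

(** An odd primitive of the Gaussian on the whole line, normalized by the Gauss
    integral. *)
Lemma gauss_primitive : exists Psi : R -> R,
  [/\ forall x, is_derive x 1 Psi (gauss_fun x),
      forall x, Psi (- x) = - Psi x &
      Psi x @[x --> +oo] --> Num.sqrt pi / 2].
Proof.
pose F (x : R) := \int[mu]_(t in `]-oo, x]) gauss_fun t.
have iT := @integrableT_gauss R.
have iS (A : set R) : measurable A -> mu.-integrable A (EFin \o @gauss_fun R).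
  by move=> mA; exact: integrableS iT.
have dF x : is_derive x 1 F (gauss_fun x).
  have cx : {for x, continuous (@gauss_fun R)} by exact: continuous_gauss_fun.
  have xx1 : x < x + 1 by rewrite ltrDl.
  have [d1 d2] := continuous_FTC1 xx1 (iS _ (measurable_itv `]-oo, (x + 1)])) (ltNyr x) cx.
  by split; [exact: d1|rewrite -derive1E; exact: d2].
exists (fun x => F x - F 0).
have dP x : is_derive x 1 (fun x => F x - F 0) (gauss_fun x).
  refine (is_derive_congr (is_derive_add (dF x) (is_derive_const (- F 0) x)) _).
  by rewrite addr0.
split => //.
- move=> x; suff : F x + F (- x) = F 0 + F (- 0) by rewrite oppr0; lra.
  apply: (@is_derive_0_is_cst R (fun x => F x + F (- x)) x 0) => s.
  have dN : is_derive s (1 : R) (fun s : R => - s) (-1).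
    exact: is_derive_opp (is_derive_var s).
  refine (is_derive_congr (is_derive_add (dF s) (is_derive_comp (dF (- s)) dN)) _).
  by rewrite /gauss_fun sqrrN; ring.
- have : Num.sqrt (@gauss_integral_proof.integral0_gauss R x ^+ 2) @[x --> +oo]
      --> Num.sqrt (pi / 4).
    by apply: continuous_cvg => //;
      [exact: sqrt_continuous|exact: gauss_integral_proof.cvg_integral0_gauss_sqr].
  rewrite sqrtrM ?pi_ge0// sqrtrV// (_ : 4 = 2 ^+ 2); last by rewrite expr2 -natrM.
  rewrite sqrtr_sqr ger0_norm//; apply: cvg_trans; apply: near_eq_cvg.
  near=> x; have x0 : 0 < x by near: x; exact: nbhs_pinfty_gt.
  rewrite sqrtr_sqr ger0_norm; last exact: gauss_integral_proof.integral0_gauss_ge0.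
  rewrite /F Rintegral_itvB//; first last.
  - by rewrite bnd_simp ltW.
  - exact: iS.
  by rewrite Rintegral_itv_obnd_cbnd//; exact: iS.
Unshelve. all: by end_near. Qed.

Section Rotation.
Variables (N l m x0 chi : R).
Hypotheses (N0 : 0 < N) (l0 : 0 < l) (x0pi : 0 < x0 < pi).

(* Polar coordinates of the complex number [l +i* m]. *)
Let ell := Num.sqrt (l ^+ 2 + m ^+ 2).
Let bet := atan (m / l).

Lemma ell_gt0 : 0 < ell.
Proof. by rewrite sqrtr_gt0 ltr_pwDl ?sqr_ge0// exprn_gt0. Qed.

Lemma ell_cos : ell * cos bet = l.
Proof.
rewrite /bet cos_atan.
have -> : 1 + (m / l) ^+ 2 = (ell / l) ^+ 2.
  rewrite [RHS]exprMn sqr_sqrtr ?addr_ge0 ?sqr_ge0//; field; by rewrite gt_eqF.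
rewrite sqrtr_sqr gtr0_norm ?divr_gt0 ?ell_gt0//.
by field; rewrite !gt_eqF// ell_gt0.
Qed.

Lemma ell_sin : ell * sin bet = m.
Proof.
by rewrite /bet sin_atanE -/bet mulrCA ell_cos divfK// gt_eqF//.
Qed.

(** Multiplied by the square root of the coefficient, the integral of the
    Gaussian with coefficient [ell exp (i bet t)] has a derivative in [t] that is
    a boundary term: the derivative of the integrand is that of
    [(i bet / 2) (x - x0)] times the integrand.  Integrating over [t] from 0 to 1
    leaves an error from the two end points only. *)
Lemma gauss_rotation :
  `|\int[mu]_(x in `]0, pi[) (expR (- (N * l * (x - x0) ^+ 2 / 2)) *
       cos (chi - N * m * (x - x0) ^+ 2 / 2)) -
    cos (chi - bet / 2) * \int[mu]_(x in `]0, pi[) expR (- (N * ell * (x - x0) ^+ 2 / 2))|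
  <= 2 / (N * l) * ((pi - x0)^-1 + x0^-1).
Proof.
have [x00 x0p] := andP x0pi.
pose c t x := N * ell * cos (bet * t) * (x - x0) ^+ 2 / 2.
pose s t x := N * ell * sin (bet * t) * (x - x0) ^+ 2 / 2.
pose f t x := chi - bet / 2 + bet * t / 2 - s t x.
pose G t x := expR (- c t x) * cos (f t x).
pose G1 t x := expR (- c t x) * (bet * s t x * cos (f t x)
   - (bet / 2 - bet * c t x) * sin (f t x)).
pose H t x := - (bet / 2) * ((x - x0) * (expR (- c t x) * sin (f t x))).
have dbt (t : R) : is_derive t (1 : R) (fun t => bet * t) bet.
  by refine (is_derive_congr (is_derive_scale bet (is_derive_var t)) _); rewrite mulr1.
have dc t x : is_derive t 1 (c ^~ x) (- (bet * s t x)).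
  refine (is_derive_congr (is_derive_mul (is_derive_mul (is_derive_scale (N * ell)
    (is_derive_cos_comp (dbt t))) (is_derive_const ((x - x0) ^+ 2) t)) (is_derive_const 2^-1 t)) _).
  by rewrite /s; field.
have ds t x : is_derive t 1 (s ^~ x) (bet * c t x).
  refine (is_derive_congr (is_derive_mul (is_derive_mul (is_derive_scale (N * ell)
    (is_derive_sin_comp (dbt t))) (is_derive_const ((x - x0) ^+ 2) t)) (is_derive_const 2^-1 t)) _).
  by rewrite /c; field.
have df t x : is_derive t 1 (f ^~ x) (bet / 2 - bet * c t x).
  refine (is_derive_congr (is_derive_add (is_derive_add (is_derive_const (chi - bet / 2) t)
    (is_derive_mul (dbt t) (is_derive_const 2^-1 t))) (is_derive_opp (ds t x))) _).
  by rewrite /c; field.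
have dG t x : is_derive t 1 (G ^~ x) (G1 t x).
  refine (is_derive_congr (is_derive_mul (is_derive_expR_comp (is_derive_opp (dc t x)))
    (is_derive_cos_comp (df t x))) _).
  by rewrite /G1; ring.
have dh x : is_derive x (1 : R) (fun x => x - x0) 1.
  by refine (is_derive_congr (is_derive_add (is_derive_var x) (is_derive_const (- x0) x)) _); rewrite addr0.
have dcx t x : is_derive x 1 (c t) (N * ell * cos (bet * t) * (x - x0)).
  refine (is_derive_congr (is_derive_mul (is_derive_scale (N * ell * cos (bet * t))
    (is_derive_mul (dh x) (dh x))) (is_derive_const 2^-1 x)) _).
  by field.
have dsx t x : is_derive x 1 (s t) (N * ell * sin (bet * t) * (x - x0)).
  refine (is_derive_congr (is_derive_mul (is_derive_scale (N * ell * sin (bet * t))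
    (is_derive_mul (dh x) (dh x))) (is_derive_const 2^-1 x)) _).
  by field.
have dfx t x : is_derive x 1 (f t) (- (N * ell * sin (bet * t) * (x - x0))).
  refine (is_derive_congr (is_derive_add (is_derive_const (chi - bet / 2 + bet * t / 2) x)
    (is_derive_opp (dsx t x))) _).
  by rewrite add0r.
have dH t x : is_derive x 1 (H t) (G1 t x).
  refine (is_derive_congr (is_derive_scale (- (bet / 2)) (is_derive_mul (dh x)
    (is_derive_mul (is_derive_expR_comp (is_derive_opp (dcx t x)))
    (is_derive_sin_comp (dfx t x))))) _).
  by rewrite /G1 /c /s; field.
have cGx t x : {for x, continuous (G t)}.
  exact: (is_derive_continuous (is_derive_mul (is_derive_expR_comp (is_derive_opp (dcx t x)))
    (is_derive_cos_comp (dfx t x)))).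
have cG1 t x : {for x, continuous (G1 t)}.
  exact: (is_derive_continuous (is_derive_mul (is_derive_expR_comp (is_derive_opp (dcx t x)))
    (is_derive_add (is_derive_mul (is_derive_scale bet (dsx t x)) (is_derive_cos_comp (dfx t x)))
      (is_derive_opp (is_derive_mul (is_derive_add (is_derive_const (bet / 2) x)
        (is_derive_opp (is_derive_scale bet (dcx t x)))) (is_derive_sin_comp (dfx t x))))))).
have p2 := pi_gt0 R.
have betp : `|bet| < pi / 2 by rewrite ltr_norml atan_gtNpi2 atan_ltpi2.
have bet1 : `|bet / 2| <= 1.
  rewrite normrM (ger0_norm (_ : 0 <= 2^-1)) ?invr_ge0// ler_pdivrMr// mul1r.
  by rewrite ltW// (lt_trans betp)// pihalf_lt2.
have c1 t x : 0 <= t -> t <= 1 -> N * l * (x - x0) ^+ 2 / 2 <= c t x.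
  move=> t0 t1; rewrite /c ler_wpM2r// ler_wpM2r ?sqr_ge0// -mulrA ler_wpM2l ?(ltW N0)//.
  rewrite -[leLHS]ell_cos ler_wpM2l ?(ltW ell_gt0)//.
  rewrite -(cos_norm bet) -(cos_norm (bet * t)).
  have bt : `|bet * t| <= `|bet| by rewrite normrM (ger0_norm t0) ler_piMr.
  have ? : 0 <= `|bet * t| by []. have ? : 0 <= `|bet| by [].
  by rewrite leNgt ltr_cos ?in_itv /= -?leNgt//; apply/andP; split; lra.
have bndc t x : x \in `[0, pi] -> `|c t x| <= N * ell * pi ^+ 2 /\ `|s t x| <= N * ell * pi ^+ 2.
  rewrite in_itv /= => /andP[h1 h2].
  have hh : (x - x0) ^+ 2 <= pi ^+ 2.
    rewrite -[leLHS]real_normK ?num_real// ler_sqr ?nnegrE ?(ltW p2)//.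
    by rewrite ler_norml; apply/andP; split; lra.
  have ne : 0 <= N * ell by rewrite mulr_ge0 ?ltW ?ell_gt0.
  have e (u : R) : `|u| <= 1 -> `|N * ell * u * (x - x0) ^+ 2 / 2| <= N * ell * pi ^+ 2.
    move=> u1; rewrite normrM normrM normrM (ger0_norm ne) (ger0_norm (sqr_ge0 _)).
    rewrite (ger0_norm (_ : 0 <= 2^-1)) ?invr_ge0// -!mulrA.
    rewrite ler_wpM2l ?(ltW N0)// ler_wpM2l ?(ltW ell_gt0)//.
    apply: le_trans hh; rewrite -[leRHS]mul1r.
    have sq := sqr_ge0 (x - x0).
    rewrite (_ : (x - x0) * ((x - x0) / 2) = (x - x0) ^+ 2 / 2); last by ring.
    apply: ler_pM; [exact: normr_ge0|exact: divr_ge0|exact: u1|].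
    by rewrite ler_pdivrMr// ler_peMr// ler1n.
  by split; apply: e; [exact: cos_max|exact: sin_max].
set Q := N * ell * pi ^+ 2.
have Q0 : 0 <= Q by rewrite !mulr_ge0 ?sqr_ge0 ?(ltW N0)// ltW// ell_gt0.
pose C := expR Q * (1 + `|bet| * Q + (1 + `|bet| * Q)).
have bb : 0 <= `|bet| * Q by rewrite mulr_ge0.
have GC t x : x \in `]0, pi[ -> `|G t x| <= C /\ `|G1 t x| <= C.
  move=> /subset_itv_oo_cc xpi; have [b1 b2] := bndc t x xpi.
  have eQ : expR (- c t x) <= expR Q.
    by rewrite ler_expR (le_trans _ b1)// -normrN ler_norm.
  split; rewrite normrM (ger0_norm (expR_ge0 _)); apply: ler_pM => //; rewrite ?expR_ge0//.
    by apply: le_trans (cos_max _) _; lra.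
  apply: le_trans (ler_normB _ _) _; rewrite [leRHS]addrC; apply: lerD; rewrite normrM.
    apply: le_trans (_ : `|bet| * Q <= _); last by lra.
    by rewrite -[leRHS]mulr1 ler_pM ?cos_max// normrM ler_wpM2l.
  rewrite -[leRHS]mulr1 ler_pM ?sin_max//.
  by apply: le_trans (ler_normB _ _) _; apply: lerD => //; rewrite normrM ler_wpM2l.
pose J t := \int[mu]_(x in `]0, pi[) G t x.
have dJ t : is_derive t 1 J (H t pi - H t 0).
  apply: (@is_derive_Rintegral R G G1 (H t) 0 pi t 1 C p2 ltr01) => //.
  - by move=> s' x _ xpi; case: (GC s' x xpi).
  - by move=> s' x _ xpi; case: (GC s' x xpi).
have Hb t x : 0 <= t -> t <= 1 -> x != x0 -> `|H t x| <= 2 / (N * l) / `|x - x0|.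
  move=> t0 t1 xx0.
  have hx : 0 < `|x - x0| by rewrite normr_gt0 subr_eq0.
  rewrite /H normrM normrN -[leRHS]mul1r; apply: ler_pM => //.
  rewrite normrM normrM (ger0_norm (expR_ge0 _)).
  apply: le_trans (_ : `|x - x0| * expR (- (N * l * (x - x0) ^+ 2 / 2)) <= _).
    rewrite ler_wpM2l// -[leRHS]mulr1; apply: ler_pM;
      [exact: expR_ge0|exact: normr_ge0| |exact: sin_max].
    by rewrite ler_expR lerN2; exact: c1.
  set w := N * l * (x - x0) ^+ 2 / 2.
  have w0 : 0 < w.
    have sq : 0 < (x - x0) ^+ 2.
      by rewrite lt_neqAle eq_sym sqrf_eq0 subr_eq0 xx0 sqr_ge0.
    by rewrite /w; apply: divr_gt0 => //; apply: mulr_gt0 => //; exact: mulr_gt0.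
  have ew : expR (- w) <= w^-1.
    rewrite expRN lef_pV2 ?posrE ?expR_gt0//.
    by apply: le_trans (expR_ge1Dx _); rewrite lerDr.
  apply: le_trans (_ : `|x - x0| * w^-1 <= _); first by rewrite ler_wpM2l.
  rewrite /w -real_normK ?num_real// le_eqVlt; apply/orP; left; apply/eqP.
  by field; rewrite !gt_eqF.
have key : `|J 1 - J 0| <= 2 / (N * l) * ((pi - x0)^-1 + x0^-1) * (1 - 0).
  apply: mvt_bound => // t; first by move=> _; exact: (is_derive_continuous (dJ t)).
  rewrite in_itv /= => /andP[t0 t1]; exists (H t pi - H t 0) => //.
  apply: le_trans (ler_normB _ _) _; rewrite mulrDr; apply: lerD.
    apply: le_trans (Hb _ _ (ltW t0) (ltW t1) _) _; first by rewrite gt_eqF.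
    by rewrite gtr0_norm// subr_gt0.
  apply: le_trans (Hb _ _ (ltW t0) (ltW t1) _) _; first by rewrite lt_eqF.
  by rewrite sub0r normrN gtr0_norm.
move: key; rewrite subr0 mulr1.
have -> : J 1 = \int[mu]_(x in `]0, pi[) (expR (- (N * l * (x - x0) ^+ 2 / 2)) *
       cos (chi - N * m * (x - x0) ^+ 2 / 2)).
  apply: eq_Rintegral => x _; rewrite /G /f /c /s !mulr1 -[N * ell * cos bet]mulrA.
  rewrite -[N * ell * sin bet]mulrA ell_cos ell_sin; congr (_ * cos _).
  by ring.
have -> : J 0 = cos (chi - bet / 2) *
    \int[mu]_(x in `]0, pi[) expR (- (N * ell * (x - x0) ^+ 2 / 2)).
  rewrite -RintegralZl//; last first.
    apply: (integrable_itvoo (M := 1)) => x xpi.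
      have := @cGx 0 x; rewrite /G /c /f /s; move=> _.
      have d0 : is_derive x 1 (fun x => N * ell * (x - x0) ^+ 2 / 2) (N * ell * (x - x0)).
        refine (is_derive_congr (is_derive_mul (is_derive_scale (N * ell)
          (is_derive_mul (dh x) (dh x))) (is_derive_const 2^-1 x)) _).
        by field.
      exact: (is_derive_continuous (is_derive_expR_comp (is_derive_opp d0))).
    rewrite ger0_norm ?expR_ge0// -expR0 ler_expR oppr_le0 divr_ge0// mulr_ge0 ?sqr_ge0//.
    by rewrite mulr_ge0 ?(ltW N0)// ltW// ell_gt0.
  apply: eq_Rintegral => x _; rewrite /G /f /c /s mulr0 cos0 sin0 !mulr1 mulr0 !mul0r.
  by rewrite addr0 subr0 mulrC.
exact.
Qed.

Lemma gauss_real (Psi : R -> R) (cN := Num.sqrt (N * ell / 2)) :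
  (forall x, is_derive x 1 Psi (gauss_fun x)) -> (forall x, Psi (- x) = - Psi x) ->
  \int[mu]_(x in `]0, pi[) expR (- (N * ell * (x - x0) ^+ 2 / 2)) =
  (Psi (cN * (pi - x0)) + Psi (cN * x0)) / cN.
Proof.
move=> dP oP; have c2 : cN ^+ 2 = N * ell / 2.
  by rewrite sqr_sqrtr// divr_ge0// mulr_ge0 ?(ltW N0)// ltW// ell_gt0.
have cN0 : 0 < cN by rewrite sqrtr_gt0 divr_gt0// mulr_gt0// ell_gt0.
have dh x : is_derive x (1 : R) (fun x => cN * (x - x0)) cN.
  refine (is_derive_congr (is_derive_scale cN (is_derive_add (is_derive_var x)
    (is_derive_const (- x0) x))) _).
  by rewrite addr0 mulr1.
have e x : expR (- (N * ell * (x - x0) ^+ 2 / 2)) = gauss_fun (cN * (x - x0)).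
  by rewrite /gauss_fun exprMn c2; congr expR; field.
apply: etrans (@Rintegral_itvoo_FTC R _ (fun x => Psi (cN * (x - x0)) / cN) 0 pi
  (pi_gt0 R) _ _) _.
- move=> x _; rewrite e.
  refine (is_derive_congr (is_derive_mul (is_derive_comp (dP _) (dh x))
    (is_derive_const cN^-1 x)) _).
  by field; rewrite gt_eqF.
- move=> x _; have -> : (fun x => expR (- (N * ell * (x - x0) ^+ 2 / 2))) =
    (fun x => gauss_fun (cN * (x - x0))) by apply/funext => u; exact: e.
  apply: (continuous_comp (f := fun x => cN * (x - x0)) (g := @gauss_fun R)).
    exact: (is_derive_continuous (dh x)).
  exact: continuous_gauss_fun.
- by rewrite sub0r mulrN oP -mulrBl opprK.
Qed.

End Rotation.

End Gaussian.

(** * The saddle point in terms of U, psi, L and K *)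

Section ComplexLink.
Variable R : realType.
Implicit Types (a b c d x : R).

Lemma mulcE a b c d :
  (a +i* b) * (c +i* d) = (a * c - b * d) +i* (a * d + b * c) :> R[i].
Proof. by []. Qed.

Lemma addcE a b c d : (a +i* b) + (c +i* d) = (a + c) +i* (b + d) :> R[i].
Proof. by []. Qed.

Lemma oppcE a b : - (a +i* b) = (- a) +i* (- b) :> R[i].
Proof. by []. Qed.

Lemma realcE x : x%:C = x +i* 0 :> R[i].
Proof. by []. Qed.

Definition cE := (realcE, oppcE, addcE, mulcE).

Lemma cabsE a b : cabs (a +i* b) = Num.sqrt (a ^+ 2 + b ^+ 2).
Proof. by rewrite /cabs normc_def. Qed.

Lemma cabs_real x : cabs x%:C = `|x|.
Proof. by rewrite realcE cabsE expr0n addr0 sqrtr_sqr. Qed.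

Lemma clog_upper a b : 0 < b -> clog (a +i* b) = (ln (a ^+ 2 + b ^+ 2) / 2) +i* uarg a b.
Proof.
move=> b0; have ab0 : 0 < a ^+ 2 + b ^+ 2 by rewrite ltr_wpDl ?sqr_ge0// exprn_gt0.
rewrite /clog /carg /= (ltW b0) cabsE uargE ?(ltW b0)//; congr (_ +i* _).
rewrite -[in RHS](sqr_sqrtr (ltW ab0)) lnXn ?sqrtr_gt0//.
by rewrite mulr2n; field.
Qed.

Lemma clog_lower a b : 0 < b ->
  clog (a +i* (- b)) = (ln (a ^+ 2 + b ^+ 2) / 2) +i* (- uarg a b).
Proof.
move=> b0; have := clog_upper a b0; rewrite /clog /carg /= (ltW b0).
by rewrite oppr_ge0 leNgt b0 /= !cabsE sqrrN => -[-> ->].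
Qed.

Lemma sqrtc_neg x : 0 <= x -> sqrtc (- x)%:C = 0 +i* Num.sqrt x :> R[i].
Proof.
move=> x0; rewrite realcE /sqrtc eqxx mul1r expr0n addr0 sqrtr_sqr normrN ger0_norm//.
rewrite subrr mul0r sqrtr0 opprK; congr (_ +i* Num.sqrt _).
by field.
Qed.

(** The principal square root is characterized by a positive real part. *)
Lemma sqrtc_uniq (w v : R[i]) : 0 < complex.Re w -> w ^+ 2 = v -> sqrtc v = w.
Proof.
move=> w0 wv; have := sqr_sqrtc v; rewrite -[in RHS]wv => /eqP.
rewrite eqf_sqr => /orP[/eqP//|/eqP e].
have : 0 <= complex.Re (sqrtc v) by case: (v) => a b; exact: sqrtr_ge0.
by rewrite e; case: (w) w0 => a b /= a0; rewrite oppr_ge0 leNgt a0.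
Qed.

Lemma cexpD x a b : cexp (x%:C * (a +i* b)) =
  (expR (x * a))%:C * (cos (x * b) +i* sin (x * b) : R[i]).
Proof.
rewrite !cE /cexp /= !mul0r !subr0 !addr0.
by congr (_ +i* _); ring.
Qed.

Lemma polar_mul a b : (cos a +i* sin a : R[i]) * (cos b +i* sin b : R[i]) =
  cos (a + b) +i* sin (a + b) :> R[i].
Proof. by rewrite mulcE cosD sinD; congr (_ +i* _); ring. Qed.

(** As [0 < l], the argument is in the open interval from [- pi / 2] to
    [pi / 2], so halving it gives a number with positive real part. *)
Lemma sqrtc_polar_inv l m : 0 < l ->
  sqrtc ((l +i* m)^-1) =
  ((Num.sqrt (Num.sqrt (l ^+ 2 + m ^+ 2)))^-1)%:C *
    (cos (- (atan (m / l) / 2)) +i* sin (- (atan (m / l) / 2)) : R[i]).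
Proof.
move=> l0; set ell := Num.sqrt (l ^+ 2 + m ^+ 2); set bet := atan (m / l).
have ell0 : 0 < ell := ell_gt0 m l0.
have ec := ell_cos m l0; have es := ell_sin m l0.
rewrite -/ell -/bet in ec es.
have se0 : 0 < Num.sqrt ell by rewrite sqrtr_gt0.
apply: sqrtc_uniq.
  rewrite !cE /= mul0r subr0 mulr_gt0 ?invr_gt0// cos_gt0_pihalf//.
  have := atan_gtNpi2 (m / l); have := atan_ltpi2 (m / l); rewrite -/bet => h1 h2.
  by have := pi_gt0 R; move=> h3; apply/andP; split; lra.
rewrite exprMn [X in _ * X]expr2 polar_mul//.
have -> : - (bet / 2) + - (bet / 2) = - bet by field.
have lm0 : (l +i* m : R[i]) != 0.
  by rewrite eq_complex /= negb_and gt_eqF.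
apply: (mulIf lm0); rewrite mulVf//.
rewrite -ec -es expr2 !cE cosN sinN !mul0r !mulr0 !subr0 !addr0.
have s2 : (Num.sqrt ell)^-1 * (Num.sqrt ell)^-1 * ell = 1.
  by rewrite -invfM -expr2 sqr_sqrtr ?(ltW ell0)// mulVf// gt_eqF.
have cs := cos2Dsin2 bet.
rewrite -[RHS]/((1 : R) +i* 0); congr (_ +i* _).
  transitivity ((Num.sqrt ell)^-1 * (Num.sqrt ell)^-1 * ell * (cos bet ^+ 2 + sin bet ^+ 2)).
    by ring.
  by rewrite s2 cs mulr1.
by ring.
Qed.

End ComplexLink.

Section SaddleData.
Variable R : realType.
Variables p q z y : R.
Hypotheses (p0 : 0 < p) (q0 : 0 < q) (pq1 : p + q = 1).
Hypotheses (z0 : 0 < z) (z1 : z < 1).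
Hypotheses (yl : Yminus p q z < y) (yu : y < Yplus p q z).

(** [U^+] is [U0 exp (i saddle_x)], and [hess_re +i* hess_im] is minus the second
    derivative of psi with respect to the angle, at the saddle point and along
    the saddle circle; [hess_norm] and [hess_arg] are its polar coordinates. *)
Definition saddle_r : R := (U0 p q z)^-1.
Definition saddle_c : R := - ((p - y) / z + q - p) / (2 * U0 p q z).
Definition saddle_x : R := acos saddle_c.
Definition hess_re : R := sin saddle_x * curv_re p q saddle_r saddle_x.
Definition hess_im : R := sin saddle_x * curv_im p q z saddle_r saddle_x.
Definition hess_norm : R := Num.sqrt (hess_re ^+ 2 + hess_im ^+ 2).
Definition hess_arg : R := atan (hess_im / hess_re).

Local Notation r := saddle_r.
Local Notation x0 := saddle_x.
Local Notation u0 := (U0 p q z).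

Let zN : z != 0. Proof. by rewrite gt_eqF. Qed.
Let z1p : 0 < 1 - z. Proof. by rewrite subr_gt0. Qed.
Let z1N : 1 - z != 0. Proof. by rewrite gt_eqF. Qed.
Let pN : p != 0. Proof. by rewrite gt_eqF. Qed.
Let qN : q != 0. Proof. by rewrite gt_eqF. Qed.

Lemma U0_sqr : u0 ^+ 2 = p * q * (1 - z) / z.
Proof. by rewrite sqr_sqrtr// divr_ge0// ?ltW// !mulr_gt0. Qed.

Lemma U0_gt0 : 0 < u0.
Proof. by rewrite sqrtr_gt0 divr_gt0// !mulr_gt0. Qed.

Lemma saddle_r_gt0 : 0 < r.
Proof. by rewrite invr_gt0 U0_gt0. Qed.

Let u0N : u0 != 0. Proof. by rewrite gt_eqF// U0_gt0. Qed.

Lemma saddle_r_sqr : p * q * r ^+ 2 = z / (1 - z).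
Proof. by rewrite /r exprVn U0_sqr; field; rewrite zN z1N pN qN. Qed.

Lemma saddle_zE : z = p * q * r ^+ 2 / (1 + p * q * r ^+ 2).
Proof.
rewrite saddle_r_sqr (_ : 1 + z / (1 - z) = (1 - z)^-1); last by field; rewrite z1N.
by field; rewrite z1N.
Qed.

Lemma saddle_c_bound : -1 < saddle_c < 1.
Proof.
have h : saddle_c = (y - (p + (q - p) * z)) / (2 * z * u0).
  by rewrite /saddle_c; field; rewrite u0N zN.
have d0 : 0 < 2 * z * u0 by rewrite !mulr_gt0// U0_gt0.
rewrite h ltr_pdivlMr// ltr_pdivrMr// mulN1r mul1r.
by move: yl yu; rewrite /Yminus /Yplus; set w := 2 * z * u0 => ? ?; apply/andP; split; lra.
Qed.

Lemma saddle_x_itv : x0 \in `]0, pi[.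
Proof.
have /andP[c1 c2] := saddle_c_bound.
by rewrite in_itv /= acos_gt0 ?acos_ltpi// ?c1 ?c2 ?ltW.
Qed.

Lemma cos_saddle_x : cos x0 = saddle_c.
Proof.
have /andP[c1 c2] := saddle_c_bound.
by rewrite acosK// in_itv /= !ltW.
Qed.

Lemma sin_saddle_gt0 : 0 < sin x0.
Proof. by apply: sin_gt0_pi; have := saddle_x_itv; rewrite in_itv. Qed.

Lemma saddle_yE : y = p + z * (q - p + 2 * cos x0 / r).
Proof. by rewrite cos_saddle_x /saddle_c /r; field; rewrite u0N zN. Qed.

(** [Yminus] and [1 - Yplus] are squares:
    they are [(sqrt (p (1 - z)) - sqrt (q z)) ^ 2] and
    [(sqrt (p z) - sqrt (q (1 - z))) ^ 2]. *)
Lemma saddle_y01 : 0 < y < 1.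
Proof.
set w := 2 * z * u0.
have w0 : 0 <= w by rewrite !mulr_ge0 ?(ltW z0)// ltW// U0_gt0.
have w2 : w ^+ 2 = 4 * p * q * z * (1 - z).
  by rewrite /w exprMn U0_sqr; field; rewrite zN.
have s1 : w <= p * (1 - z) + q * z.
  have h0 : 0 <= p * (1 - z) + q * z by rewrite addr_ge0 ?mulr_ge0 ?ltW.
  rewrite -ler_sqr ?nnegrE// w2 -subr_ge0.
  have -> : (p * (1 - z) + q * z) ^+ 2 - 4 * p * q * z * (1 - z) =
    (p * (1 - z) - q * z) ^+ 2 by ring.
  exact: sqr_ge0.
have s2 : w <= p * z + q * (1 - z).
  have h0 : 0 <= p * z + q * (1 - z) by rewrite addr_ge0 ?mulr_ge0 ?ltW.
  rewrite -ler_sqr ?nnegrE// w2 -subr_ge0.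
  have -> : (p * z + q * (1 - z)) ^+ 2 - 4 * p * q * z * (1 - z) =
    (p * z - q * (1 - z)) ^+ 2 by ring.
  exact: sqr_ge0.
move: yl yu; rewrite /Yminus /Yplus -/w => h1 h2.
have qE : q = 1 - p by rewrite -pq1; ring.
have e : p * (1 - z) + q * z = p + (q - p) * z by ring.
have e2 : p * z + q * (1 - z) = 1 - (p + (q - p) * z) by ring: qE.
rewrite e in s1; rewrite e2 in s2.
by apply/andP; split; [apply: le_lt_trans h1; rewrite subr_ge0
  |apply: lt_le_trans h2 _; rewrite -lerBrDl].
Qed.

Let D1 := sqmod_gt0 (- p) r saddle_x_itv.
Let D2 := sqmod_gt0 q r saddle_x_itv.

Lemma hess_re_gt0 : 0 < hess_re.
Proof.
rewrite mulr_gt0 ?sin_saddle_gt0// divr_gt0//; last by rewrite mulr_gt0.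
by rewrite mulr_gt0 ?sin_saddle_gt0// !mulr_gt0// saddle_r_gt0.
Qed.

Lemma U_saddle (s : R) : U s p q y z = (u0 * cos x0) +i* (s * (u0 * sin x0)).
Proof.
rewrite /U; set b := (p - y) / z + q - p.
have bE : b = - 2 * (u0 * cos x0).
  by rewrite cos_saddle_x /saddle_c -/b; field; rewrite u0N.
have -> : b ^+ 2 - 4 * u0 ^+ 2 = - (2 * (u0 * sin x0)) ^+ 2.
  by rewrite bE; have h := sin2cos2 x0; ring: h.
rewrite sqrtc_neg ?sqr_ge0// sqrtr_sqr ger0_norm; last first.
  by rewrite !mulr_ge0// ltW ?U0_gt0 ?sin_saddle_gt0.
by rewrite bE !cE; congr (_ +i* _); field.
Qed.

(** The principal logarithm of the definitions is the continuous one used in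
    the integral, as U^+ is in the open upper half-plane and U^- is its
    conjugate. *)
Lemma clog_saddle (kap s : R) : s = 1 \/ s = -1 -> 0 < sqmod kap r x0 ->
  clog ((u0 * cos x0 + kap) +i* (s * (u0 * sin x0))) =
  (ln u0 + lmod kap r x0) +i* (s * (x0 + larg kap r x0)).
Proof.
move=> hs D; have us0 : 0 < u0 * sin x0 by rewrite mulr_gt0 ?U0_gt0 ?sin_saddle_gt0.
have e1 : (u0 * cos x0 + kap) ^+ 2 + (u0 * sin x0) ^+ 2 = u0 ^+ 2 * sqmod kap r x0.
  by rewrite /sqmod /saddle_r; field.
have e2 : ln ((u0 * cos x0 + kap) ^+ 2 + (u0 * sin x0) ^+ 2) / 2 = ln u0 + lmod kap r x0.
  rewrite e1 lnM ?posrE ?exprn_gt0 ?U0_gt0// lnXn ?U0_gt0// /lmod mulr2n.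
  by field.
have e3 : uarg (u0 * cos x0 + kap) (u0 * sin x0) = x0 + larg kap r x0.
  rewrite (_ : u0 * cos x0 + kap = u0 * (cos x0 + kap * r)); last first.
    by rewrite /saddle_r; field.
  by rewrite uarg_scale ?U0_gt0// /larg [RHS]addrC subrK.
case: hs => ->; first by rewrite !mul1r clog_upper// e2 e3.
by rewrite !mulN1r clog_lower// e2 e3.
Qed.

Lemma psi_saddle (s : R) : s = 1 \/ s = -1 ->
  psi s p q y z = (amp p q z (1 - y) y r x0) +i* (s * phs p q z (1 - y) y r x0).
Proof.
move=> hs; rewrite /psi U_saddle.
have lr : ln r = - ln u0 by rewrite lnV// posrE U0_gt0.
have c0 : clog ((u0 * cos x0) +i* (s * (u0 * sin x0))) = ln u0 +i* (s * x0).
  have s0 : sqmod 0 r x0 = 1 by rewrite /sqmod mul0r addr0 cos2Dsin2.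
  have := @clog_saddle 0 s hs; rewrite s0 addr0 => -> //.
  rewrite /lmod s0 ln1 mul0r addr0 /larg mul0r addr0 uarg_polar ?subrr ?addr0//.
  exact: subset_itv_oo_cc saddle_x_itv.
have c1 := clog_saddle hs D1; have c2 := clog_saddle hs D2.
rewrite c0 (_ : (_ +i* _) - p%:C = (u0 * cos x0 - p) +i* (s * (u0 * sin x0))); last first.
  by rewrite !cE oppr0 addr0.
rewrite c1 (_ : (_ +i* _) + q%:C = (u0 * cos x0 + q) +i* (s * (u0 * sin x0))); last first.
  by rewrite !cE addr0.
by rewrite c2 !cE /amp /phs lr; congr (_ +i* _); ring.
Qed.

(** The key identity is [(U - p) (U + q) hess = z (U ^ 2 - U0 ^ 2)], where [hess]
    is [hess_re +i* s hess_im]. *)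
Lemma L_saddle (s : R) : s = 1 \/ s = -1 ->
  L s p q y z = ((Num.sqrt hess_norm)^-1)%:C *
     (cos (hess_arg / 2) +i* (s * - sin (hess_arg / 2)) : R[i]).
Proof.
move=> hs; have hr := hess_re_gt0.
have ss : s ^+ 2 = 1 by case: hs => ->; rewrite ?sqrrN expr1n.
have st : sin x0 ^+ 2 = 1 - cos x0 ^+ 2 by exact: sin2cos2.
have lN : (hess_re +i* (s * hess_im) : R[i]) != 0.
  by rewrite eq_complex /= negb_and gt_eqF.
have sN : s != 0 by case: hs => ->; rewrite ?oppr_eq0 oner_neq0.
have key : (U s p q y z - p%:C) * (U s p q y z + q%:C) * (hess_re +i* (s * hess_im)) =
    z%:C * (U s p q y z ^+ 2 - (u0 ^+ 2)%:C).
  have rE : u0 = r^-1 by rewrite invrK.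
  have rN : r != 0 by rewrite gt_eqF// saddle_r_gt0.
  have mN : 1 + p * q * r ^+ 2 != 0.
    by rewrite gt_eqF// addr_gt0// !mulr_gt0// saddle_r_gt0.
  have D1N : 1 + 2 * - p * r * cos x0 + (- p * r) ^+ 2 != 0.
    by rewrite exprMn -sqmodE gt_eqF.
  have D2N : 1 + 2 * q * r * cos x0 + (q * r) ^+ 2 != 0.
    by rewrite exprMn -sqmodE gt_eqF.
  have qE : q = 1 - p by rewrite -pq1; ring.
  have zE := saddle_zE.
  rewrite U_saddle expr2 !cE !mul0r !oppr0 !addr0.
  rewrite /hess_re /hess_im /curv_re /curv_im !sqmodE rE.
  move: (cos x0) (sin x0) D1N D2N st => c t D1N D2N st.
  rewrite zE; congr (_ +i* _).
    field: st ss; by rewrite mN rN D1N D2N.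
  field: st ss; by rewrite mN rN D1N D2N.
have dN : z%:C * (U s p q y z ^+ 2 - (u0 ^+ 2)%:C) != 0 :> R[i].
  apply: mulf_neq0; first by rewrite eq_complex /= negb_and zN.
  rewrite U_saddle expr2 !cE.
  rewrite eq_complex /= negb_and; apply/orP; left.
  rewrite (_ : _ + _ = - 2 * (u0 * sin x0) ^+ 2); last by ring: ss st.
  rewrite mulf_neq0 ?oppr_eq0 ?pnatr_eq0// sqrf_eq0 mulf_neq0//.
  by rewrite gt_eqF// sin_saddle_gt0.
rewrite /L (_ : _ / _ = (hess_re +i* (s * hess_im))^-1); last first.
  apply: (mulIf lN); rewrite mulVf// mulrAC key divff//.
rewrite sqrtc_polar_inv//.
have -> : hess_re ^+ 2 + (s * hess_im) ^+ 2 = hess_re ^+ 2 + hess_im ^+ 2.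
  by rewrite [(s * _) ^+ 2]exprMn ss mul1r.
rewrite -/hess_norm.
have -> : s * hess_im / hess_re = s * (hess_im / hess_re) by rewrite mulrA.
case: hs => ->; rewrite ?mulN1r ?atanN ?mul1r -/hess_arg ?mulNr ?opprK ?cosN ?sinN//.
Qed.

End SaddleData.

Lemma scaled_triangle (R : realDomainType) (X W I J u v a b c d : R) : 0 <= X ->
  `|X * I - W| <= X * a -> `|I - J| <= b -> `|J - u| <= c -> `|u - v| <= d ->
  `|W - X * v| <= X * (a + b + c + d).
Proof.
move=> X0 h1 h2 h3 h4.
have -> : W - X * v = - (X * I - W) + X * ((I - J) + (J - u) + (u - v)) by ring.
apply: le_trans (ler_normD _ _) _; rewrite normrN normrM (ger0_norm X0).
have -> : X * (a + b + c + d) = X * a + X * (b + c + d) by ring.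
apply: lerD => //; rewrite ler_wpM2l//.
apply: le_trans (ler_normD _ _) _; apply: lerD => //.
by apply: le_trans (ler_normD _ _) _; exact: lerD.
Qed.

Section Estimate.
Variable R : realType.
Notation mu := (@lebesgue_measure R).
Variables p q z y : R.
Hypotheses (p0 : 0 < p) (q0 : 0 < q) (pq1 : p + q = 1).
Hypotheses (z0 : 0 < z) (z1 : z < 1).
Hypotheses (yl : Yminus p q z < y) (yu : y < Yplus p q z).

Local Notation r := (saddle_r p q z).
Local Notation x0 := (saddle_x p q z y).
Local Notation l := (hess_re p q z y).
Local Notation m := (hess_im p q z y).
Local Notation ell := (hess_norm p q z y).
Local Notation bet := (hess_arg p q z y).
Local Notation A := (amp p q z (1 - y) y r).
Local Notation B := (phs p q z (1 - y) y r).

Lemma K_saddle (s eps : R) : s = 1 \/ s = -1 ->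
  K s p q eps y z =
  (Num.sqrt eps / Num.sqrt (2 * pi) * expR (eps^-1 * A x0) / Num.sqrt ell)%:C *
  (cos (eps^-1 * B x0 - bet / 2) +i* (s * sin (eps^-1 * B x0 - bet / 2)) : R[i]).
Proof.
move=> hs; rewrite /K psi_saddle// L_saddle// cexpD.
set E := expR _; set t := eps^-1 * B x0.
have -> : cos (eps^-1 * (s * B x0)) = cos t.
  by rewrite mulrCA -/t; case: hs => ->; rewrite ?mul1r ?mulN1r ?cosN.
have -> : sin (eps^-1 * (s * B x0)) = s * sin t.
  by rewrite mulrCA -/t; case: hs => ->; rewrite ?mul1r ?mulN1r ?sinN.
have ss : s ^+ 2 = 1 by case: hs => ->; rewrite ?sqrrN expr1n.
rewrite cosB sinB !cE !mul0r !subr0 !addr0.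
by congr (_ +i* _); ring: ss.
Qed.

Let y0 : 0 < y. Proof. by have /andP[] := saddle_y01 p0 q0 pq1 z0 z1 yl yu. Qed.
Let y1 : y < 1. Proof. by have /andP[] := saddle_y01 p0 q0 pq1 z0 z1 yl yu. Qed.
Let r0 : 0 < r. Proof. exact: saddle_r_gt0. Qed.
Let p1 : p < 1. Proof. by rewrite -pq1 ltrDl. Qed.
Let q1 : q < 1. Proof. by rewrite -pq1 ltrDr. Qed.
Let xpi : x0 \in `]0, pi[. Proof. exact: saddle_x_itv. Qed.
Let zE := saddle_zE p0 q0 z0 z1.
Let yE : y = p + z * (q - p + 2 * cos x0 / r). Proof. exact: saddle_yE. Qed.

(** The distance from the saddle point to the real axis, as an angle. *)
Definition saddle_gap : R := Num.min x0 (pi - x0).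

Lemma saddle_gap_gt0 : 0 < saddle_gap.
Proof. by move: xpi; rewrite in_itv /= lt_min subr_gt0. Qed.

Lemma amp_scale (N t x : R) :
  amp p q (z * N) ((1 - y) * N) (y * N) t x = N * amp p q z (1 - y) y t x.
Proof. by rewrite /amp; ring. Qed.

Lemma phs_scale (N t x : R) :
  phs p q (z * N) ((1 - y) * N) (y * N) t x = N * phs p q z (1 - y) y t x.
Proof. by rewrite /phs; ring. Qed.

Variables (N k : R) (n : nat).
Hypotheses (N0 : 0 < N) (k0 : 0 < k) (nE : n%:R = z * N).
Hypothesis k_decay : k <= decay q y r x0.

Lemma decay_bound x : x \in `[0, pi] ->
  0 < sqmod (- p) r x -> 0 < sqmod q r x -> A x - A x0 <= - (k * (x - x0) ^+ 2).
Proof.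
move=> xx D1 D2.
have := amp_saddle_max p0 q0 pq1 r0 zE xpi yE y0 y1 xx D1 D2.
have : k * (x - x0) ^+ 2 <= decay q y r x0 * (x - x0) ^+ 2 by rewrite ler_wpM2r ?sqr_ge0.
move: (amp _ _ _ _ _ _ _) (amp _ _ _ _ _ _ _) => u v h1 h2.
by rewrite lerBlDr addrC (le_trans h2)// lerD2l lerN2.
Qed.

(** The contribution of the two cuts is exponentially small compared with the
    modulus at the saddle point. *)
Lemma saddle_cut : `|wint p q n%:R ((1 - y) * N) (y * N) r
    - pi * krawc p q ((1 - y) * N) (y * N) n| <=
  4 * (1 + r) * (expR (N * A x0) * expR (- (N * k * saddle_gap ^+ 2))).
Proof.
have [c1 c2] := andP (saddle_c_bound p0 q0 z0 z1 yl yu).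
have xx : 0 < x0 < pi by move: xpi; rewrite in_itv.
have [xx0 xx1] := andP xx.
have g1 : saddle_gap <= x0 by rewrite ge_min lexx.
have g2 : saddle_gap <= pi - x0 by rewrite ge_min lexx orbT.
have g0 := saddle_gap_gt0.
have cx1 : -1 < cos x0 by rewrite cos_saddle_x.
have cx2 : cos x0 < 1 by rewrite cos_saddle_x.
have p2 := pi_gt0 R.
have sq x : saddle_gap <= `|x - x0| -> saddle_gap ^+ 2 <= (x - x0) ^+ 2.
  by move=> h; rewrite -[leRHS]real_normK ?num_real// ler_sqr ?nnegrE// ltW.
have fin x t : A x - A x0 <= - (k * (x - x0) ^+ 2) -> saddle_gap <= `|x - x0| ->
    amp p q z (1 - y) y t x <= A x ->
    `|wim p q n%:R ((1 - y) * N) (y * N) t x| <=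
     expR (N * A x0) * expR (- (N * k * saddle_gap ^+ 2)).
  move=> h1 h2 h3; rewrite nE; apply: le_trans (wim_le _ _ _ _ _ _ _) _.
  rewrite amp_scale -expRD ler_expR -mulrA -mulrN -mulrDr ler_pM2l//.
  apply: le_trans h3 _; rewrite -lerBlDl; apply: le_trans h1 _.
  by rewrite lerN2 ler_pM2l// sq.
apply: wint_deform.
- by rewrite p0.
- by rewrite q0.
- exact: r0.
- by rewrite mulr_ge0 ?(ltW N0)// subr_ge0 ltW.
- by apply: mulr_ge0; exact: ltW.
- move=> t t0 tr pt.
  apply: fin.
  + apply: decay_bound; first by rewrite in_itv /= lexx ltW.
      rewrite /sqmod cos0 sin0 expr0n addr0 mulNr.
      rewrite (_ : (1 - p * r) ^+ 2 = (p * r - 1) ^+ 2); last by ring.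
      by rewrite exprn_gt0// subr_gt0 (lt_trans pt)// ltr_pM2l.
    by rewrite /sqmod cos0 sin0 expr0n addr0 exprn_gt0// addr_gt0// mulr_gt0.
  + by rewrite sub0r normrN gtr0_norm.
  + exact: (amp_cut_0 p0 q0 pq1 r0 zE cx1 cx2 yE pt (ltW tr)).
- move=> t t0 tr qt.
  apply: fin.
  + apply: decay_bound; first by rewrite in_itv /= lexx ltW.
      rewrite /sqmod cospi sinpi expr0n addr0 mulNr.
      rewrite (_ : (-1 - p * r) ^+ 2 = (1 + p * r) ^+ 2); last by ring.
      by rewrite exprn_gt0// addr_gt0// mulr_gt0.
    rewrite /sqmod cospi sinpi expr0n addr0 exprn_gt0// addrC subr_gt0.
    by rewrite (lt_trans qt)// ltr_pM2l.
  + by rewrite gtr0_norm// subr_gt0.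
  + exact: (amp_cut_pi p0 q0 pq1 r0 zE cx1 cx2 yE qt (ltW tr)).
- by rewrite mulr_ge0// expR_ge0.
Qed.

Variables (d eta : R) (Psi : R -> R).
Hypotheses (d0 : 0 < d) (eta0 : 0 <= eta) (kl : 2 * k <= l).
Hypothesis loc : forall x, x \in `]0, pi[ -> `|x - x0| <= d ->
  `|A x - A x0 + l * (x - x0) ^+ 2 / 2| <= eta * (x - x0) ^+ 2 /\
  `|B x - B x0 + m * (x - x0) ^+ 2 / 2| <= eta * (x - x0) ^+ 2.
Hypothesis dPsi : forall x, is_derive x (1 : R) Psi (gauss_fun x).
Hypothesis oPsi : forall x, Psi (- x) = - Psi x.

Let cN := Num.sqrt (N * ell / 2).

(** The four error terms come, in this order, from the cuts, from the comparison
    with the Gaussian, from its rotation, and from the tails of the real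
    Gaussian. *)
Lemma saddle_estimate :
  `|pi * krawc p q ((1 - y) * N) (y * N) n
    - expR (N * A x0) * (Num.sqrt pi / cN) * cos (N * B x0 - bet / 2)| <=
  expR (N * A x0) * (4 * (1 + r) * expR (- (N * k * saddle_gap ^+ 2)) +
   (2 * eta + 2 / (d ^+ 2 * N)) * (k^-1 + 2 * k^-1 ^+ 2) * (pi / Num.sqrt N) +
   2 / (N * l) * ((pi - x0)^-1 + x0^-1) +
   `|Psi (cN * (pi - x0)) + Psi (cN * x0) - Num.sqrt pi| / cN).
Proof.
have l0 : 0 < l := hess_re_gt0 p0 q0 z0 z1 yl yu.
have ell0 : 0 < ell by exact: ell_gt0.
have cN0 : 0 < cN by rewrite sqrtr_gt0 divr_gt0// mulr_gt0.
have xx : 0 < x0 < pi by move: xpi; rewrite in_itv.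
have spos (x : R) : x \in `]0, pi[ -> 0 <= sin x.
  by rewrite in_itv /= => /andP[h1 h2]; apply: sin_ge0_pi; rewrite !ltW.
have D1 (x : R) : x \in `]0, pi[ -> 0 < sqmod (- p) r x by exact: sqmod_gt0.
have D2 (x : R) : x \in `]0, pi[ -> 0 < sqmod q r x by exact: sqmod_gt0.
set I0 := \int[mu]_(x in `]0, pi[)
  (expR (N * (A x - A x0)) * cos (N * B x0 + N * (B x - B x0))).
have cI (x : R) : x \in `]0, pi[ -> {for x, continuous
    (fun x => expR (N * (A x - A x0)) * cos (N * B x0 + N * (B x - B x0)))}.
  move=> xi.
  have dA := is_derive_scale N (is_derive_add (is_derive_ampx z (1 - y) y (D1 _ xi) (D2 _ xi))
    (is_derive_const (- A x0) x)).
  have dB := is_derive_add (is_derive_const (N * B x0) x) (is_derive_scale N (is_derive_add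
    (is_derive_phsx z (1 - y) y (D1 _ xi) (D2 _ xi) (spos _ xi) r0)
    (is_derive_const (- B x0) x))).
  exact: (is_derive_continuous (is_derive_mul (is_derive_expR_comp dA)
    (is_derive_cos_comp dB))).
have Emax (x : R) : x \in `]0, pi[ -> A x - A x0 <= - (k * (x - x0) ^+ 2).
  by move=> xi; apply: decay_bound; [exact: subset_itv_oo_cc|exact: D1|exact: D2].
have wI : wint p q n%:R ((1 - y) * N) (y * N) r = expR (N * A x0) * I0.
  rewrite nE /I0 -RintegralZl//; last first.
    apply: (integrable_itvoo (M := 1)) => // x xi.
    rewrite normrM ger0_norm ?expR_ge0//.
    apply: mulr_ile1; [exact: expR_ge0|exact: normr_ge0| |exact: cos_max].
    rewrite expR_le1; apply: mulr_ge0_le0; first exact: ltW.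
    by apply: le_trans (Emax _ xi) _; rewrite oppr_le0 mulr_ge0 ?sqr_ge0// ltW.
  apply: eq_Rintegral => x _; rewrite /wre amp_scale phs_scale mulrA -expRD.
  by congr (expR _ * cos _); ring.
have step1 := saddle_cut.
have step2 := @laplace_compare R (fun x => A x - A x0) (fun x => B x - B x0)
  N x0 k l m d eta (N * B x0) N0 k0 kl d0 eta0 cI Emax loc.
have step3 := gauss_rotation m (N * B x0) N0 l0 xx.
have step4 := gauss_real m x0 N0 l0 dPsi oPsi.
rewrite -/I0 in step2; rewrite -/ell -/bet in step3; rewrite -/ell -/cN in step4.
rewrite step4 in step3.
set J := \int[mu]_(x in _) _ in step2 step3.
set ct := cos (N * B x0 - bet / 2) in step3 *.
set P := Psi _ + Psi _ in step3 *.
have step5 : `|ct * (P / cN) - Num.sqrt pi / cN * ct| <= `|P - Num.sqrt pi| / cN.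
  have -> : ct * (P / cN) - Num.sqrt pi / cN * ct = ct * ((P - Num.sqrt pi) / cN).
    by field; rewrite gt_eqF.
  rewrite normrM -[leRHS]mul1r; apply: ler_pM; [exact: normr_ge0|exact: normr_ge0|exact: cos_max|].
  by rewrite normrM normfV (gtr0_norm cN0).
rewrite wI in step1.
set X := expR (N * A x0) in step1 *.
have X0 : 0 <= X by exact: expR_ge0.
set W := pi * krawc _ _ _ _ _ in step1 *.
rewrite -[X * (_ / _) * ct]mulrA; apply: scaled_triangle step2 step3 step5 => //.
by rewrite [leRHS]mulrCA.
Qed.

End Estimate.

(** * Uniformity along the sequences *)

Section LocalExpansion.
Variable R : realType.

Lemma cos_taylor (s x0 : R) :
  `|cos s - cos x0 + sin s * (s - x0)| <= (s - x0) ^+ 2.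
Proof.
pose f t := cos t - cos x0 + sin s * (t - x0).
have df (t : R) : is_derive t 1 f (sin s - sin t).
  refine (is_derive_congr (is_derive_add (is_derive_add (is_derive_cos t)
    (is_derive_const (- cos x0) t)) (is_derive_scale (sin s) (is_derive_add
    (is_derive_var t) (is_derive_const (- x0) t)))) _).
  by ring.
have sin_lip u v : `|sin u - sin v| <= `|u - v| :> R.
  by rewrite -!cosBpihalf (le_trans (cos_lip _ _))// opprB addrA subrK.
have f0 : f x0 = 0 by rewrite /f !subrr mulr0 addr0.
rewrite -[X in `|X|]/(f s) -[f s]subr0 -f0 -[leRHS]real_normK ?num_real// expr2.
have [xs|sx] := leP x0 s.
  rewrite {2}(ger0_norm (_ : 0 <= s - x0)) ?subr_ge0//.
  apply: mvt_bound => // t; first by move=> _; exact: is_derive_continuous (df t).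
  rewrite in_itv /= => /andP[h1 h2]; exists (sin s - sin t) => //.
  by apply: le_trans (sin_lip _ _) _; rewrite !ger0_norm; lra.
rewrite distrC [`|s - x0|]distrC {2}(ger0_norm (_ : 0 <= x0 - s)) ?subr_ge0 ?(ltW sx)//.
apply: mvt_bound => [|t _|t]; first exact: ltW.
  exact: is_derive_continuous (df t).
rewrite in_itv /= => /andP[h1 h2]; exists (sin s - sin t) => //.
by apply: le_trans (sin_lip _ _) _; rewrite [leLHS]ler0_norm ?[leRHS]ger0_norm; lra.
Qed.

(** A quadratic expansion from the continuity of [rho], in quantitative form: [cos s - cos x0] is close to [- sin s (s - x0)], and [sin s * rho s] is
    close to [l]. *)
Lemma local_quad (F rho : R -> R) (x0 x l d M e : R) :
  (forall s, s \in `]0, pi[ -> is_derive s 1 F ((cos s - cos x0) * rho s)) ->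
  (forall s, s \in `]0, pi[ -> `|s - x0| <= d ->
     `|rho s| <= M /\ `|sin s * rho s - l| <= e) ->
  x0 \in `]0, pi[ -> x \in `]0, pi[ -> `|x - x0| <= d ->
  `|F x - F x0 + l * (x - x0) ^+ 2 / 2| <= (e + d * M) * (x - x0) ^+ 2.
Proof.
move=> dF hrho x0pi xpi xd.
pose g s := F s - F x0 + l * (s - x0) ^+ 2 / 2.
have dg (s : R) : s \in `]0, pi[ -> is_derive s 1 g ((cos s - cos x0) * rho s + l * (s - x0)).
  move=> spi; refine (is_derive_congr (is_derive_add (is_derive_add (dF s spi)
    (is_derive_const (- F x0) s)) (is_derive_mul (is_derive_scale l (is_derive_mul
     (is_derive_add (is_derive_var s) (is_derive_const (- x0) s))
     (is_derive_add (is_derive_var s) (is_derive_const (- x0) s))))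
     (is_derive_const 2^-1 s))) _).
  by field.
have bound (s : R) : s \in `]0, pi[ -> `|s - x0| <= `|x - x0| ->
    `|(cos s - cos x0) * rho s + l * (s - x0)| <= (e + d * M) * `|x - x0|.
  move=> spi sx; have sd := le_trans sx xd; have [r1 r2] := hrho s spi sd.
  have M0 : 0 <= M := le_trans (normr_ge0 _) r1.
  have e0 : 0 <= e := le_trans (normr_ge0 _) r2.
  have d0 : 0 <= d := le_trans (normr_ge0 _) sd.
  have -> : (cos s - cos x0) * rho s + l * (s - x0) =
    (cos s - cos x0 + sin s * (s - x0)) * rho s - (sin s * rho s - l) * (s - x0) by ring.
  apply: le_trans (ler_normB _ _) _; rewrite !normrM [leRHS]mulrDl addrC.
  apply: lerD; first by rewrite ler_pM.
  apply: le_trans (_ : d * `|s - x0| * M <= _); last first.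
    by rewrite mulrAC ler_wpM2l ?mulr_ge0.
  rewrite ler_pM//; apply: le_trans (cos_taylor s x0) _.
  by rewrite -real_normK ?num_real// expr2 ler_wpM2r.
have g0 : g x0 = 0 by rewrite /g !subrr expr0n mulr0 mul0r addr0.
rewrite -[X in `|X|]/(g x) -[g x]subr0 -g0.
rewrite -[(x - x0) ^+ 2]real_normK ?num_real// expr2 mulrA.
have pi_sub (u v t : R) : u \in `]0, pi[ -> v \in `]0, pi[ -> u <= t -> t <= v ->
    t \in `]0, pi[.
  rewrite !in_itv /= => /andP[h1 h2] /andP[h3 h4] h5 h6.
  by rewrite (lt_le_trans h1)//= (le_lt_trans h6).
have [xx|xx] := leP x0 x.
  rewrite {2}(ger0_norm (_ : 0 <= x - x0)) ?subr_ge0//.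
  apply: mvt_bound => // t; rewrite in_itv /= => /andP[h1 h2].
    exact: is_derive_continuous (dg t (pi_sub _ _ _ x0pi xpi h1 h2)).
  have tpi := pi_sub _ _ _ x0pi xpi (ltW h1) (ltW h2).
  exists ((cos t - cos x0) * rho t + l * (t - x0)); first exact: dg.
  by apply: bound => //; rewrite !ger0_norm; lra.
rewrite distrC [X in _ <= _ * X]distrC (ger0_norm (_ : 0 <= x0 - x)) ?subr_ge0 ?(ltW xx)//.
apply: mvt_bound => [|t|t]; first exact: ltW.
  rewrite in_itv /= => /andP[h1 h2].
  exact: is_derive_continuous (dg t (pi_sub _ _ _ xpi x0pi h1 h2)).
rewrite in_itv /= => /andP[h1 h2].
have tpi := pi_sub _ _ _ xpi x0pi (ltW h1) (ltW h2).
exists ((cos t - cos x0) * rho t + l * (t - x0)); first exact: dg.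
by apply: bound => //; rewrite [leLHS]ler0_norm ?[leRHS]ler0_norm; lra.
Qed.

End LocalExpansion.

Section Sequences.
Variable R : realType.
Variables p q z y : R.
Hypotheses (p0 : 0 < p) (q0 : 0 < q) (pq1 : p + q = 1).
Hypotheses (z0 : 0 < z) (z1 : z < 1).
Hypotheses (yl : Yminus p q z < y) (yu : y < Yplus p q z).
Variables (zk yk : nat -> R).
Hypotheses (zk_z : zk k @[k --> \oo] --> z) (yk_y : yk k @[k --> \oo] --> y).

Let zN : z != 0. Proof. by rewrite gt_eqF. Qed.
Let u0 := U0_gt0 p0 q0 z0 z1.

Lemma cvg_U0 : U0 p q (zk k) @[k --> \oo] --> U0 p q z.
Proof.
rewrite /U0; apply: continuous_cvg; first exact: sqrt_continuous.
apply: cvgM; last exact: cvgV.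
by apply: cvgM; [exact: cvg_cst|apply: cvgB => //; exact: cvg_cst].
Qed.

Lemma cvg_Yminus : Yminus p q (zk k) @[k --> \oo] --> Yminus p q z.
Proof.
apply: cvgB; last by apply: cvgM; [apply: cvgM => //; exact: cvg_cst|exact: cvg_U0].
by apply: cvgD; [exact: cvg_cst|apply: cvgM => //; exact: cvg_cst].
Qed.

Lemma cvg_Yplus : Yplus p q (zk k) @[k --> \oo] --> Yplus p q z.
Proof.
apply: cvgD; last by apply: cvgM; [apply: cvgM => //; exact: cvg_cst|exact: cvg_U0].
by apply: cvgD; [exact: cvg_cst|apply: cvgM => //; exact: cvg_cst].
Qed.

Lemma near_admissible : \forall k \near \oo,
  [/\ 0 < zk k, zk k < 1, Yminus p q (zk k) < yk k & yk k < Yplus p q (zk k)].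
Proof.
have h1 : \forall k \near \oo, 0 < yk k - Yminus p q (zk k).
  by apply: (cvgr_gt (y - Yminus p q z)); [apply: cvgB => //; exact: cvg_Yminus|rewrite subr_gt0].
have h2 : \forall k \near \oo, 0 < Yplus p q (zk k) - yk k.
  by apply: (cvgr_gt (Yplus p q z - y)); [apply: cvgB => //; exact: cvg_Yplus|rewrite subr_gt0].
near=> k; split.
- by near: k; exact: (cvgr_gt z).
- by near: k; exact: (cvgr_lt z).
- by rewrite -subr_gt0; near: k.
- by rewrite -subr_gt0; near: k.
Unshelve. all: by end_near. Qed.

Local Notation r := (saddle_r p q z).
Local Notation x0 := (saddle_x p q z y).
Local Notation rk k := (saddle_r p q (zk k)).
Local Notation xk k := (saddle_x p q (zk k) (yk k)).

Let r0 : 0 < r. Proof. exact: saddle_r_gt0. Qed.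
Let xpi : x0 \in `]0, pi[. Proof. exact: saddle_x_itv. Qed.

Lemma cvg_saddle_r : rk k @[k --> \oo] --> r.
Proof. by apply: cvgV; [rewrite gt_eqF|exact: cvg_U0]. Qed.

Lemma cvg_saddle_x : xk k @[k --> \oo] --> x0.
Proof.
have cb := saddle_c_bound p0 q0 z0 z1 yl yu.
rewrite /saddle_x; apply: continuous_cvg; first exact: continuous_acos.
rewrite /saddle_c; apply: cvgM.
  apply: cvgN; apply: cvgB; last exact: cvg_cst.
  apply: cvgD; last exact: cvg_cst.
  by apply: cvgM; [apply: cvgB => //; exact: cvg_cst|exact: cvgV].
apply: cvgV; first by rewrite mulf_neq0 ?pnatr_eq0// gt_eqF.
by apply: cvgM; [exact: cvg_cst|exact: cvg_U0].
Qed.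

Section CurvatureLimits.
Context {T : Type} {F : set_system T} {FF : Filter F} {rr xx zz : T -> R}.
Hypotheses (cr : rr t @[t --> F] --> r) (cx : xx t @[t --> F] --> x0)
  (cz : zz t @[t --> F] --> z).

Lemma cvg_cos_comp : cos (xx t) @[t --> F] --> cos x0.
Proof. by apply: continuous_cvg => //; exact: continuous_cos. Qed.

Lemma cvg_sin_comp : sin (xx t) @[t --> F] --> sin x0.
Proof. by apply: continuous_cvg => //; exact: continuous_sin. Qed.

Lemma cvg_sqmod kap : sqmod kap (rr t) (xx t) @[t --> F] --> sqmod kap r x0.
Proof.
have c1 : cos (xx t) + kap * rr t @[t --> F] --> cos x0 + kap * r.
  by apply: cvgD; [exact: cvg_cos_comp|apply: cvgM => //; exact: cvg_cst].
rewrite /sqmod !expr2; under eq_fun do rewrite !expr2.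
by apply: cvgD; apply: cvgM => //; exact: cvg_sin_comp.
Qed.

Lemma cvg_sqmodMV :
  (sqmod (- p) (rr t) (xx t) * sqmod q (rr t) (xx t))^-1 @[t --> F] -->
  (sqmod (- p) r x0 * sqmod q r x0)^-1.
Proof.
apply: cvgV; last by apply: cvgM; exact: cvg_sqmod.
by rewrite mulf_neq0// gt_eqF// sqmod_gt0.
Qed.

Lemma cvg_mul_rr2 (k : R) : k * rr t ^+ 2 @[t --> F] --> k * r ^+ 2.
Proof.
apply: cvgM; first exact: cvg_cst.
by rewrite expr2; under eq_fun do rewrite expr2; exact: cvgM.
Qed.

Lemma cvg_curv_re : curv_re p q (rr t) (xx t) @[t --> F] --> curv_re p q r x0.
Proof.
apply: cvgM; last exact: cvg_sqmodMV.
apply: cvgM; last exact: cvg_sin_comp.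
exact: cvg_mul_rr2.
Qed.

Lemma cvg_curv_im : curv_im p q (zz t) (rr t) (xx t) @[t --> F] --> curv_im p q z r x0.
Proof.
apply: cvgM; last exact: cvg_sqmodMV.
apply: cvgM; first by apply: cvgM => //; exact: cvg_cst.
apply: cvgD; last by apply: cvgM => //; exact: cvg_cst.
apply: cvgM; last exact: cvg_cos_comp.
by apply: cvgB; [exact: cvg_cst|exact: cvg_mul_rr2].
Qed.

End CurvatureLimits.

Lemma cvg_hess_re : hess_re p q (zk k) (yk k) @[k --> \oo] --> hess_re p q z y.
Proof.
apply: cvgM.
  by apply: cvg_sin_comp; exact: cvg_saddle_x.
by apply: cvg_curv_re; [exact: cvg_saddle_r|exact: cvg_saddle_x].
Qed.

Lemma cvg_hess_im : hess_im p q (zk k) (yk k) @[k --> \oo] --> hess_im p q z y.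
Proof.
apply: cvgM.
  by apply: cvg_sin_comp; exact: cvg_saddle_x.
by apply: cvg_curv_im => //; [exact: cvg_saddle_r|exact: cvg_saddle_x].
Qed.

Lemma cvg_hess_norm : hess_norm p q (zk k) (yk k) @[k --> \oo] --> hess_norm p q z y.
Proof.
rewrite /hess_norm; apply: continuous_cvg; first exact: sqrt_continuous.
rewrite !expr2; under eq_fun do rewrite !expr2.
by apply: cvgD; apply: cvgM; (exact: cvg_hess_re || exact: cvg_hess_im).
Qed.

Lemma cvg_decay : decay q (yk k) (rk k) (xk k) @[k --> \oo] --> decay q y r x0.
Proof.
have cr := cvg_saddle_r.
have cX n (f : nat -> R) (a : R) : f k @[k --> \oo] --> a -> f k ^+ n @[k --> \oo] --> a ^+ n.
  move=> fa; elim: n => [|n IH].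
    by rewrite expr0; under eq_fun do rewrite expr0; exact: cvg_cst.
  by rewrite exprS; under eq_fun do rewrite exprS; exact: cvgM.
have q1 : 0 < 1 + q * r by rewrite addr_gt0// mulr_gt0.
apply: cvgM; last first.
  apply: cvgM; last exact: cvg_cst.
  by apply: cX; apply: cvg_sin_comp; exact: cvg_saddle_x.
apply: cvgM.
  by apply: cvgM; [apply: cvgM => //; exact: cvg_cst|exact: cX].
apply: cvgV; first by rewrite gt_eqF// exprn_gt0.
apply: cX; apply: cvgD; first exact: cvg_cst.
by apply: cvgM => //; exact: cvg_cst.
Qed.

(** The factor [rho] of [local_quad] is jointly continuous in the parameters and
    in the angle; convergence along the product of the filter of large [k] with
    the neighbourhoods of [x0] gives one [d] for all large [k]. *)
Lemma near_local_quad (eta : R) : 0 < eta -> exists2 d, 0 < d &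
  \forall k \near \oo, forall x, x \in `]0, pi[ -> `|x - xk k| <= d ->
  let A := amp p q (zk k) (1 - yk k) (yk k) (rk k) in
  let B := phs p q (zk k) (1 - yk k) (yk k) (rk k) in
  `|A x - A (xk k) + hess_re p q (zk k) (yk k) * (x - xk k) ^+ 2 / 2|
     <= eta * (x - xk k) ^+ 2 /\
  `|B x - B (xk k) + hess_im p q (zk k) (yk k) * (x - xk k) ^+ 2 / 2|
     <= eta * (x - xk k) ^+ 2.
Proof.
move=> eta0.
pose F := filter_prod (\oo : set_system nat) (nbhs x0).
have FF : Filter F by exact: filter_prod_filter.
have cr : rk u.1 @[u --> F] --> r.
  by apply: cvg_comp cvg_saddle_r; exact: cvg_fst.
have cz : zk u.1 @[u --> F] --> z by apply: cvg_comp zk_z; exact: cvg_fst.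
have cx : (u.2 : R) @[u --> F] --> x0 by exact: cvg_snd.
have c1 := cvg_curv_re (FF := FF) cr cx.
have c2 := cvg_curv_im (FF := FF) cr cx cz.
have c3 := cvgM (FF := FF) (cvg_sin_comp (FF := FF) cx) c1.
have c4 := cvgM (FF := FF) (cvg_sin_comp (FF := FF) cx) c2.
pose M := `|curv_re p q r x0| + `|curv_im p q z r x0| + 1.
have M0 : 0 < M by rewrite ltr_wpDl// addr_ge0.
have e4 : 0 < eta / 4 by rewrite divr_gt0.
have near_norm (f : nat * R -> R) (a : R) : f u @[u --> F] --> a ->
    `|a| < M -> \forall u \near F, `|f u| <= M.
  by move=> fa aM; exact: (cvgr_norm_le (FF := FF) a fa M aM).
have aM1 : `|curv_re p q r x0| < M by rewrite /M -addrA ltrDl ltr_wpDl.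
have aM2 : `|curv_im p q z r x0| < M.
  by rewrite /M [X in X + 1]addrC -addrA ltrDl ltr_wpDl.
have n1 := near_norm _ _ c1 aM1.
have n2 := near_norm _ _ c2 aM2.
have n3 := cvgr_dist_le (FF := FF) _ _ c3 _ e4.
have n4 := cvgr_dist_le (FF := FF) _ _ c4 _ e4.
have nn : \forall u \near F, [/\ `|curv_re p q (rk u.1) u.2| <= M,
   `|curv_im p q (zk u.1) (rk u.1) u.2| <= M,
   `|hess_re p q z y - sin u.2 * curv_re p q (rk u.1) u.2| <= eta / 4 &
   `|hess_im p q z y - sin u.2 * curv_im p q (zk u.1) (rk u.1) u.2| <= eta / 4].
  by near=> u; split; near: u; [exact: n1|exact: n2|exact: n3|exact: n4].
move: nn => [[Q1 Q2] [/= oQ1 nQ2] Q12].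
have [e /= e0 eQ2] := nQ2.
exists (Num.min (e / 2) (eta / 2 / M)).
  by rewrite lt_min !divr_gt0.
have m1 := cvgr_dist_le _ _ cvg_hess_re _ e4.
have m2 := cvgr_dist_le _ _ cvg_hess_im _ e4.
have e20 : 0 < e / 2 by rewrite divr_gt0.
have m3 := cvgr_dist_lt _ _ cvg_saddle_x _ e20.
near=> k.
have hk : Q1 k by near: k; exact: oQ1.
have [k1 k2 k3 k4] : [/\ 0 < zk k, zk k < 1, Yminus p q (zk k) < yk k & yk k < Yplus p q (zk k)].
  by near: k; exact: near_admissible.
have hl : `|hess_re p q z y - hess_re p q (zk k) (yk k)| <= eta / 4 by near: k; exact: m1.
have hm : `|hess_im p q z y - hess_im p q (zk k) (yk k)| <= eta / 4 by near: k; exact: m2.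
have hx : `|x0 - xk k| < e / 2 by near: k; exact: m3.
set d := Num.min _ _.
have dM : d * M <= eta / 2.
  by rewrite -ler_pdivlMr// ge_min lexx orbT.
have de : d <= e / 2 by rewrite ge_min lexx.
have inQ s : `|s - xk k| <= d -> [/\ `|curv_re p q (rk k) s| <= M,
   `|curv_im p q (zk k) (rk k) s| <= M,
   `|sin s * curv_re p q (rk k) s - hess_re p q (zk k) (yk k)| <= eta / 2 &
   `|sin s * curv_im p q (zk k) (rk k) s - hess_im p q (zk k) (yk k)| <= eta / 2].
  move=> sd; have hs : Q2 s.
    apply: eQ2 => /=.
    have := ler_normD (x0 - xk k) (xk k - s); rewrite addrA subrK [`|xk k - s|]distrC.
    by move=> h; apply: le_lt_trans h _; lra.
  have [/= h1 h2 h3 h4] := Q12 (k, s) (conj hk hs).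
  split => //.
    have := ler_normB (hess_re p q z y - hess_re p q (zk k) (yk k))
      (hess_re p q z y - sin s * curv_re p q (rk k) s).
    rewrite (_ : _ - _ - _ = sin s * curv_re p q (rk k) s - hess_re p q (zk k) (yk k)); last by ring.
    by move=> h; apply: le_trans h _; lra.
  have := ler_normB (hess_im p q z y - hess_im p q (zk k) (yk k))
    (hess_im p q z y - sin s * curv_im p q (zk k) (rk k) s).
  rewrite (_ : _ - _ - _ = sin s * curv_im p q (zk k) (rk k) s - hess_im p q (zk k) (yk k)); last by ring.
  by move=> h; apply: le_trans h _; lra.
have rk0 : 0 < rk k := saddle_r_gt0 p0 q0 k1 k2.
have xkpi : xk k \in `]0, pi[ := saddle_x_itv p0 q0 k1 k2 k3 k4.
have zkE := saddle_zE p0 q0 k1 k2.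
have ykE := saddle_yE p0 q0 k1 k2 k3 k4.
move=> x xx xd /=.
have spos (s : R) : s \in `]0, pi[ -> 0 <= sin s.
  by rewrite in_itv /= => /andP[h1 h2]; apply: sin_ge0_pi; rewrite !ltW.
have fin (u : R) : u <= (eta / 2 + d * M) * (x - xk k) ^+ 2 -> u <= eta * (x - xk k) ^+ 2.
  move=> h; apply: le_trans h _; rewrite ler_wpM2r ?sqr_ge0//.
  by rewrite [leRHS]splitr lerD2l.
have dA (s : R) : s \in `]0, pi[ ->
    is_derive s 1 (amp p q (zk k) (1 - yk k) (yk k) (rk k))
      ((cos s - cos (xk k)) * curv_re p q (rk k) s).
  move=> spi; have D1 := sqmod_gt0 (- p) (rk k) spi; have D2 := sqmod_gt0 q (rk k) spi.
  rewrite -(phst_saddle p0 q0 pq1 rk0 zkE ykE D1 D2).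
  exact: is_derive_ampx.
have dB (s : R) : s \in `]0, pi[ ->
    is_derive s 1 (phs p q (zk k) (1 - yk k) (yk k) (rk k))
      ((cos s - cos (xk k)) * curv_im p q (zk k) (rk k) s).
  move=> spi; have D1 := sqmod_gt0 (- p) (rk k) spi; have D2 := sqmod_gt0 q (rk k) spi.
  rewrite -(ampt_saddle p0 q0 pq1 rk0 zkE ykE D1 D2).
  exact: (is_derive_phsx _ _ _ D1 D2 (spos _ spi) rk0).
have bA (s : R) : s \in `]0, pi[ -> `|s - xk k| <= d -> `|curv_re p q (rk k) s| <= M /\
    `|sin s * curv_re p q (rk k) s - hess_re p q (zk k) (yk k)| <= eta / 2.
  by move=> _ /inQ[].
have bB (s : R) : s \in `]0, pi[ -> `|s - xk k| <= d -> `|curv_im p q (zk k) (rk k) s| <= M /\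
    `|sin s * curv_im p q (zk k) (rk k) s - hess_im p q (zk k) (yk k)| <= eta / 2.
  by move=> _ /inQ[].
have qA := local_quad dA bA xkpi xx xd.
have qB := local_quad dB bB xkpi xx xd.
by split; apply: fin; [exact: qA|exact: qB].
Unshelve. all: by end_near. Qed.

End Sequences.

Section ErrorTerms.
Variable R : realType.
Implicit Types (s Q c r k g l d : R).

(** The next three lemmas bound the error terms of [saddle_estimate], with
    [s ^ 2] for [N] and multiplied by [c], which is of order [s]. *)
Lemma cut_term s Q c r rk k g gk : 0 < s -> 0 < k -> 0 < g -> g <= gk ->
  0 <= c -> c <= s * Q -> 0 <= rk -> rk <= r ->
  c * (4 * (1 + rk) * expR (- (s ^+ 2 * k * gk ^+ 2))) <=
  4 * Q * (1 + r) / (k * g ^+ 2) / s.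
Proof.
move=> s0 k0 g0 gk_ge c0 cQ rk0 rkr.
set w := s ^+ 2 * k * g ^+ 2.
have w0 : 0 < w by rewrite !mulr_gt0// exprn_gt0.
have hw : expR (- (s ^+ 2 * k * gk ^+ 2)) <= w^-1.
  apply: le_trans (_ : expR (- w) <= _).
    rewrite ler_expR lerN2 ler_wpM2l//; first by apply: mulr_ge0; [exact: sqr_ge0|exact: ltW].
    by rewrite ler_sqr ?nnegrE ?(ltW g0)// (le_trans (ltW g0)).
  rewrite expRN lef_pV2 ?posrE ?expR_gt0//.
  by apply: le_trans (expR_ge1Dx _); rewrite lerDr.
have -> : 4 * Q * (1 + r) / (k * g ^+ 2) / s = (s * Q) * (4 * (1 + r) * w^-1).
  by rewrite /w; field; rewrite !gt_eqF.
have h4 : 0 <= 4 * (1 + rk) by rewrite mulr_ge0// addr_ge0.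
apply: ler_pM => //; first by rewrite mulr_ge0// expR_ge0.
apply: ler_pM; [exact: h4|exact: expR_ge0| |exact: hw].
by rewrite ler_pM2l// lerD2l.
Qed.

Lemma laplace_term s Q c d eta C : 0 < s -> 0 < d -> 0 <= eta -> 0 <= C ->
  0 <= c -> c <= s * Q ->
  c * ((2 * eta + 2 / (d ^+ 2 * s ^+ 2)) * C * (pi / s)) <=
  2 * eta * (Q * C * pi) + 2 / d ^+ 2 * (Q * C * pi) / s ^+ 2.
Proof.
move=> s0 d0 eta0 C0 c0 cQ; have p0 := pi_gt0 R.
have -> : 2 * eta * (Q * C * pi) + 2 / d ^+ 2 * (Q * C * pi) / s ^+ 2 =
  (s * Q) * ((2 * eta + 2 / (d ^+ 2 * s ^+ 2)) * C * (pi / s)).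
  by field; rewrite !gt_eqF.
apply: ler_wpM2r => //; apply: mulr_ge0; last by rewrite divr_ge0 ?ltW.
apply: mulr_ge0 => //; apply: addr_ge0; first exact: mulr_ge0.
by apply: divr_ge0 => //; apply: mulr_ge0; exact: sqr_ge0.
Qed.

Lemma endpoint_term s Q c l lk g u v : 0 < s -> 0 < l -> l <= lk -> 0 < g ->
  g <= u -> g <= v -> 0 <= c -> c <= s * Q ->
  c * (2 / (s ^+ 2 * lk) * (u^-1 + v^-1)) <= 4 * Q / (l * g) / s.
Proof.
move=> s0 l0 llk g0 gu gv c0 cQ.
have lk0 : 0 < lk by rewrite (lt_le_trans l0).
have u0 : 0 < u by rewrite (lt_le_trans g0).
have v0 : 0 < v by rewrite (lt_le_trans g0).
have -> : 4 * Q / (l * g) / s = (s * Q) * (2 / (s ^+ 2 * l) * (g^-1 + g^-1)).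
  by field; rewrite !gt_eqF.
have hu : u^-1 <= g^-1 by rewrite lef_pV2.
have hv : v^-1 <= g^-1 by rewrite lef_pV2.
have iu : 0 <= u^-1 by rewrite invr_ge0 ltW.
have iv : 0 <= v^-1 by rewrite invr_ge0 ltW.
have s2 : 0 < s ^+ 2 by rewrite exprn_gt0.
have h0 : 0 <= 2 / (s ^+ 2 * lk).
  by apply: divr_ge0 => //; apply: mulr_ge0; exact: ltW.
apply: ler_pM => //; first by rewrite mulr_ge0// addr_ge0.
apply: ler_pM; [exact: h0|exact: addr_ge0| |exact: lerD].
by rewrite ler_pM2l// lef_pV2 ?posrE ?(mulr_gt0 s2)// ler_pM2l.
Qed.

Lemma div_small (C e s : R) : 0 < e -> 0 < s -> C / e <= s -> C / s <= e.
Proof. by move=> e0 s0; rewrite !ler_pdivrMr// mulrC. Qed.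

(** [T] is the modulus of [K]; the coefficient of the cosine in the integral is
    [2 pi T]. *)
Lemma normalization (N ell X kw c Err eps0 : R) : 0 < N -> 0 < ell -> 0 <= X ->
  0 < eps0 -> let cN := Num.sqrt (N * ell / 2) in
  let T := Num.sqrt N^-1 / Num.sqrt (2 * pi) * X / Num.sqrt ell in
  `|pi * kw - X * (Num.sqrt pi / cN) * c| <= X * Err ->
  cN * Err <= eps0 -> `|kw - 2 * T * c| <= eps0 * (T + T).
Proof.
move=> N0 ell0 X0 e00 cN T h1 h2; have p0 := pi_gt0 R.
have cN0 : 0 < cN by rewrite sqrtr_gt0 divr_gt0// mulr_gt0.
have sp0 : 0 < Num.sqrt (pi : R) by rewrite sqrtr_gt0.
have sp1 : 1 <= Num.sqrt (pi : R).
  by rewrite -sqrtr1 ler_wsqrtr// (le_trans _ (pi_ge2 R))// ler1n.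
have TE : 2 * pi * T = X * (Num.sqrt pi / cN).
  rewrite /T /cN sqrtrV ?(ltW N0)// sqrtrM// [Num.sqrt (N * ell / 2)]sqrtrM; last first.
    by rewrite mulr_ge0 ?ltW.
  rewrite [Num.sqrt (N * ell)]sqrtrM ?(ltW N0)// [Num.sqrt 2^-1]sqrtrV//.
  have e2 : Num.sqrt 2 ^+ 2 = 2 :> R by rewrite sqr_sqrtr.
  have ep : Num.sqrt pi ^+ 2 = pi :> R by rewrite sqr_sqrtr// ltW.
  have n1 : Num.sqrt N != 0 by rewrite gt_eqF// sqrtr_gt0.
  have n2 : Num.sqrt ell != 0 by rewrite gt_eqF// sqrtr_gt0.
  have n3 : Num.sqrt 2 != 0 :> R by rewrite gt_eqF// sqrtr_gt0.
  have n4 : Num.sqrt pi != 0 :> R by rewrite gt_eqF.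
  rewrite -{1}ep -{1}e2.
  move: (Num.sqrt 2) (Num.sqrt pi) (Num.sqrt N) (Num.sqrt ell) n1 n2 n3 n4.
  move=> b c' a' e n1 n2 n3 n4; field.
  by rewrite n1 n2 n3 n4.
have T0 : 0 <= T.
  by rewrite /T; do !(apply: mulr_ge0 || apply: divr_ge0 || rewrite ?invr_ge0 ?sqrtr_ge0).
have piT : pi * (kw - 2 * T * c) = pi * kw - X * (Num.sqrt pi / cN) * c.
  by rewrite -TE; ring.
rewrite -(ler_pM2l p0) -{1}(gtr0_norm p0) -normrM piT; apply: le_trans h1 _.
have -> : X = 2 * pi * T * cN / Num.sqrt pi.
  by rewrite TE; field; rewrite !gt_eqF.
have -> : 2 * pi * T * cN / Num.sqrt pi * Err = 2 * pi * T * (cN * Err / Num.sqrt pi).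
  by field; rewrite gt_eqF.
have -> : pi * (eps0 * (T + T)) = 2 * pi * T * eps0 by ring.
apply: ler_wpM2l; first by rewrite !mulr_ge0// ltW.
rewrite ler_pdivrMr//; apply: le_trans h2 _.
by rewrite ler_peMr// ltW.
Qed.

Lemma dist_gap (g u v a : R) : 2 * g <= u -> 2 * g <= a - u -> `|u - v| < g ->
  g <= v /\ g <= a - v.
Proof. by move=> h1 h2; rewrite ltr_distl => /andP[h3 h4]; split; lra. Qed.

Lemma quarter_le (k l : R) : k <= l / 4 -> 2 * k <= l / 2.
Proof. by move=> ?; lra. Qed.

Lemma half_le (k l : R) : k / 2 <= l -> k / 4 <= l / 2.
Proof. by move=> ?; lra. Qed.

Lemma krawtchoukE (p q y : R) (N n : nat) :
  krawtchouk p q N n (y * N%:R) = krawc p q ((1 - y) * N%:R) (y * N%:R) n.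
Proof.
rewrite /krawtchouk /krawc; apply: eq_bigr => k _.
by rewrite mulrBl mul1r.
Qed.

End ErrorTerms.

Theorem mainTheorem10 (R : realType) (p q : R)
    (p_gt0 : 0 < p) (p_lt1 : p < 1) (q_gt0 : 0 < q) (q_lt1 : q < 1)
    (pq1 : p + q = 1)
    (z y : R) (z_gt0 : 0 < z) (z_lt1 : z < 1)
    (y_gtY : Yminus p q z < y) (y_ltY : y < Yplus p q z)
    (N n : nat -> nat) (zk yk x eps : nat -> R)
    (N_oo : N k @[k --> \oo] --> \oo)
    (zk_z : zk k @[k --> \oo] --> z) (yk_y : yk k @[k --> \oo] --> y)
    (epsE : forall k, eps k = (N k)%:R^-1)
    (xE : forall k, x k = yk k * (N k)%:R)
    (nE : forall k, (n k)%:R = zk k * (N k)%:R) :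
  asymp_sum (fun k => (krawtchouk p q (N k) (n k) (x k))%:C)
            (fun k => Kplus p q (eps k) (yk k) (zk k))
            (fun k => Kminus p q (eps k) (yk k) (zk k)).
Proof.
rewrite /asymp_sum; apply/eqoP => e e0.
have e5 : 0 < e / 5 by rewrite divr_gt0.
have [Psi [dPsi oPsi lPsi]] := gauss_primitive R.
pose r := saddle_r p q z.
have r0 : 0 < r := saddle_r_gt0 p_gt0 q_gt0 z_gt0 z_lt1.
pose x0 := saddle_x p q z y.
have xpi : x0 \in `]0, pi[ := saddle_x_itv p_gt0 q_gt0 z_gt0 z_lt1 y_gtY y_ltY.
pose l := hess_re p q z y.
have l0 : 0 < l := hess_re_gt0 p_gt0 q_gt0 z_gt0 z_lt1 y_gtY y_ltY.
pose ell := hess_norm p q z y.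
have ell0 : 0 < ell := ell_gt0 _ l0.
(* half of the limit gap is a lower bound for the gaps of large index *)
pose g := saddle_gap p q z y / 2.
have g0 : 0 < g.
  by rewrite divr_gt0//; exact: (saddle_gap_gt0 p_gt0 q_gt0 z_gt0 z_lt1 y_gtY y_ltY).
have /andP[y0 y1] := saddle_y01 p_gt0 q_gt0 pq1 z_gt0 z_lt1 y_gtY y_ltY.
have s0 : 0 < sin x0 by apply: sin_gt0_pi; move: xpi; rewrite in_itv.
pose D := decay q y r x0.
have D0 : 0 < D.
  by rewrite /D /decay; apply: mulr_gt0; rewrite divr_gt0// ?exprn_gt0 ?addr_gt0 ?mulr_gt0 ?exprn_gt0.
pose kap := Num.min (D / 2) (l / 4).
have kap0 : 0 < kap by rewrite lt_min !divr_gt0.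
have kapD : kap <= D / 2 by rewrite ge_min lexx.
have kapl : kap <= l / 4 by rewrite ge_min lexx orbT.
pose C := kap^-1 + 2 * kap^-1 ^+ 2.
have C0 : 0 < C by rewrite addr_gt0 ?mulr_gt0 ?exprn_gt0 ?invr_gt0.
pose Q := Num.sqrt ((ell + 1) / 2).
have Q0 : 0 < Q by rewrite sqrtr_gt0 divr_gt0// addr_gt0.
have QC0 : 0 < Q * C * pi by rewrite !mulr_gt0// pi_gt0.
(* the value for which the term in [eta] contributes e / 5 to the error *)
pose eta := e / 5 / (2 * (Q * C * pi)).
have eta0 : 0 < eta by rewrite divr_gt0// mulr_gt0.
have etaE : 2 * eta * (Q * C * pi) = e / 5.
  by rewrite /eta; move: QC0; set QC := Q * C * pi => QC0; field; rewrite gt_eqF.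
have [d d0 nquad] := near_local_quad p_gt0 q_gt0 pq1 z_gt0 z_lt1 y_gtY y_ltY zk_z yk_y eta0.
have [X0 X0P] : exists X0 : R, forall u, X0 <= u -> `|Psi u - Num.sqrt pi / 2| <= e / 5 / 2.
  have e52 : 0 < e / 5 / 2 by rewrite divr_gt0.
  have := cvgr_dist_le _ _ lPsi _ e52.
  case=> X [_ XP]; exists (X + 1) => u Xu; rewrite distrC; apply: XP.
  by rewrite (lt_le_trans _ Xu)// ltrDl.
pose Q1 := Num.sqrt (ell / 4).
have Q10 : 0 < Q1 by rewrite sqrtr_gt0 divr_gt0.
(* the error terms other than that in [eta] are at most C1 / s, C2 / s ^ 2 and
   C3 / s, plus a Gaussian tail, where [s] is the square root of [N k] *)
pose C1 := 4 * Q * (1 + (r + 1)) / (kap * g ^+ 2).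
pose C2 := 2 / d ^+ 2 * (Q * C * pi).
pose C3 := 4 * Q / (l / 2 * g).
have near_sqrt (b : R) : \forall k \near \oo, b <= Num.sqrt (N k)%:R.
  have hN : \forall k \near \oo, (`|Num.ceil (b ^+ 2)|%N <= N k)%N.
    exact: (N_oo _ (nbhs_infty_ge _)).
  apply: (filterS _ hN) => k /= hk.
  rewrite (le_trans (ler_norm b))// -sqrtr_sqr ler_wsqrtr//.
  apply: (le_trans (ceil_ge _)); rewrite -(ler_nat R) in hk; apply: le_trans hk.
  by rewrite natr_absz ler_int ler_norm.
have cr := cvg_saddle_r p_gt0 q_gt0 z_gt0 z_lt1 zk_z.
have cx := cvg_saddle_x p_gt0 q_gt0 z_gt0 z_lt1 y_gtY y_ltY zk_z yk_y.
have cl := cvg_hess_re p_gt0 q_gt0 z_gt0 z_lt1 y_gtY y_ltY zk_z yk_y.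
have cell := cvg_hess_norm p_gt0 q_gt0 z_gt0 z_lt1 y_gtY y_ltY zk_z yk_y.
have cD := cvg_decay p_gt0 q_gt0 z_gt0 z_lt1 y_gtY y_ltY zk_z yk_y.
have nadm := near_admissible z_gt0 z_lt1 y_gtY y_ltY zk_z yk_y.
have rr1 : r < r + 1 by rewrite ltrDl.
have nr := cvgr_le _ cr _ rr1.
have nx := cvgr_dist_lt _ _ cx _ g0.
have ll2 : l / 2 < l by rewrite ltr_pdivrMr// ltr_pMr// ltr1n.
have nl := cvgr_ge _ cl _ ll2.
have ell1 : ell < ell + 1 by rewrite ltrDl.
have nell1 := cvgr_le _ cell _ ell1.
have ell2 : ell / 2 < ell by rewrite ltr_pdivrMr// ltr_pMr// ltr1n.
have nell2 := cvgr_ge _ cell _ ell2.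
have DD2 : D / 2 < D by rewrite ltr_pdivrMr// ltr_pMr// ltr1n.
have nD := cvgr_ge _ cD _ DD2.
near=> k.
have [k1 k2 k3 k4] : [/\ 0 < zk k, zk k < 1, Yminus p q (zk k) < yk k & yk k < Yplus p q (zk k)].
  by near: k; exact: nadm.
set s := Num.sqrt (N k)%:R : R.
have s1 : 1 <= s by rewrite /s; near: k; exact: near_sqrt.
have sgt0 : 0 < s by rewrite (lt_le_trans ltr01).
have Ngt0 : 0 < (N k)%:R :> R by rewrite -sqrtr_gt0.
have s2 : s ^+ 2 = (N k)%:R by rewrite sqr_sqrtr// ltW.
have hr : saddle_r p q (zk k) <= r + 1 by near: k; exact: nr.
have hx : `|x0 - saddle_x p q (zk k) (yk k)| < g by near: k; exact: nx.
have hl : l / 2 <= hess_re p q (zk k) (yk k) by near: k; exact: nl.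
have hell1 : hess_norm p q (zk k) (yk k) <= ell + 1 by near: k; exact: nell1.
have hell2 : ell / 2 <= hess_norm p q (zk k) (yk k) by near: k; exact: nell2.
have hD : D / 2 <= decay q (yk k) (saddle_r p q (zk k)) (saddle_x p q (zk k) (yk k)).
  by near: k; exact: nD.
have hs1 : C1 / (e / 5) <= s by rewrite /s; near: k; exact: near_sqrt.
have hs2 : C2 / (e / 5) <= s by rewrite /s; near: k; exact: near_sqrt.
have hs3 : C3 / (e / 5) <= s by rewrite /s; near: k; exact: near_sqrt.
have hs4 : X0 / (Q1 * g) <= s by rewrite /s; near: k; exact: near_sqrt.
have quad (u : R) : u \in `]0, pi[ -> `|u - saddle_x p q (zk k) (yk k)| <= d ->
  `|amp p q (zk k) (1 - yk k) (yk k) (saddle_r p q (zk k)) u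
    - amp p q (zk k) (1 - yk k) (yk k) (saddle_r p q (zk k)) (saddle_x p q (zk k) (yk k))
    + hess_re p q (zk k) (yk k) * (u - saddle_x p q (zk k) (yk k)) ^+ 2 / 2|
    <= eta * (u - saddle_x p q (zk k) (yk k)) ^+ 2 /\
  `|phs p q (zk k) (1 - yk k) (yk k) (saddle_r p q (zk k)) u
    - phs p q (zk k) (1 - yk k) (yk k) (saddle_r p q (zk k)) (saddle_x p q (zk k) (yk k))
    + hess_im p q (zk k) (yk k) * (u - saddle_x p q (zk k) (yk k)) ^+ 2 / 2|
    <= eta * (u - saddle_x p q (zk k) (yk k)) ^+ 2.
  by move: u; near: k; exact: nquad.
set xk := saddle_x p q (zk k) (yk k) in hx hD quad *.
set ek := hess_norm p q (zk k) (yk k) in hell1 hell2 *.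
have ek0 : 0 < ek by rewrite (lt_le_trans _ hell2)// divr_gt0.
have gx : g <= xk /\ g <= pi - xk.
  have h1 : 2 * g <= x0.
    by rewrite /g mulrC divfK ?pnatr_eq0// ge_min lexx.
  have h2 : 2 * g <= pi - x0.
    by rewrite /g mulrC divfK ?pnatr_eq0// ge_min lexx orbT.
  exact: dist_gap h1 h2 hx.
have [gx1 gx2] := gx.
have hgap : g <= saddle_gap p q (zk k) (yk k) by rewrite le_min gx1 gx2.
have rk0 := saddle_r_gt0 p_gt0 q_gt0 k1 k2.
have kl : 2 * kap <= hess_re p q (zk k) (yk k) by apply: le_trans hl; exact: quarter_le.
have est := saddle_estimate p_gt0 q_gt0 pq1 k1 k2 k3 k4 Ngt0 kap0 (nE k)
  (le_trans kapD hD) d0 (ltW eta0) kl quad dPsi oPsi.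
set cN := Num.sqrt ((N k)%:R * ek / 2) in est.
have cNE : cN = s * Num.sqrt (ek / 2) by rewrite /cN -mulrA sqrtrM// ltW.
have cN0 : 0 <= cN by exact: sqrtr_ge0.
have cNQ : cN <= s * Q by rewrite cNE ler_pM2l// ler_wsqrtr// ler_pM2r.
have cNQ1 : s * Q1 <= cN.
  by rewrite cNE ler_pM2l// ler_wsqrtr// half_le.
have big u : g <= u -> `|Psi (cN * u) - Num.sqrt pi / 2| <= e / 5 / 2.
  move=> gu; apply: X0P; apply: le_trans (_ : s * Q1 * g <= _).
    by rewrite -mulrA -ler_pdivrMr// mulr_gt0.
  apply: ler_pM; [|exact: ltW|exact: cNQ1|exact: gu].
  by apply: mulr_ge0; exact: ltW.
have T4 : `|Psi (cN * (pi - xk)) + Psi (cN * xk) - Num.sqrt pi| <= e / 5.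
  have -> : Psi (cN * (pi - xk)) + Psi (cN * xk) - Num.sqrt pi =
    (Psi (cN * (pi - xk)) - Num.sqrt pi / 2) + (Psi (cN * xk) - Num.sqrt pi / 2) by field.
  by apply: le_trans (ler_normD _ _) _; rewrite (splitr (e / 5)); apply: lerD; exact: big.
have T1 := cut_term sgt0 kap0 g0 hgap cN0 cNQ (ltW rk0) hr.
have T2 := laplace_term sgt0 d0 (ltW eta0) (ltW C0) cN0 cNQ.
have l20 : 0 < l / 2 by rewrite divr_gt0.
have T3 := endpoint_term sgt0 l20 hl g0 gx2 gx1 cN0 cNQ.
rewrite -/C1 in T1; rewrite etaE -/C2 in T2; rewrite -/C3 in T3.
have C20 : 0 <= C2 by rewrite mulr_ge0 ?divr_ge0 ?sqr_ge0// ltW.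
have B1 : C1 / s <= e / 5 := div_small e5 sgt0 hs1.
have B3 : C3 / s <= e / 5 := div_small e5 sgt0 hs3.
have B2 : C2 / s ^+ 2 <= e / 5.
  apply: le_trans (div_small e5 sgt0 hs2); rewrite ler_wpM2l// lef_pV2 ?posrE ?exprn_gt0//.
  by rewrite expr2 ler_peMr// ltW.
rewrite s2 in T1 T2 T3 B2.
have cNgt0 : 0 < cN by rewrite sqrtr_gt0 divr_gt0// mulr_gt0.
have err : cN * (4 * (1 + saddle_r p q (zk k)) *
      expR (- ((N k)%:R * kap * saddle_gap p q (zk k) (yk k) ^+ 2)) +
    (2 * eta + 2 / (d ^+ 2 * (N k)%:R)) * C * (pi / s) +
    2 / ((N k)%:R * hess_re p q (zk k) (yk k)) * ((pi - xk)^-1 + xk^-1) +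
    `|Psi (cN * (pi - xk)) + Psi (cN * xk) - Num.sqrt pi| / cN) <= e.
  rewrite mulrDr [cN * (_ + _ + _)]mulrDr [cN * (_ + _)]mulrDr.
  rewrite [cN * (_ / cN)]mulrCA divff ?gt_eqF// mulr1.
  apply: le_trans (lerD (lerD (lerD T1 T2) T3) T4) _.
  rewrite [leRHS](_ : e = e / 5 + (e / 5 + e / 5) + e / 5 + e / 5); last by field.
  by rewrite lerD2r; apply: lerD => //; apply: lerD => //; rewrite lerD2l.
have key := normalization Ngt0 ek0 (expR_ge0 _) e0 est err.
rewrite /Kplus /Kminus.
rewrite (K_saddle p_gt0 q_gt0 pq1 k1 k2 k3 k4 (eps k) (or_introl erefl)).
rewrite (K_saddle p_gt0 q_gt0 pq1 k1 k2 k3 k4 (eps k) (or_intror erefl)).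
rewrite xE krawtchoukE epsE invrK -/xk -/ek.
set T := _ / Num.sqrt ek in key *.
set kw := krawc _ _ _ _ _ in key *.
set th := _ - _ / 2 in key *.
have T0 : 0 <= T.
  by rewrite /T; do !(apply: mulr_ge0 || apply: divr_ge0 || rewrite ?invr_ge0 ?sqrtr_ge0 ?expR_ge0).
have cabT (sg : R) : sg ^+ 2 = 1 -> cabs (T%:C * (cos th +i* (sg * sin th) : R[i])) = T.
  move=> sg2; rewrite !cE !mul0r subr0 addr0 cabsE.
  have -> : (T * cos th) ^+ 2 + (T * (sg * sin th)) ^+ 2 = T ^+ 2.
    by have h := sin2cos2 th; ring: sg2 h.
  by rewrite sqrtr_sqr ger0_norm.
rewrite !cabT ?sqrrN ?expr1n// [`|T + T|]ger0_norm ?addr_ge0//.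
apply: le_trans key; rewrite ger0_norm; last first.
  by rewrite /cabs normc_def /= sqrtr_ge0.
rewrite (_ : _ - _ = (kw - 2 * T * cos th)%:C) ?cabs_real//.
by rewrite !cE; congr (_ +i* _); ring.
Unshelve. all: by end_near. Qed.
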